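(* Let $N\ge 2$ be an integer, let $B\subset\mathbb{R}^N$ be the open unit ball, and let $0<\delta<N/2$. For $\lambda>0$ consider the problem $$(P_\lambda)\qquad -\Delta U=\frac{\lambda+\delta|\nabla U|^2}{1-U},\quad U>0\ \text{ in } B,\qquad U=0\ \text{ on }\partial B .$$ Set $\lambda^*:=N-1-\delta$ and $U^*(r):=1-r$ (where $r=|x|$). Then the following hold. (i) If $N\ge 3$ and $\delta\le (N-2-2\sqrt{N-1})/2$, then the bifurcation diagram of $(P_\lambda)$ is of Type I, with limit value $\lambda^*$. Furthermore, $(\lambda^*,U^* )$ is the unique rupture solution of $(P_\lambda)$ (that is, $U^*$ is a rupture solution of $(P_{\lambda^*})$, and if $\lambda>0$ and $U$ is a rupture solution of $(P_\lambda)$, then $\lambda=\lambda^*$ and $U=U^*$), and $(P_\lambda)$ has exactly one radial regular solution for each fixed $\lambda\in(0,\lambda^* )$. (ii) If either $N\ge 3$ and $\delta>(N-2-2\sqrt{N-1})/2$, or $N=2$, then the bifurcation diagram of $(P_\lambda)$ is of Type II, with limit value $\lambda^*$. Furthermore, $(\lambda^*,U^* )$ is the unique rupture solution of $(P_\lambda)$ (that is, $U^*$ is a rupture solution of $(P_{\lambda^*})$, and if $\lambda>0$ and $U$ is a rupture solution of $(P_\lambda)$, then $\lambda=\lambda^*$ and $U=U^*$), and $(P_{\lambda^*})$ has infinitely many radial regular solutions. In particular, this occurs for $3\le N\le 6$ (since then $(N-2-2\sqrt{N-1})/2<0$).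
   Context: Solutions are radial functions $U=U(r)$, $r=|x|$. A regular solution of $(P_\lambda)$ is a classical solution with $0<U<1$ in $B$. A radial regular solution satisfies $$U''+\tfrac{N-1}{r}U'+\tfrac{\lambda+\delta (U')^2}{1-U}=0\ (0<r<1),\quad U(0)=\alpha,\ U'(0)=0,\ U(1)=0,$$ for some $\alpha\in(0,1)$. A rupture solution of $(P_\lambda)$ is a radial function $U$, continuous on $\overline B$, with $U(0)=1$ and $0<U<1$ in $B\setminus\{0\}$, $U=0$ on $\partial B$, satisfying the equation classically in $B\setminus\{0\}$ (the equation is singular at the origin). Bifurcation diagram: for fixed $\delta>0$, for each $\alpha\in(0,1)$ there is exactly one value $\lambda=\lambda(\alpha)>0$ for which the boundary value problem $$U''+\tfrac{N-1}{r}U'+\tfrac{\lambda+\delta (U')^2}{1-U}=0\ (0<r<1),\quad U(0)=\alpha,\ U'(0)=0,\ U(1)=0$$ has a solution. The bifurcation diagram (curve) is $\mathcal{C}=\{(\alpha,\lambda(\alpha)):0<\alpha<1\}$. $\mathcal C$ is of Type I if there is $\lambda^*>0$ such that $\lambda(\alpha)\to\lambda^*$ as $\alpha\to1$ and $\alpha\mapsto\lambda(\alpha)$ is strictly increasing on $(0,1)$. $\mathcal C$ is of Type II if there is $\lambda^*>0$ such that $\lambda(\alpha)\to\lambda^*$ as $\alpha\to 1$ and $\lambda(\alpha)$ oscillates around $\lambda^*$, i.e. $\lambda(\alpha)-\lambda^*$ changes sign infinitely many times as $\alpha\to1$. *)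

(* Defs.v *)
From HB Require Import structures.
From mathcomp Require Import all_boot all_order all_algebra.
From mathcomp Require Import all_classical all_reals all_analysis.

Set Implicit Arguments.
Unset Strict Implicit.
Unset Printing Implicit Defensive.

Import Order.TTheory GRing.Theory Num.Theory.
Import numFieldNormedType.Exports.

Local Open Scope ring_scope.
Local Open Scope classical_set_scope.


(* The library norm of 'rV[R]_N is the sup norm; it induces the same topology
   as the Euclidean norm below. *)
Definition enorm (R : realType) (N : nat) (x : 'rV[R]_N) : R :=
  Num.sqrt (\sum_(i < N) x 0 i ^+ 2).

Definition eball (R : realType) (N : nat) : set 'rV[R]_N :=
  [set x | enorm x < 1].

Definition ecball (R : realType) (N : nat) : set 'rV[R]_N :=
  [set x | enorm x <= 1].

Definition esphere (R : realType) (N : nat) : set 'rV[R]_N :=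
  [set x | enorm x = 1].

Definition basis_vec (R : realType) (N : nat) (i : 'I_N) : 'rV[R]_N :=
  delta_mx 0 i.

Definition partial (R : realType) (N : nat) (i : 'I_N) (U : 'rV[R]_N -> R) :
  'rV[R]_N -> R := 'D_(basis_vec R i) U.

Definition laplacian (R : realType) (N : nat) (U : 'rV[R]_N -> R)
  (x : 'rV[R]_N) : R := \sum_(i < N) partial i (partial i U) x.

Definition grad_sq (R : realType) (N : nat) (U : 'rV[R]_N -> R)
  (x : 'rV[R]_N) : R := \sum_(i < N) partial i U x ^+ 2.

(* [derivable] guards against the default value of ['D_v] at points where the
   limit does not exist.  Meant for open sets [A]. *)
Definition C2_on (R : realType) (N : nat) (A : set 'rV[R]_N)
    (U : 'rV[R]_N -> R) : Prop :=
  forall x, A x ->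
    {for x, continuous U} /\
    (forall i : 'I_N, derivable U x (basis_vec R i) /\
                      {for x, continuous (partial i U)}) /\
    (forall i j : 'I_N, derivable (partial i U) x (basis_vec R j) /\
                        {for x, continuous (partial j (partial i U))}).

Definition classical_on (R : realType) (N : nat) (delta lambda : R)
    (A : set 'rV[R]_N) (U : 'rV[R]_N -> R) : Prop :=
  C2_on A U /\
  forall x, A x ->
    - laplacian U x = (lambda + delta * grad_sq U x) / (1 - U x).

(* Solutions are total functions on R^N, but only their values on the closed
   unit ball matter. *)
Definition radial (R : realType) (N : nat) (U : 'rV[R]_N -> R) : Prop :=
  exists u : R -> R, forall x, ecball x -> U x = u (enorm x).

Definition regular_solution (R : realType) (N : nat) (delta lambda : R)
    (U : 'rV[R]_N -> R) : Prop :=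
  [/\ {within @ecball R N, continuous U},
      forall x, esphere x -> U x = 0,
      forall x, eball x -> 0 < U x < 1
    & classical_on delta lambda (@eball R N) U].

Definition radial_regular_solution (R : realType) (N : nat) (delta lambda : R)
    (U : 'rV[R]_N -> R) : Prop :=
  radial U /\ regular_solution delta lambda U.

Definition rupture_solution (R : realType) (N : nat) (delta lambda : R)
    (U : 'rV[R]_N -> R) : Prop :=
  radial U /\
  [/\ {within @ecball R N, continuous U},
      U 0 = 1,
      forall x, esphere x -> U x = 0,
      forall x, (@eball R N `\ 0) x -> 0 < U x < 1
    & classical_on delta lambda (@eball R N `\ 0) U].

Definition Ustar (R : realType) (N : nat) (x : 'rV[R]_N) : R := 1 - enorm x.

Definition unique_rupture_solution (R : realType) (N : nat)
    (delta lambda0 : R) (U0 : 'rV[R]_N -> R) : Prop :=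
  rupture_solution delta lambda0 U0 /\
  forall (lambda : R) (U : 'rV[R]_N -> R),
    0 < lambda -> rupture_solution delta lambda U ->
    lambda = lambda0 /\ (forall x, ecball x -> U x = U0 x).

(* U'(0) = 0 is a one-sided derivative: the profile lives on [0, 1]. *)
Definition radial_bvp (R : realType) (N : nat) (delta alpha lambda : R)
    (u : R -> R) : Prop :=
  [/\ {within `[0, 1], continuous u},
      u 0 = alpha,
      (u h - u 0) / h @[h --> 0^'+] --> (0 : R),
      u 1 = 0
    & forall r : R, 0 < r < 1 ->
        [/\ derivable u r 1, derivable (derive1 u) r 1 &
            derive1 (derive1 u) r + (N%:R - 1) / r * derive1 u r
            + (lambda + delta * derive1 u r ^+ 2) / (1 - u r) = 0]].

(* [lam] is the map alpha |-> lambda(alpha) whose graph over (0, 1) is the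
   bifurcation curve: lam alpha is the one and only positive value of the
   parameter for which the boundary value problem with u(0) = alpha is
   solvable.  Values of [lam] outside (0, 1) are irrelevant. *)
Definition bifurcation_map (R : realType) (N : nat) (delta : R)
    (lam : R -> R) : Prop :=
  forall alpha : R, 0 < alpha < 1 -> forall lambda : R,
    (0 < lambda /\ exists u : R -> R, radial_bvp N delta alpha lambda u)
    <-> lambda = lam alpha.

Definition typeI (R : realType) (N : nat) (delta lambda0 : R) : Prop :=
  exists lam : R -> R,
    [/\ bifurcation_map N delta lam,
        0 < lambda0,
        lam alpha @[alpha --> (1 : R)^'-] --> lambda0
      & forall a b : R, 0 < a -> a < b -> b < 1 -> lam a < lam b].

(* Infinitely many sign changes of lam - lambda0 as alpha -> 1: its values
   have strictly alternating signs along some increasing sequence tending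
   to 1. *)
Definition typeII (R : realType) (N : nat) (delta lambda0 : R) : Prop :=
  exists lam : R -> R,
    [/\ bifurcation_map N delta lam,
        0 < lambda0,
        lam alpha @[alpha --> (1 : R)^'-] --> lambda0
      & exists a : nat -> R,
          [/\ forall n, 0 < a n < 1,
              forall n, a n < a n.+1,
              a @ \oo --> (1 : R)
            & forall n, (lam (a n) - lambda0) * (lam (a n.+1) - lambda0) < 0]].

Definition exactly_one_radial_regular (R : realType) (N : nat)
    (delta lambda : R) : Prop :=
  exists U : 'rV[R]_N -> R,
    radial_regular_solution delta lambda U /\
    forall V : 'rV[R]_N -> R, radial_regular_solution delta lambda V ->
      forall x, ecball x -> V x = U x.

(* Solutions are restricted to the closed ball (and extended by the default
   value outside), so that junk values there are not counted. *)
Definition infinitely_many_radial_regular (R : realType) (N : nat)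
    (delta lambda : R) : Prop :=
  infinite_set
    [set U \_ (@ecball R N) | U in
       [set U : 'rV[R]_N -> R | radial_regular_solution delta lambda U]].

Definition threshold (R : realType) (N : nat) : R :=
  (N%:R - 2 - 2 * Num.sqrt (N%:R - 1)) / 2.

(* Main.v *)
(* With [V = 1 - U] and [L = ln V] the radial equation becomes
   L'' + (N - 1) / r L' = lambda e^(-2 L) + (delta - 1) L'^2, which is invariant
   under dilations.  Hence every regular radial solution is 1 - W (k r) / W k for
   one entire profile W = e^L with W 0 = 1, and the bifurcation curve is
   parametrised by k |-> (1 - 1 / W k, k^2 / W(k)^2).  The profile is obtained by
   Picard iteration on Y = (e^((1 - delta) L) - 1) / (1 - delta), whose equation
   contains no gradient term.

   In the variables t = ln r, x = t + ln lambda / 2 - L, y = x', the equation is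
   the autonomous system x' = y, y' = l - c y + (1 - delta) y^2 - e^(2 x) with
   l = N - 1 - delta and c = N - 2 delta; its only equilibrium e^(2 x) = l is U*,
   and lambda = e^(2 x) along the curve.  A Pohozaev identity bounds the orbit of
   the profile from above and a decreasing energy bounds it from below, so that
   it converges to the equilibrium.  This is a focus when c^2 < 8 l, and then a
   Riccati comparison gives infinitely many crossings; otherwise it is a node and
   x is monotone.  A rupture solution is an orbit that stays bounded as
   t -> -oo, where it also has to converge to the equilibrium; as the energy is
   monotone the orbit is constant. *)
Require Import Defs.
From HB Require Import structures.
From mathcomp Require Import all_boot all_order all_algebra.
From mathcomp Require Import all_classical all_reals all_analysis.
From mathcomp Require Import ring lra.

Set Implicit Arguments.
Unset Strict Implicit.
Unset Printing Implicit Defensive.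

Import Order.TTheory GRing.Theory Num.Theory.
Import numFieldNormedType.Exports.

Local Open Scope ring_scope.
Local Open Scope classical_set_scope.

(** * Calculus on the real line *)

(** Two obstacles shape the proof. The range of the map from [L] to [Y] is bounded above when
    [1 < d], so the iteration runs with an extended nonlinearity and [Y] must be shown to stay in
    that range; the Pohozaev bound on r L' does this, and is therefore proved during the
    construction of the profile. Convergence to the equilibrium uses no phase-plane theorem: a
    bounded monotone energy has a limit, and bounds on second derivatives turn this into limits of
    [y] and y'. The hypothesis delta < N / 2 says that the damping [c] is positive; it fixes the
    signs in the energy and Pohozaev identities and makes [l] positive. The linearisation at the
    equilibrium is u'' + c u' + 2 l u = 0, with discriminant c^2 - 8 l = (N - 2 - 2 delta)^2 - 4 (N
    - 1), whence the threshold. On a rupture orbit [x] could a priori tend to -oo towards the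
    origin; this is excluded because it would keep [V] away from 0 there. *)

Notation dd x f l := (is_derive x 1 f l).

Section Rules.
Context {R : realType}.
Implicit Types (f g : R -> R) (x a b l c s t e T S K B : R).

Lemma dval f x a b : dd x f a -> a = b -> dd x f b.
Proof. by move=> h <-. Qed.
Lemma dcst c x : dd x (fun=> c) 0.
Proof. exact: is_derive_cst. Qed.
Lemma did x : dd x (fun t : R => t) 1.
Proof. exact: is_derive_id. Qed.
Lemma dD f g x a b : dd x f a -> dd x g b -> dd x (fun t => f t + g t) (a + b).
Proof. exact: is_deriveD. Qed.
Lemma dN f x a : dd x f a -> dd x (fun t => - f t) (- a).
Proof. exact: is_deriveN. Qed.
Lemma dM f g x a b : dd x f a -> dd x g b ->
  dd x (fun t => f t * g t) (a * g x + f x * b).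
Proof.
move=> fa gb; apply: (dval (is_deriveM fa gb)).
by rewrite /GRing.scale /= addrC; congr (_ + _); rewrite mulrC.
Qed.
Lemma dX f x a n : dd x f a -> dd x (fun t => f t ^+ n) (n%:R * f x ^+ n.-1 * a).
Proof.
move=> fa; have -> : (fun t => f t ^+ n) = f ^+ n.
  by apply/funext => t; rewrite fctE.
apply: (dval (is_deriveX n fa)).
by rewrite /GRing.scale /= mulr_natl.
Qed.
Lemma dV f x a : dd x f a -> f x != 0 -> dd x (fun t => (f t)^-1) (- a / f x ^+ 2).
Proof.
move=> fa f0; apply: (dval (is_deriveV f0 fa)).
by rewrite /GRing.scale /= !mulNr mulrC.
Qed.
Lemma dcomp f g x a b : dd (g x) f a -> dd x g b -> dd x (fun t => f (g t)) (a * b).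
Proof. by move=> fa gb; exact: (is_derive1_comp (f := f) (g := g)). Qed.
Lemma dexp g x b : dd x g b -> dd x (fun t => expR (g t)) (expR (g x) * b).
Proof. by move=> gb; exact: (dcomp (is_derive_expR _)). Qed.
Lemma dln g x b : dd x g b -> 0 < g x -> dd x (fun t => ln (g t)) (b / g x).
Proof. by move=> gb g0; rewrite mulrC; exact: (dcomp (is_derive1_ln g0)). Qed.

Lemma dd_cont f x l : dd x f l -> {for x, continuous f}.
Proof. by move=> [h _]; apply/differentiable_continuous/derivable1_diffP. Qed.
Lemma dd_derivable f x l : dd x f l -> derivable f x 1.
Proof. by case. Qed.
Lemma dd_derive1 f x l : dd x f l -> f^`() x = l.
Proof. by move=> [_ h]; rewrite derive1E. Qed.
Lemma derivable_dd f x : derivable f x 1 -> dd x f (f^`() x).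
Proof. by move=> h; rewrite derive1E; exact: derivableP. Qed.

Lemma near_eps x (P : R -> Prop) :
  (\forall y \near x, P y) <->
  exists2 e : R, 0 < e & forall y, `|y - x| < e -> P y.
Proof.
split=> [/nbhs_ballP[e /= e0 h]|[e e0 h]].
  by exists e => // y yx; apply: h; rewrite /ball /= distrC.
apply/nbhs_ballP; exists e => // y; rewrite /ball /= distrC; exact: h.
Qed.

Lemma cont_eps f x : {for x, continuous f} <->
  forall e, 0 < e -> exists2 r, 0 < r & forall y, `|y - x| < r -> `|f y - f x| < e.
Proof.
split=> [/cvgrPdist_lt h e e0|h].
  have /near_eps[r r0 H] := h _ e0.
  by exists r => // y /H; rewrite distrC.
apply/cvgrPdist_lt => e e0; have [r r0 H] := h _ e0.
by apply/near_eps; exists r => // y /H; rewrite distrC.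
Qed.

(** The division-free form of differentiability includes [h = 0], which makes derivatives at the
    origin of radial functions easy to check directly. *)
Lemma dd_eps f x l : dd x f l <->
  forall e, 0 < e -> exists2 r, 0 < r & forall h, `|h| < r ->
    `|f (x + h) - f x - l * h| <= e * `|h|.
Proof.
split.
  move=> /is_derive1_caratheodory[g [E /cont_eps C gx]] e e0.
  have [r r0 H] := C _ e0; exists r => // h hr.
  rewrite E (_ : x + h - x = h); last by rewrite addrC addKr.
  rewrite -mulrBl normrM ler_wpM2r // ltW // -gx H //.
  by rewrite (_ : x + h - x = h) // addrC addKr.
move=> H; apply/is_derive1_caratheodory.
exists (fun z => if z == x then l else (f z - f x) / (z - x)); split.
- move=> z; case: eqVneq => [->|zx]; first by rewrite !subrr mulr0.
  by rewrite divfK // subr_eq0.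
- apply/cont_eps => e e0; have [r r0 {}H] := H (e / 2) ltac:(lra).
  exists r => // y yr; rewrite eqxx; case: eqVneq => [_|yx]; first by rewrite subrr normr0.
  have := H _ yr; rewrite (_ : x + (y - x) = y); last by rewrite addrC subrK.
  have yx0 : 0 < `|y - x| by rewrite normr_gt0 subr_eq0.
  rewrite -ler_pdivrMr // => h.
  rewrite (_ : _ - l = (f y - f x - l * (y - x)) / (y - x)).
    by rewrite normrM normfV; lra.
  by field; rewrite subr_eq0.
- by rewrite eqxx.
Qed.

Lemma eq_dd f g x l r : 0 < r -> (forall y, `|y - x| < r -> f y = g y) ->
  dd x f l -> dd x g l.
Proof.
move=> r0 fg /dd_eps H; apply/dd_eps => e e0.
have [s s0 {}H] := H _ e0; exists (Num.min r s) => [|h]; first by rewrite lt_min r0.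
rewrite lt_min => /andP[hr hs]; rewrite -!fg; first exact: H.
  by rewrite subrr normr0.
by rewrite addrC addKr.
Qed.

Lemma eq_ddT f g x l : (forall y, f y = g y) -> dd x f l -> dd x g l.
Proof. by move=> /funext ->. Qed.

Lemma within_cont f a b : (forall x, a <= x -> x <= b -> {for x, continuous f}) ->
  {within `[a, b], continuous f}.
Proof.
by move=> H; apply: continuous_in_subspaceT => x; rewrite inE /= in_itv /= => /andP[]; exact: H.
Qed.

Lemma MVTdd f f' a b : a < b -> (forall x, a <= x -> x <= b -> dd x f (f' x)) ->
  exists c, [/\ a < c, c < b & f b - f a = f' c * (b - a)].
Proof.
move=> ab H; have [||c] := @MVT R f f' a b ab.
- by move=> x; rewrite in_itv /= => /andP[? ?]; apply: H; lra.
- by apply: within_cont => x ? ?; apply: dd_cont (H _ _ _).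
by rewrite in_itv /= => /andP[? ?] ?; exists c.
Qed.

Lemma dd_ndecr f f' a b : a <= b -> (forall x, a <= x -> x <= b -> dd x f (f' x)) ->
  (forall x, a <= x -> x <= b -> 0 <= f' x) -> f a <= f b.
Proof.
rewrite le_eqVlt => /predU1P[->//|ab] H P; have [c [ac cb E]] := MVTdd ab H.
have := P c (ltW ac) (ltW cb); rewrite -(subr_ge0 (f a)) E => h; apply: mulr_ge0 => //; lra.
Qed.

Lemma dd_incr f f' a b : a < b -> (forall x, a <= x -> x <= b -> dd x f (f' x)) ->
  (forall x, a < x -> x < b -> 0 < f' x) -> f a < f b.
Proof.
move=> ab H P; have [c [ac cb E]] := MVTdd ab H.
have := P c ac cb; rewrite -(subr_gt0 (f a)) E => h; apply: mulr_gt0 => //; lra.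
Qed.

Lemma dd_nincr f f' a b : a <= b -> (forall x, a <= x -> x <= b -> dd x f (f' x)) ->
  (forall x, a <= x -> x <= b -> f' x <= 0) -> f b <= f a.
Proof.
move=> ab H P; have := @dd_ndecr (fun x => - f x) (fun x => - f' x) a b ab.
rewrite lerN2; apply; first by move=> x *; exact: dN (H _ _ _).
by move=> x ? ?; rewrite oppr_ge0; exact: P.
Qed.

Lemma dd_le f g f' g' a b : a <= b ->
  (forall x, a <= x -> x <= b -> dd x f (f' x)) ->
  (forall x, a <= x -> x <= b -> dd x g (g' x)) ->
  (forall x, a <= x -> x <= b -> f' x <= g' x) -> f b - f a <= g b - g a.
Proof.
move=> ab F G P.
have := @dd_ndecr (fun x => g x - f x) (fun x => g' x - f' x) a b ab.
have D x : a <= x -> x <= b -> dd x (fun x => g x - f x) (g' x - f' x).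
  by move=> ? ?; exact: dD (G _ _ _) (dN (F _ _ _)).
have D0 x : a <= x -> x <= b -> 0 <= g' x - f' x by move=> ? ?; rewrite subr_ge0 P.
by move=> /(_ D D0) ?; lra.
Qed.

Lemma dd_lip f f' a b M : a <= b -> (forall x, a <= x -> x <= b -> dd x f (f' x)) ->
  (forall x, a <= x -> x <= b -> `|f' x| <= M) -> `|f b - f a| <= M * (b - a).
Proof.
rewrite le_eqVlt => /predU1P[->|ab] H P; first by rewrite !subrr normr0 mulr0.
have [c [ac cb ->]] := MVTdd ab H.
by rewrite normrM (ger0_norm (_ : 0 <= b - a)) ?ler_wpM2r ?P ?ltW ?subr_gt0.
Qed.

(** The derivative is known at one point, hence a comparison with [f x] and no monotonicity on the
    interval. *)
Lemma dd_pos_right f x l : dd x f l -> 0 < l ->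
  exists2 e, 0 < e & forall y, x < y -> y < x + e -> f x < f y.
Proof.
move=> /dd_eps H l0; have [r r0 {}H] := H (l / 2) ltac:(lra).
exists r => // y xy yr; have := H (y - x); rewrite (_ : x + (y - x) = y); last lra.
rewrite ger0_norm; last lra.
move=> /(_ ltac:(lra)); rewrite ler_norml => /andP[h _].
have : 0 < l * (y - x) by rewrite mulr_gt0 // subr_gt0.
by move=> ?; nra.
Qed.

Lemma dd_pos_left f x l : dd x f l -> 0 < l ->
  exists2 e, 0 < e & forall y, x - e < y -> y < x -> f y < f x.
Proof.
move=> /dd_eps H l0; have [r r0 {}H] := H (l / 2) ltac:(lra).
exists r => // y xy yr; have := H (y - x); rewrite (_ : x + (y - x) = y); last lra.
rewrite ler0_norm; last lra.
move=> /(_ ltac:(lra)); rewrite ler_norml => /andP[_ h].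
have : 0 < l * (x - y) by rewrite mulr_gt0 // subr_gt0.
by move=> ?; nra.
Qed.

Lemma IVTc f a b v : a <= b -> (forall x, a <= x -> x <= b -> {for x, continuous f}) ->
  f a <= v -> v <= f b -> exists c, [/\ a <= c, c <= b & f c = v].
Proof.
move=> ab C fa fb; have [||c] := @IVT R f a b v ab; first exact: within_cont.
  by rewrite ge_min fa le_max fb orbT.
by rewrite in_itv /= => /andP[? ?] ?; exists c.
Qed.

Lemma cont_bounded f a b : (forall x, a <= x -> x <= b -> {for x, continuous f}) ->
  exists2 M, 0 < M & forall x, a <= x -> x <= b -> `|f x| <= M.
Proof.
move=> C; have [ab|ba] := leP a b; last by exists 1 => // x ? ?; lra.
have C' : {within `[a, b], continuous (fun x => `|f x|)}.
  apply: within_cont => x ? ?; apply: (@continuous_comp _ _ _ f Num.norm); first exact: C.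
  exact: norm_continuous.
have [c _ H] := EVT_max ab C'.
exists (`|f c| + 1) => [|x ? ?]; first by rewrite ltr_pwDr.
by rewrite (le_trans (H x _)) ?ler_wpDr // in_itv /=; apply/andP.
Qed.

(** The zero is the supremum of the points where [f] is nonnegative; continuity excludes both strict
    signs there. *)
Lemma sup_last f a b : a < b -> (forall x, a <= x -> x <= b -> {for x, continuous f}) ->
  0 <= f a -> f b < 0 ->
  exists c, [/\ a <= c, c < b, f c = 0 & forall x, c < x -> x <= b -> f x < 0].
Proof.
move=> ab C fa fb; pose S := [set x | [/\ a <= x, x <= b & 0 <= f x]].
have Sa : S a by split=> //; exact: ltW.
have Sub : ubound S b by move=> x [].
have hs : has_sup S by split; [exists a|exists b].
have ac : a <= sup S by exact: (ub_le_sup (ex_intro _ b Sub)).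
have cb : sup S <= b by apply: ge_sup => //; exists a.
have aft x : sup S < x -> x <= b -> f x < 0.
  move=> cx xb; rewrite ltNge; apply/negP => fx.
  have : x <= sup S by apply: (ub_le_sup (ex_intro _ b Sub)); split=> //; lra.
  by lra.
have c0 : 0 <= f (sup S).
  rewrite leNgt; apply/negP => fc.
  have /cont_eps/(_ (- f (sup S)) ltac:(lra))[r r0 H] := C _ ac cb.
  have [x [xa xb fx] xr] := sup_adherent r0 hs.
  have xc : x <= sup S by apply: (ub_le_sup (ex_intro _ b Sub)).
  have := H x; rewrite ltr_norml => /(_ ltac:(by lra)); rewrite ltr_norml => ?; lra.
have cb' : sup S < b by rewrite lt_neqAle cb andbT; apply/eqP => E; move: c0; rewrite E; lra.
exists (sup S); split => //; apply/eqP; rewrite eq_le c0 andbT leNgt; apply/negP => fc.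
have /cont_eps/(_ _ fc)[r r0 H] := C _ ac cb.
pose y := Num.min b (sup S + r / 2).
have yb : y <= b by rewrite ge_min lexx.
have yr : y <= sup S + r / 2 by rewrite ge_min lexx orbT.
have cy : sup S < y by rewrite lt_min cb' /=; lra.
have := H y; rewrite ltr_norml => /(_ ltac:(by lra)); rewrite ltr_norml => ?.
by have := aft y cy yb; lra.
Qed.

(** Were [f x] negative, the derivative at the last zero before [x] would push [f] above 0 just
    after it, where [f] is already negative. *)
Lemma barrier f f' a b : (forall x, a <= x -> x < b -> dd x f (f' x)) ->
  (forall x, a <= x -> x < b -> f x = 0 -> 0 < f' x) -> 0 <= f a ->
  forall x, a <= x -> x < b -> 0 <= f x.
Proof.
move=> H P fa x ax xb; rewrite leNgt; apply/negP => fx.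
have ax' : a < x by rewrite lt_neqAle ax andbT; apply/eqP => E; move: fa; rewrite E; lra.
have [|c [ac cx fc aft]] := @sup_last f a x ax' _ fa fx.
  by move=> y ? ?; apply: dd_cont (H _ _ _); lra.
have cb : c < b by lra.
have [e e0 up] := dd_pos_right (H c ac cb) (P c ac cb fc).
pose y := Num.min x (c + e / 2).
have yb : y <= x by rewrite ge_min lexx.
have yr : y <= c + e / 2 by rewrite ge_min lexx orbT.
have cy : c < y by rewrite lt_min cx /=; lra.
by have := aft y cy yb; have := up y cy ltac:(lra); lra.
Qed.

(* Landau: f(t+h)-f(t) = h f'(xi) and f' varies by at most K h over a step h. *)
Lemma landau f f' f'' T K (l : R) :
  (forall t, T <= t -> dd t f (f' t)) -> (forall t, T <= t -> dd t f' (f'' t)) ->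
  (forall t, T <= t -> `|f'' t| <= K) ->
  (forall e, 0 < e -> exists2 S, T <= S & forall t, S <= t -> `|f t - l| < e) ->
  forall e, 0 < e -> exists2 S, T <= S & forall t, S <= t -> `|f' t| < e.
Proof.
move=> F F' B L e e0.
have K0 : 0 <= K by rewrite (le_trans _ (B T (lexx _))).
(* [f'] varies by at most [e / 2] over a step of this length; the added 1 covers [K = 0]. *)
pose h := e / (2 * (K + 1)).
have h0 : 0 < h by rewrite divr_gt0 //; lra.
have hK : K * h <= e / 2.
  rewrite /h mulrA ler_pdivrMr; last lra.
  by nra.
have eh : 0 < e * h by rewrite mulr_gt0.
have [S TS HS] := L (e * h / 8) ltac:(lra).
exists S => // t St.
have [|c [tc ch E]] := @MVTdd f f' t (t + h) ltac:(lra).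
  by move=> x *; apply: F; lra.
have D : `|f (t + h) - f t| < e * h / 4.
  have := HS t St; have := HS (t + h) ltac:(lra).
  by rewrite !ltr_norml => ? ?; lra.
have C : `|f' c| < e / 4.
  move: D; rewrite E (_ : t + h - t = h); last lra.
  rewrite normrM (gtr0_norm h0) => D.
  by rewrite -(ltr_pM2r h0); lra.
have V : `|f' c - f' t| <= K * (c - t).
  by apply: dd_lip => [|x *|x *]; [lra|apply: F'|apply: B]; lra.
have : K * (c - t) <= e / 2.
  by apply: le_trans hK; apply: ler_wpM2l => //; lra.
move: C V; rewrite ltr_norml ler_norml ltr_norml => ? ? ?; lra.
Qed.

Lemma mono_bounded_cvg f T B : (forall s t, T <= s -> s <= t -> f s <= f t) ->
  (forall t, T <= t -> f t <= B) ->
  exists2 l, (forall t, T <= t -> f t <= l) &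
    forall e, 0 < e -> exists2 S, T <= S & forall t, S <= t -> `|f t - l| < e.
Proof.
move=> mono bd; pose A := [set f t | t in [set t | T <= t]].
have hA : has_sup A by split; [exists (f T), T => //=|exists B => _ [t /= Tt <-]; exact: bd].
have ub t : T <= t -> f t <= sup A by move=> ?; apply: ub_le_sup; [case: hA|exists t].
exists (sup A) => // e e0; have [_ [S /= TS <-] HS] := sup_adherent e0 hA.
exists S => // t St; have := mono _ _ TS St; have := ub t ltac:(lra).
by rewrite ltr_norml => ? ?; lra.
Qed.

(** The fundamental theorem differentiates an integral at points to the right of its base point.
    Moving the base point changes the integral by a constant, so primitives with different base
    points glue to one on the whole line. *)
Lemma antiderivative (g : R -> R) : continuous g ->
  exists2 G : R -> R, G 0 = 0 & forall x : R, dd x G (g x).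
Proof.
move=> gc.
pose F a x : R := (\int[lebesgue_measure]_(t in [set` `[a, x]]) g t)%R.
have dF (a x : R) : a < x -> dd x (F a) (g x).
  move=> ax; have xu : x < x + 1 by rewrite ltrDl.
  have [|h E] := @continuous_FTC1_closed R g a x (x + 1) xu _ ax (gc x).
    apply: continuous_compact_integrable; first exact: segment_compact.
    by apply: within_cont => *; exact: gc.
  by rewrite -E; exact: derivable_dd.
have dF0 (a b x y : R) : a < y -> b < y -> y <= x -> F a x - F b x = F a y - F b y.
  move=> ay bY yx.
  have D z : y <= z -> z <= x -> dd z (fun x => F a x - F b x) 0.
    move=> yz zx; apply: (dval (a := g z - g z)); last by rewrite subrr.
    by apply: dD; [|apply: dN]; apply: dF; lra.
  by apply/eqP; rewrite eq_le (dd_nincr yx D) ?(dd_ndecr yx D).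
have glue (a b x : R) : a < x -> a < 0 -> b < x -> b < 0 -> F a x - F a 0 = F b x - F b 0.
  move=> ax a0 bx b0; case: (leP 0 x) => x0.
    by have := dF0 a b x 0 a0 b0 x0; lra.
  by have := dF0 a b 0 x ax bx (ltW x0); lra.
(* A base point to the left of both [x] and 0; by [glue] the increment from 0 is the same for all
   such points, so it may vary with [x]. *)
pose A (x : R) : R := - `|x| - 1.
have Ax x : A x < x by rewrite /A; have := ler_norm (- x); rewrite normrN; lra.
have A0 x : A x < 0 by rewrite /A; have := normr_ge0 x; lra.
exists (fun x => F (A x) x - F (A x) 0); first by rewrite subrr.
move=> x; have D : dd x (fun y => F (A x - 1) y - F (A x - 1) 0) (g x).
  apply: (dval (a := g x + - 0)); last by rewrite oppr0 addr0.
  apply: dD (dN (dcst _ _)); apply: dF; have := Ax x; lra.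
apply: eq_dd ltr01 _ D => y yx; apply: glue => //; last by have := A0 x; lra.
by have := Ax x; move: yx; rewrite ltr_norml /A ltrBlDr => /andP[? ?]; have := ler_norm (-x); rewrite normrN; lra.
Qed.

End Rules.

(** Hypotheses are tried first, so a derivative known in the context is used as a black box. The
    value is built by unification, and [dby] leaves its comparison with the stated one to [ring] or
    [field]. *)
Ltac dsolve :=
  first [ eassumption | eapply dcst | eapply did
    | eapply dD; dsolve | eapply dN; dsolve | eapply dX; dsolve
    | eapply dM; dsolve | eapply dexp; dsolve
    | eapply dV; [dsolve|] | eapply dln; [dsolve|] | idtac ].
Ltac dby := eapply dval; [dsolve|].

(** * Picard iteration for a singular initial value problem *)

(** McShane extension: the supremum over [A] of downward cones of slope [k], cut off at 0 to keep
    the lower bound. *)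
Lemma lipschitz_extension (R : realType) (A : set R) (h : R -> R) (k : R) :
  A !=set0 -> 0 <= k ->
  (forall y, A y -> 0 <= h y <= 1) ->
  (forall y z, A y -> A z -> h z - h y <= k * `|y - z|) ->
  exists f : R -> R, [/\ forall y, A y -> f y = h y, forall y, 0 <= f y <= 1
    & forall y z, `|f y - f z| <= k * `|y - z|].
Proof.
move=> [a0 Aa0] k0 h01 hlip.
pose S y := [set Num.max 0 (h z - k * `|y - z|) | z in A].
have Sne y : S y !=set0 by exists (Num.max 0 (h a0 - k * `|y - a0|)), a0.
have S1 y : ubound (S y) 1.
  move=> _ [z Az <-]; rewrite ge_max ler01 /=.
  have /andP[_] := h01 z Az; have : 0 <= k * `|y - z| by rewrite mulr_ge0.
  lra.
have hS y : has_sup (S y) by split => //; exists 1.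
have Sub y z : A z -> h z - k * `|y - z| <= sup (S y).
  move=> Az; apply: (@le_trans _ _ (Num.max 0 (h z - k * `|y - z|))).
    by rewrite le_max lexx orbT.
  by apply: (ub_le_sup (ex_intro _ 1 (S1 y))); exists z.
have S0 y : 0 <= sup (S y).
  apply: (@le_trans _ _ (Num.max 0 (h a0 - k * `|y - a0|))).
    by rewrite le_max lexx.
  by apply: (ub_le_sup (ex_intro _ 1 (S1 y))); exists a0.
have lip y z : sup (S y) <= sup (S z) + k * `|y - z|.
  apply: ge_sup => // _ [w Aw <-].
  rewrite ge_max addr_ge0 ?mulr_ge0 //=.
  have := Sub z w Aw.
  have : `|z - w| <= `|y - z| + `|y - w|.
    by rewrite (_ : z - w = (y - w) - (y - z)) ?(le_trans (ler_normB _ _)) ?(addrC `|y - w|) //; ring.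
  by move=> t1 t2; nra.
exists (fun y => sup (S y)); split.
- move=> y Ay; apply/eqP; rewrite eq_le; apply/andP; split.
    apply: ge_sup => // _ [w Aw <-].
    by rewrite ge_max; case/andP: (h01 y Ay) => -> _ /=; have := hlip y w Ay Aw; lra.
  by have := Sub y y Ay; rewrite subrr normr0 mulr0 subr0.
- by move=> y; rewrite S0 /=; apply: ge_sup.
- move=> y z; rewrite ler_norml; have := lip y z; have := lip z y.
  by rewrite (distrC z y) => *; lra.
Qed.

Section Weighted.
Context {R : realType}.
Implicit Types (g h P Z : R -> R) (s A K X : R).

(** A negative value at [s] would by monotonicity be an upper bound for all values on the left,
    against points near 0 where [h] is almost nonnegative. *)
Lemma ge0_from0 h h' X : (forall s, 0 < s -> s < X -> dd s h (h' s)) ->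
  (forall s, 0 < s -> s < X -> 0 <= h' s) ->
  (forall e r : R, 0 < e -> 0 < r -> exists s, [/\ 0 < s, s < r & - e <= h s]) ->
  forall s, 0 < s -> s < X -> 0 <= h s.
Proof.
move=> D P F s s0 sX; rewrite leNgt; apply/negP => hs.
have [r [r0 rs hr]] := F (- h s / 2) s ltac:(lra) s0.
have : h r <= h s by apply: (dd_ndecr (ltW rs)) => x *; [apply: D|apply: P]; lra.
lra.
Qed.

(** Smallness along some points tending to 0, weaker than a limit. Monotonicity arguments from the
    origin use no more, and this is what the mean value theorem yields for a flux. *)
Definition vanishes0 (h : R -> R) := forall e r : R, 0 < e -> 0 < r ->
  exists s, [/\ 0 < s, s < r & `|h s| <= e].

Lemma vanishes0_cont h : {for 0, continuous h} -> h 0 = 0 -> vanishes0 h.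
Proof.
move=> /cont_eps C h0 e r e0 r0; have [q q0 H] := C _ e0.
exists (Num.min q r / 2); split.
- by rewrite divr_gt0 // lt_min q0.
- by have : Num.min q r <= r; [rewrite ge_min lexx orbT|lra].
- have m0 : 0 < Num.min q r by rewrite lt_min q0.
  have mq : Num.min q r <= q by rewrite ge_min lexx.
  by have := H (Num.min q r / 2); rewrite h0 !subr0 => /(_ _)/ltW; apply; rewrite gtr0_norm; lra.
Qed.

(** The two integrations that solve (s^n Z')' = s^n g each gain a factor 1 / K in the norm weighted
    by e^(K s). The powers of [s] cancel, so the singular coefficient costs nothing. Each bound
    holds because the weighted majorant plus or minus the function is nondecreasing. *)
Lemma weighted_bound n g P Z Z' A K X : 0 < K -> 0 <= A ->
  (forall s, 0 < s -> s < X -> dd s P (s ^+ n * g s)) ->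
  (forall s, 0 < s -> s < X -> dd s Z (Z' s)) ->
  (forall s, 0 < s -> s < X -> s ^+ n * Z' s = P s) ->
  (forall s, 0 < s -> s < X -> `|g s| <= A * expR (K * s)) ->
  vanishes0 P -> vanishes0 Z ->
  forall s, 0 < s -> s < X -> `|Z s| <= A / K ^+ 2 * expR (K * s).
Proof.
move=> K0 A0 dP dZ ZP gA P0 Z0.
have bnd (e : R) : e = 1 \/ e = -1 -> forall s, 0 < s -> s < X ->
    0 <= A / K * s ^+ n * expR (K * s) + e * P s.
  move=> e1; apply: (@ge0_from0 _ (fun s => A / K * (n%:R * s ^+ n.-1 * expR (K * s) +
      s ^+ n * (K * expR (K * s))) + e * (s ^+ n * g s))).
  - move=> s s0 sX; have := dP s s0 sX => ?; dby; rewrite /=; ring.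
  - move=> s s0 sX.
    have t1 : 0 <= A / K * (n%:R * s ^+ n.-1 * expR (K * s)).
      by rewrite !mulr_ge0 ?invr_ge0 ?exprn_ge0 ?expR_ge0 // ltW.
    have -> : A / K * (n%:R * s ^+ n.-1 * expR (K * s) + s ^+ n * (K * expR (K * s)))
      + e * (s ^+ n * g s) = A / K * (n%:R * s ^+ n.-1 * expR (K * s)) +
        s ^+ n * (A * expR (K * s) + e * g s).
      by field; rewrite gt_eqF.
    apply: addr_ge0 => //; apply: mulr_ge0; first by rewrite exprn_ge0 // ltW.
    by have := gA s s0 sX; rewrite ler_norml; case: e1 => -> /andP[? ?]; lra.
  - move=> eps r eps0 r0; have [s [s0 sr Ps]] := P0 _ _ eps0 r0.
    exists s; split => //; have : 0 <= A / K * s ^+ n * expR (K * s).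
      by rewrite !mulr_ge0 ?invr_ge0 ?exprn_ge0 ?expR_ge0 // ltW.
    by move: Ps; rewrite ler_norml; case: e1 => -> /andP[? ?]; lra.
have bZ' s : 0 < s -> s < X -> `|Z' s| <= A / K * expR (K * s).
  move=> s0 sX; have b1 := bnd 1 (or_introl erefl) s s0 sX.
  have b2 := bnd (-1) (or_intror erefl) s s0 sX.
  have sn : 0 < s ^+ n by rewrite exprn_gt0.
  move: b1 b2; rewrite -(ZP s s0 sX) => b1 b2.
  rewrite ler_norml -(ler_pM2l sn) -(ler_pM2l sn _ (_ * expR _)); lra.
have bndZ (e : R) : e = 1 \/ e = -1 -> forall s, 0 < s -> s < X ->
    0 <= A / K ^+ 2 * expR (K * s) + e * Z s.
  move=> e1; apply: (@ge0_from0 _ (fun s => A / K * expR (K * s) + e * Z' s)).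
  - move=> s s0 sX; have := dZ s s0 sX => ?; dby; rewrite /=; field.
    by rewrite gt_eqF.
  - move=> s s0 sX; have := bZ' s s0 sX; rewrite ler_norml.
    by case: e1 => -> /andP[? ?]; lra.
  - move=> eps r eps0 r0; have [s [s0 sr Ps]] := Z0 _ _ eps0 r0.
    exists s; split => //; have : 0 <= A / K ^+ 2 * expR (K * s).
      by rewrite !mulr_ge0 ?invr_ge0 ?exprn_ge0 ?expR_ge0 // ltW.
    by move: Ps; rewrite ler_norml; case: e1 => -> /andP[? ?]; lra.
move=> s s0 sX; have := bndZ 1 (or_introl erefl) s s0 sX.
by have := bndZ (-1) (or_intror erefl) s s0 sX; rewrite ler_norml => ? ?; lra.
Qed.

Lemma le_geom (x y c : R) : (forall k, x <= y + c / 2 ^+ k) -> x <= y.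
Proof.
move=> H; rewrite leNgt; apply/negP => yx.
have c0 : 0 < c.
  rewrite ltNge; apply/negP => c0; have := H 0; rewrite expr0 divr1; lra.
have d0 : 0 < x - y by rewrite subr_gt0.
pose k := Num.trunc (c / (x - y)).
have : c / (x - y) < k.+1%:R by apply: Num.Theory.truncnS_gt.
have k2 : k.+1%:R <= 2 ^+ k.+1 :> R.
  by rewrite -natrX ler_nat ltnW // ltn_expl.
rewrite ltr_pdivrMr // => h; have := H k.+1.
have p2 : 0 < 2 ^+ k.+1 :> R by rewrite exprn_gt0.
rewrite -lerBlDl ler_pdivlMr // => ?; nra.
Qed.

(** Nested intervals: 2 C / 2^k is the sum of the remaining increments, so the lower ends increase
    and the upper ends decrease. *)
Lemma geom_cvg (u : nat -> R) (C : R) :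
  (forall k, `|u k.+1 - u k| <= C / 2 ^+ k) ->
  exists l, forall k, `|u k - l| <= 2 * C / 2 ^+ k.
Proof.
move=> H; pose a k := u k - 2 * C / 2 ^+ k; pose b k := u k + 2 * C / 2 ^+ k.
have E k : 2 * C / 2 ^+ k.+1 = C / 2 ^+ k.
  by rewrite exprS; field; rewrite expf_neq0.
have aS k : a k <= a k.+1.
  by have := H k; rewrite /a E ler_norml; lra.
have bS k : b k.+1 <= b k by have := H k; rewrite /b E ler_norml; lra.
have C0 k : 0 <= C / 2 ^+ k by apply: le_trans (H k).
have ab j k : a j <= b k.
  have am i m : a i <= a (i + m)%N.
    by elim: m => [|m IH]; rewrite ?addn0 // addnS (le_trans IH).
  have bm i m : b (i + m)%N <= b i.
    by elim: m => [|m IH]; rewrite ?addn0 // addnS (le_trans _ IH).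
  apply: le_trans (am j k) _; apply: (@le_trans _ _ (b (j + k)%N)); last by rewrite addnC.
  by rewrite /a /b; have := C0 (j + k)%N; lra.
have ubA k : ubound (range a) (b k) by move=> _ [j _ <-].
have hA : has_sup (range a) by split; [exists (a 0), 0|exists (b 0)].
exists (sup (range a)) => k.
have : a k <= sup (range a) by apply: ub_le_sup; [case: hA|exists k].
have : sup (range a) <= b k by apply: ge_sup; [case: hA|exact: ubA].
by rewrite /a /b ler_norml => ? ?; lra.
Qed.

Section Picard.
Variables (f : R -> R) (k : R) (n : nat).
Hypotheses (k0 : 0 < k) (f01 : forall y, 0 <= f y <= 1)
  (flip : forall y z, `|f y - f z| <= k * `|y - z|).

(** One Picard step for (s^n Z')' = s^n f(y), with [P] the flux s^n Z'. Setting [Z'] to 0 on the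
    left of the origin makes [Z] differentiable on the whole line. The last clause comes from
    [f <= 1] and gives all iterates common Lipschitz constants on bounded sets. *)
Definition solves_from (y : R -> R) (Z Z' P : R -> R) : Prop :=
  [/\ P 0 = 0 /\ (forall s, dd s P (s ^+ n * f (y s))),
      Z 0 = 0 /\ (forall s, dd s Z (Z' s)),
      forall s, 0 < s -> s ^+ n * Z' s = P s,
      forall s, s <= 0 -> Z' s = 0
    & forall s, `|Z' s| <= `|s|].

Lemma f_cont : continuous f.
Proof.
move=> x; apply/cont_eps => e e0; exists (e / k) => [|y yx]; first by rewrite divr_gt0.
by rewrite (le_lt_trans (flip y x)) // mulrC -ltr_pdivlMr.
Qed.

(** Since 0 <= f <= 1, the flux is at most s^(n+1); dividing by s^n leaves a function that extends
    continuously by 0, hence has a primitive. *)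
Lemma solves_from_exists (y : R -> R) : continuous y ->
  exists Z Z' P, solves_from y Z Z' P.
Proof.
move=> yc.
have gc : continuous (fun s => s ^+ n * f (y s)).
  move=> s; apply: (@continuousM _ _ (fun s => s ^+ n) (f \o y)).
    exact: exprn_continuous.
  by apply: continuous_comp; [exact: yc|exact: f_cont].
have [P P0 dP] := antiderivative gc.
have Pb s : 0 < s -> `|P s| <= s ^+ n * s.
  move=> s0; have := @dd_lip _ P _ 0 s (s ^+ n) (ltW s0) (fun x _ _ => dP x).
  rewrite P0 !subr0; apply => x x0 xs.
  have /andP[f0 f1] := f01 (y x).
  rewrite normrM ger0_norm ?exprn_ge0 // (ger0_norm f0) -[leRHS]mulr1.
  by apply: ler_pM; rewrite ?exprn_ge0 // lerXn2r // nnegrE ltW.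
pose Z' s := if 0 < s then P s / s ^+ n else 0.
have Zb s : `|Z' s| <= `|s|.
  rewrite /Z'; case: ltP => s0; last by rewrite normr0.
  have sn : 0 < s ^+ n by rewrite exprn_gt0.
  by rewrite normrM normfV (gtr0_norm sn) (gtr0_norm s0) ler_pdivrMr // mulrC Pb.
have Zc : continuous Z'.
  move=> s; case: (ltgtP s 0) => s0.
  - apply/cont_eps => e e0; exists (- s) => [|x]; first lra.
    rewrite ltr_norml => /andP[_ xs].
    by rewrite /Z' !ifF ?subrr ?normr0 //; apply/negbTE; rewrite -leNgt; lra.
  - apply: (@dd_cont _ _ _ (s ^+ n * f (y s) / s ^+ n +
       P s * (- (n%:R * s ^+ n.-1) / s ^+ n ^+ 2))).
    apply: (@eq_dd _ (fun s => P s / s ^+ n) _ _ _ s) => // [x|].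
      by rewrite ltr_norml => /andP[? ?]; rewrite /Z' ifT //; lra.
    have := dP s => ?; dby; last by rewrite /=; ring.
    by rewrite expf_neq0 // gt_eqF.
  - apply/cont_eps => e e0; exists e => // x; rewrite s0 subr0 => xe.
    by rewrite {2}/Z' ltxx subr0 (le_lt_trans (Zb x)).
have [Z Z0 dZ] := antiderivative Zc.
exists Z, Z', P; split => // [s s0|s s0].
  by rewrite /Z' s0 mulrCA divff ?mulr1 // expf_neq0 // gt_eqF.
by rewrite /Z' ifF //; apply/negbTE; rewrite -leNgt.
Qed.

Lemma solves_from_cont y Z Z' P : solves_from y Z Z' P -> continuous Z.
Proof. by move=> [_ [_ dZ] _ _ _] s; exact: dd_cont (dZ s). Qed.

Lemma solves_from_nonpos y Z Z' P : solves_from y Z Z' P ->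
  forall s, s <= 0 -> Z s = 0.
Proof.
move=> [_ [Z0 dZ] _ Zn _] s s0; have := @dd_lip _ Z _ s 0 0 s0 (fun x _ _ => dZ x).
rewrite mul0r Z0 sub0r normrN normr_le0 => H; apply/eqP/H => x _ x0.
by rewrite Zn ?normr0.
Qed.

(** With this weight [weighted_bound] turns the Lipschitz constant [k] into the contraction factor k
    / K^2 = 1 / 2. *)
Let K := Num.sqrt (2 * k).
Let K0 : 0 < K. Proof. by rewrite sqrtr_gt0 mulr_gt0. Qed.
Let K2 : K ^+ 2 = 2 * k. Proof. by rewrite sqr_sqrtr // mulr_ge0 // ltW. Qed.

Lemma solves_from_contract y1 Z1 Z1' P1 y2 Z2 Z2' P2 A :
  solves_from y1 Z1 Z1' P1 -> solves_from y2 Z2 Z2' P2 -> 0 <= A ->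
  (forall s, 0 < s -> `|y1 s - y2 s| <= A * expR (K * s)) ->
  forall s, 0 < s -> `|Z1 s - Z2 s| <= A / 2 * expR (K * s).
Proof.
move=> [[P10 dP1] [Z10 dZ1] ZP1 _ _] [[P20 dP2] [Z20 dZ2] ZP2 _ _] A0 H s s0.
have := @weighted_bound n (fun s => f (y1 s) - f (y2 s)) (fun s => P1 s - P2 s)
  (fun s => Z1 s - Z2 s) (fun s => Z1' s - Z2' s) (k * A) K (s + 1) K0.
rewrite K2 (_ : k * A / (2 * k) = A / 2); last by field; rewrite gt_eqF.
apply; rewrite ?ltrDl //.
- by rewrite mulr_ge0 // ltW.
- by move=> x _ _; rewrite mulrBr; exact: dD (dP1 x) (dN (dP2 x)).
- by move=> x x0 _; rewrite mulrBr ZP1 ?ZP2.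
- move=> x x0 _; rewrite (le_trans (flip _ _)) // -mulrA ler_wpM2l ?H // ltW //.
- apply: vanishes0_cont; last by rewrite P10 P20 subrr.
  exact: dd_cont (dD (dP1 0) (dN (dP2 0))).
- apply: vanishes0_cont; last by rewrite Z10 Z20 subrr.
  exact: dd_cont (dD (dZ1 0) (dN (dZ2 0))).
Qed.

(** The iterates converge geometrically in the weighted norm. Their common Lipschitz bounds make the
    limit continuous, so a Picard step can be applied to it, and the contraction identifies the
    result with the limit. *)
Lemma picard : exists y y' P, solves_from y y y' P.
Proof.
(* The step is carried out on the type of continuous functions, so that choice makes it a self-map
   that can be iterated. *)
have Tex (y : {y : R -> R | continuous y}) : exists Z : {y : R -> R | continuous y},
    exists Z' P, solves_from (sval y) (sval Z) Z' P.
  have [Z [Z' [P H]]] := solves_from_exists (svalP y).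
  by exists (exist _ Z (solves_from_cont H)), Z', P.
pose T y := projT1 (cid (Tex y)).
have TP y : exists Z' P, solves_from (sval y) (sval (T y)) Z' P.
  exact: projT2 (cid (Tex y)).
have c0 : continuous (fun _ : R => 0 : R) by move=> x; exact: cvg_cst.
pose u j := iter j T (exist _ (fun _ : R => 0 : R) c0).
have uP j : exists Z' P, solves_from (sval (u j)) (sval (u j.+1)) Z' P by exact: TP.
pose C := K ^- 2.
have C0 : 0 <= C by rewrite invr_ge0 exprn_ge0 // ltW.
have step j s : 0 < s -> `|sval (u j.+1) s - sval (u j) s| <= C / 2 ^+ j * expR (K * s).
  elim: j s => [|j IH] s s0.
    have [Z' [P [[P0 dP] [Z0 dZ] ZP _ _]]] := uP 0.
    rewrite expr0 divr1 /= subr0.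
    have := @weighted_bound n (fun s => f (sval (u 0) s)) P _ Z' 1 K (s + 1) K0 ler01
      (fun x _ _ => dP x) (fun x _ _ => dZ x) (fun x x0 _ => ZP x x0).
    rewrite div1r; apply; rewrite ?ltrDl //.
    + move=> x x0 _; have /andP[f0 f1] := f01 (sval (u 0) x).
      rewrite mul1r ger0_norm // (le_trans f1) // -[leLHS]expR0 ler_expR.
      by rewrite mulr_ge0 // ltW.
    + exact: vanishes0_cont (dd_cont (dP 0)) P0.
    + exact: vanishes0_cont (dd_cont (dZ 0)) Z0.
  have [Z1' [P1 H1]] := uP j; have [Z2' [P2 H2]] := uP j.+1.
  have := solves_from_contract H2 H1 _ IH s0; rewrite exprS invfM.
  rewrite (_ : C / 2 ^+ j / 2 = C * (2^-1 * (2 ^+ j)^-1)) ?mulrA; last by ring.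
  by apply; rewrite mulr_ge0 // invr_ge0 exprn_ge0.
have u0 j s : s <= 0 -> sval (u j) s = 0.
  by case: j => // j s0; have [Z' [P H]] := uP j; exact: solves_from_nonpos H s s0.
have lim s : exists l, forall j, `|sval (u j) s - l| <= 2 * (C * expR (K * s)) / 2 ^+ j.
  apply: geom_cvg => j; case: (ltP 0 s) => s0; first by rewrite mulrAC step.
  by rewrite !u0 // subrr normr0 !mulr_ge0 ?expR_ge0 // invr_ge0 exprn_ge0.
pose y s := projT1 (cid (lim s)).
have yP s j : `|sval (u j) s - y s| <= 2 * (C * expR (K * s)) / 2 ^+ j.
  exact: (projT2 (cid (lim s)) j).
have lip j M s t : s <= t -> `|s| <= M -> `|t| <= M ->
    `|sval (u j) t - sval (u j) s| <= M * (t - s).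
  move=> st sM tM; have M0 : 0 <= M by apply: le_trans sM.
  case: j => [|j]; first by rewrite subrr normr0 mulr_ge0 // subr_ge0.
  have [Z' [P [_ [_ dZ] _ _ Zb]]] := uP j.
  apply: dd_lip => // x sx xt; rewrite (le_trans (Zb x)) //.
  by move: sM tM; rewrite !ler_norml; lra.
have ylip M s t : s <= t -> `|s| <= M -> `|t| <= M -> `|y t - y s| <= M * (t - s).
  move=> st sM tM.
  apply: (@le_geom _ _ (2 * (C * expR (K * s)) + 2 * (C * expR (K * t)))) => j.
  have := lip j M s t st sM tM; have := yP s j; have := yP t j.
  rewrite mulrDl !ler_norml; lra.
have yc : continuous y.
  move=> x; apply/cont_eps => e e0.
  pose M := `|x| + 1; have M0 : 0 < M by rewrite ltr_wpDl.
  exists (Num.min 1 (e / M)) => [|z]; first by rewrite lt_min ltr01 divr_gt0.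
  rewrite lt_min => /andP[z1 ze].
  have xM : `|x| <= M by rewrite ler_wpDr.
  have zM : `|z| <= M.
    by rewrite -[z](subrK x) (le_trans (ler_normD _ _)) // /M addrC lerD2l ltW.
  move: ze; rewrite ltr_pdivlMr // mulrC; apply: le_lt_trans.
  case: (leP x z) => [xz|/ltW zx].
    by rewrite [X in _ * X]ger0_norm ?subr_ge0 // ylip.
  by rewrite distrC [X in _ * X]distrC [X in _ * X]ger0_norm ?subr_ge0 // ylip.
have [Z [Z' [P H]]] := solves_from_exists yc.
suff E : y = Z by exists y, Z', P; rewrite [X in solves_from _ X]E.
apply/funext => s; case: (ltP 0 s) => s0; last first.
  rewrite (solves_from_nonpos H s0); apply/eqP; rewrite -normr_le0.
  apply: (@le_geom _ _ (2 * (C * expR (K * s)))) => j; rewrite add0r.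
  by have := yP s j; rewrite u0 // sub0r normrN.
apply/eqP; rewrite -subr_eq0 -normr_le0.
apply: (@le_geom _ _ (2 * (C * expR (K * s)))) => j; rewrite add0r.
have [Z1' [P1 H1]] := uP j.
have A0 : 0 <= 2 * C / 2 ^+ j by rewrite !mulr_ge0 // invr_ge0 exprn_ge0.
have := solves_from_contract H1 H A0 _ s0.
have yP' x : 0 < x -> `|sval (u j) x - y x| <= 2 * C / 2 ^+ j * expR (K * x).
  by move=> _; have := yP x j; rewrite mulrA mulrAC.
move=> /(_ yP') h; have := yP s j.+1.
rewrite exprS invfM; move: h; rewrite !ler_norml.
have -> : 2 * C / 2 ^+ j / 2 * expR (K * s) = C * expR (K * s) / 2 ^+ j by field; rewrite expf_neq0.
have -> : 2 * (C * expR (K * s)) * (2^-1 / 2 ^+ j) = C * expR (K * s) / 2 ^+ j by field; rewrite expf_neq0.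
have -> : 2 * (C * expR (K * s)) / 2 ^+ j = 2 * (C * expR (K * s) / 2 ^+ j) by ring.
lra.
Qed.

End Picard.
End Weighted.

(** * The profile *)

Section Profile.
Context {R : realType}.
Implicit Types (b c d l t s r : R) (n : nat).

(** The primitive of e^(b L) vanishing at 0, with its limit form for [b = 0]. As Y'' = e^(b L) (L''
    + b L'^2), the choice b = 1 - d absorbs the gradient term and leaves the right-hand side e^(- (1
    + d) L). *)
Definition Phi b (L : R) : R := if b == 0 then L else (expR (b * L) - 1) / b.
(** The inverse of [Phi b] on its range 1 + b y > 0; elsewhere the value carries no meaning. *)
Definition Psi b (y : R) : R := if b == 0 then y else ln (1 + b * y) / b.

Lemma dPhi b (L : R) : dd L (Phi b) (expR (b * L)).
Proof.
rewrite /Phi; case: eqVneq => [->|b0]; first by rewrite mul0r expR0; exact: did.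
by dby => //; rewrite /=; field.
Qed.

Lemma Phi0 b : Phi b 0 = 0.
Proof. by rewrite /Phi; case: eqP => //; rewrite mulr0 expR0 subrr mul0r. Qed.

Lemma Phi_le b (L1 L2 : R) : L1 <= L2 -> Phi b L1 <= Phi b L2.
Proof. by move=> h; apply: (dd_ndecr h) => x _ _; [exact: dPhi|exact: expR_ge0]. Qed.

Lemma PhiK b (L : R) : Psi b (Phi b L) = L.
Proof.
rewrite /Phi /Psi; case: eqVneq => // b0.
by rewrite mulrCA divff // mulr1 addrC subrK expRK mulrAC divff // mul1r.
Qed.

Lemma dPsi b (L : R) : dd (Phi b L) (Psi b) (expR (- (b * L))).
Proof.
rewrite /Phi /Psi; case: eqVneq => [->|b0].
  by rewrite mul0r oppr0 expR0; exact: did.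
have E : 1 + b * ((expR (b * L) - 1) / b) = expR (b * L) by field.
by dby => //; rewrite ?E ?expR_gt0 // expRN; field; rewrite b0 gt_eqF ?expR_gt0.
Qed.

(** The damping is a parameter because time reversal, with [y] changing sign, replaces [c] by [- c]
    and nothing else. *)
Definition orbit c b l (x y : R -> R) t :=
  dd t x (y t) /\ dd t y (l - c * y t + b * y t ^+ 2 - expR (2 * x t)).

Definition lsol (NN d l : R) (L L' : R -> R) r :=
  dd r L (L' r) /\
  dd r L' (- ((NN - 1) / r * L' r) + l * expR (- (2 * L r)) - (1 - d) * L' r ^+ 2).

Lemma dd_expR t : dd t expR (expR t). Proof. exact: is_derive_expR. Qed.

Lemma lsol_orbit (NN d l : R) (L L' : R -> R) t : 0 < l -> lsol NN d l L L' (expR t) ->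
  orbit (NN - 2 * d) (1 - d) (NN - 1 - d)
    (fun t => t + ln l / 2 - L (expR t)) (fun t => 1 - expR t * L' (expR t)) t.
Proof.
move=> l0 [dL dL']; have e0 := expR_gt0 t; have en : expR t != 0 by rewrite gt_eqF.
have E : expR (2 * (t + ln l / 2 - L (expR t))) = l * expR t ^+ 2 * expR (- (2 * L (expR t))).
  rewrite (_ : 2 * _ = ln l + (2 * t - 2 * L (expR t))); last by field.
  by rewrite expRD lnK ?posrE // expRD mulrA mulr_natl -expRM_natl -mulr_natl.
have h1 := dcomp dL (dd_expR t); have h2 := dcomp dL' (dd_expR t).
split; first by dby; rewrite /=; ring.
by dby; rewrite E /=; field.
Qed.

(** With p = 1 - y = r V' / V this is p (N - d p) - lambda r^2 / V^2. The factor in [pohM] is, up to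
    a constant, r^(N - 2) V^(2 - 2 d); it turns the derivative into (N - 2 d) p^2 times a positive
    weight. *)
Definition pohF (NN d : R) (x y : R -> R) t : R :=
  (1 - y t) * (NN - d * (1 - y t)) - expR (2 * x t).
Definition pohM (NN d : R) (x y : R -> R) t : R :=
  expR ((NN - 2 * d) * t + 2 * (d - 1) * x t) * pohF NN d x y t.

Lemma dpohM (NN d : R) (x y : R -> R) t :
  orbit (NN - 2 * d) (1 - d) (NN - 1 - d) x y t ->
  dd t (pohM NN d x y) ((NN - 2 * d) * (1 - y t) ^+ 2 *
     expR ((NN - 2 * d) * t + 2 * (d - 1) * x t)).
Proof. by move=> [dx dy]; rewrite /pohM /pohF; dby; rewrite /=; ring. Qed.

(** [pohM] is nondecreasing, so a lower bound along some times tending to -oo suffices; for rupture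
    solutions only such a sequence is available. *)
Lemma pohozaev (NN d : R) (x y : R -> R) T : 0 < NN - 2 * d ->
  (forall t, t <= T -> orbit (NN - 2 * d) (1 - d) (NN - 1 - d) x y t) ->
  (forall e t0, 0 < e -> exists2 t, t < t0 & - e <= pohM NN d x y t) ->
  forall t, t <= T -> 0 <= pohF NN d x y t.
Proof.
move=> c0 orb fr t tT; rewrite leNgt; apply/negP => Ft.
have Mt : pohM NN d x y t < 0 by rewrite pmulr_rlt0 ?expR_gt0.
have [s st Ms] := fr (- pohM NN d x y t / 2) t ltac:(lra).
have : pohM NN d x y s <= pohM NN d x y t.
  have D u : s <= u -> u <= t -> dd u (pohM NN d x y) ((NN - 2 * d) * (1 - y u) ^+ 2 *
     expR ((NN - 2 * d) * u + 2 * (d - 1) * x u)).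
    by move=> us ut; apply: dpohM; apply: orb; lra.
  apply: (@dd_ndecr _ (pohM NN d x y) _ _ _ (ltW st) D) => u us ut.
  by rewrite mulr_ge0 ?expR_ge0 // mulr_ge0 ?sqr_ge0 // ltW.
lra.
Qed.

(** A quadratic in p = 1 - y lying above a positive exponential confines p between its roots 0 and N
    / d. In the original variable, 0 < r L' < N / d. *)
Lemma pohF_bounds (NN d : R) (x y : R -> R) t : 0 < d -> 0 < NN ->
  0 <= pohF NN d x y t -> [/\ 0 < 1 - y t, 1 - y t < NN / d &
    expR (2 * x t) <= NN * (1 - y t) - d * (1 - y t) ^+ 2].
Proof.
rewrite /pohF => d0 NN0; set p := 1 - y t; have := expR_gt0 (2 * x t).
set q := expR _ => q0 F0.
have Fq : q <= NN * p - d * p ^+ 2 by rewrite expr2; lra.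
have p0 : 0 < p.
  rewrite ltNge; apply/negP => p0.
  by have : 0 <= d * p ^+ 2 by [rewrite mulr_ge0 ?sqr_ge0 // ltW]; nra.
split => //; rewrite ltr_pdivlMr // -(ltr_pM2l p0); rewrite expr2 in Fq; lra.
Qed.

(** [L'] vanishes on the left of the origin so that [L] is differentiable on the whole line. The
    fourth clause is L''(0) = 1 / N, from which the solution in the ball becomes twice
    differentiable at its centre. The last one is the Pohozaev bound for lambda = 1. *)
Definition is_profile (NN d : R) (L L' : R -> R) : Prop :=
  [/\ L 0 = 0 /\ (forall s, s <= 0 -> L' s = 0),
      forall s : R, dd s L (L' s) /\ (0 < s -> lsol NN d 1 L L' s),
      forall s, 0 <= s -> 0 <= L s,
      forall e, 0 < e -> exists2 r, 0 < r & forall s, 0 < s -> s < r ->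
        `|L' s / s - NN^-1| <= e
    & forall t, 0 <= pohF NN d (fun t => t + ln 1 / 2 - L (expR t))
                           (fun t => 1 - expR t * L' (expR t)) t].

Section Existence.
Variables (n : nat) (d : R).
Hypotheses (n0 : (0 < n)%N) (d0 : 0 < d) (dn : 0 < n.+1%:R - 2 * d).
Let b := 1 - d.
Let NN : R := n.+1%:R.

(** In terms of y = Phi(L) the derivative of e^(- (1 + d) L) is - (1 + d) e^(- 2 L), at most [1 + d]
    in size when [0 <= L]. Only the values of [Phi] on the half line [0 <= L] matter; beyond them
    the function is extended. *)
Lemma nonlinearity : exists f : R -> R,
  [/\ forall L, 0 <= L -> f (Phi b L) = expR (- ((1 + d) * L)),
      forall y, 0 <= f y <= 1 & forall y z, `|f y - f z| <= (1 + d) * `|y - z|].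
Proof.
pose A := [set Phi b L | L in [set L | 0 <= L]].
pose h y := expR (- ((1 + d) * Psi b y)).
have hE L : h (Phi b L) = expR (- ((1 + d) * L)) by rewrite /h PhiK.
have mono (L1 L2 : R) : 0 <= L1 -> L1 <= L2 ->
    expR (- ((1 + d) * L1)) - expR (- ((1 + d) * L2)) <= (1 + d) * (Phi b L2 - Phi b L1).
  move=> L10 L12.
  have D (L : R) : dd L (fun L => expR (- ((1 + d) * L)) + (1 + d) * Phi b L)
     ((1 + d) * (expR (b * L) - expR (- ((1 + d) * L)))).
    by have := dPhi b L => ?; dby; rewrite /=; ring.
  have := @dd_ndecr R _ _ L1 L2 L12 (fun L _ _ => D L).
  move=> /(_ _) H; have : forall x, L1 <= x -> x <= L2 ->
     0 <= (1 + d) * (expR (b * x) - expR (- ((1 + d) * x))).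
    move=> x x1 x2; rewrite mulr_ge0 ?subr_ge0 ?ler_expR; [lra| |].
      by rewrite addr_ge0 // ltW.
    by rewrite /b; nra.
  by move=> /H; lra.
have [||||f [fA f01 flip]] := @lipschitz_extension R A h (1 + d).
- by exists (Phi b 0), 0 => /=.
- by rewrite addr_ge0 // ltW.
- move=> _ [L /= L0 <-]; rewrite hE expR_ge0 -[leRHS]expR0 ler_expR oppr_le0.
  by rewrite mulr_ge0 // addr_ge0 // ltW.
- move=> _ _ [L1 /= L10 <-] [L2 /= L20 <-]; rewrite !hE.
  case: (leP L1 L2) => [L12|/ltW L21].
    have := mono _ _ L10 L12; have : Phi b L1 <= Phi b L2 by exact: Phi_le.
    move=> hP h1; apply: (@le_trans _ _ 0).
      rewrite subr_le0 ler_expR lerN2 ler_wpM2l // addr_ge0 // ltW //.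
    by rewrite mulr_ge0 // addr_ge0 // ltW.
  have hP : Phi b L2 <= Phi b L1 by exact: Phi_le.
  by have := mono _ _ L20 L21; rewrite ger0_norm // subr_ge0.
by exists f; split => // L L0; rewrite fA ?hE //; exists L.
Qed.

(** Picard gives [Y] on the whole line, but [Psi b (Y s)] solves the equation for [L] only while [Y]
    stays in the range of [Phi b], which for [1 < d] is bounded above. The Pohozaev bound limits the
    growth of [L] to a logarithm and so keeps [Y] inside. *)
Lemma profile : exists L L' : R -> R, is_profile NN d L L'.
Proof.
have [f [fPhi f01 flip]] := nonlinearity.
have k0 : 0 < 1 + d by rewrite addr_gt0.
have [Y [Y' [P [[P0 dP] [Y0 dY] YP Yn Yb]]]] := picard n k0 f01 flip.
have nN : n%:R = NN - 1 :> R by rewrite /NN -natr1 addrK.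
have P_ge0 s : 0 <= s -> 0 <= P s.
  move=> s0; rewrite -P0; apply: (@dd_ndecr _ P _ _ _ s0 (fun x _ _ => dP x)) => x x0 _.
  by rewrite mulr_ge0 ?exprn_ge0 //; case/andP: (f01 (Y x)).
have Y'_ge0 s : 0 <= Y' s.
  case: (ltP 0 s) => s0; last by rewrite Yn.
  by have := P_ge0 s (ltW s0); rewrite -YP // pmulr_rge0 // exprn_gt0.
have Yle s t : s <= t -> Y s <= Y t.
  by move=> st; apply: (@dd_ndecr _ Y _ _ _ st (fun x _ _ => dY x)) => x _ _.
have Y_ge0 s : 0 <= s -> 0 <= Y s by move=> s0; rewrite -Y0 Yle.
pose L s := Psi b (Y s); pose L' s := expR (- (b * L s)) * Y' s.
have range B s : 0 <= B -> 0 <= s -> Y s <= Phi b B -> 0 <= L s <= B /\ Y s = Phi b (L s).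
  move=> B0 s0 sB; have [|||c [c0 cB E]] := @IVTc _ (Phi b) 0 B (Y s) B0.
  - by move=> x _ _; exact: dd_cont (dPhi b x).
  - by rewrite Phi0 Y_ge0.
  - by [].
  by rewrite /L -E PhiK c0 cB.
have dL s : Y s = Phi b (L s) -> dd s L (L' s).
  by move=> E; have := dPsi b (L s); rewrite -E => /dcomp; apply.
have dY' s : 0 < s -> dd s Y' (f (Y s) - n%:R / s * Y' s).
  move=> s0; have sn : s ^+ n != 0 by rewrite expf_neq0 // gt_eqF.
  have sn1 : s ^+ n.-1 != 0 by rewrite expf_neq0 // gt_eqF.
  apply: (@eq_dd _ (fun s => P s / s ^+ n) _ _ _ s) => // [x|].
    rewrite ltr_norml => /andP[? ?]; rewrite -YP; last lra.
    by rewrite mulrAC divff ?mul1r // expf_neq0 // gt_eqF //; lra.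
  have := dP s => ?; dby => //; rewrite /= -YP // -(prednK n0) /= exprS.
  by field; rewrite gt_eqF // sn1.
have sol s : 0 < s -> 0 <= L s -> Y s = Phi b (L s) -> lsol NN d 1 L L' s.
  move=> s0 L0 E; split; first exact: dL.
  have h1 := dL s E; have h2 := dY' s s0; dby; rewrite /= E fPhi // -nN.
  have -> : expR (- (2 * L s)) = expR (- (b * L s)) * expR (- ((1 + d) * L s)).
    by rewrite -expRD; congr expR; rewrite /b; ring.
  by rewrite /L' /b; ring.
have [s0 [s00 s01 Ys0]] : exists s0, [/\ 0 < s0, s0 <= 1 & Y s0 <= Phi b 1].
  have P1 : 0 < Phi b 1.
    rewrite -(Phi0 b); apply: (@dd_incr _ (Phi b) _ _ _ ltr01 (fun x _ _ => dPhi b x)) => x _ _.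
    exact: expR_gt0.
  have /cont_eps/(_ _ P1)[r r0 H] := dd_cont (dY 0).
  have m0 : 0 < Num.min 1 (r / 2) by rewrite lt_min ltr01 divr_gt0.
  exists (Num.min 1 (r / 2)); split => //; first by rewrite ge_min lexx.
  have := H (Num.min 1 (r / 2)); rewrite Y0 !subr0 gtr0_norm // => /(_ _)/ltW h.
  apply: le_trans (ler_norm _) (h _).
  by apply: (@le_lt_trans _ _ (r / 2)); [rewrite ge_min lexx orbT|lra].
pose x t := t + ln 1 / 2 - L (expR t); pose y t := 1 - expR t * L' (expR t).
have fr e t0 : 0 < e -> exists2 t, t < t0 & - e <= pohM NN d x y t.
  (* Near the origin 0 <= L <= 1, so [E1] bounds both the weight in [pohM] and the ratio of (1 -
     y)^2 to r^2; hence [pohM] is at least - C r^2. *)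
  move=> e0; pose E1 := expR (2 * `|b|); pose C := E1 * (d * E1 + 1).
  have C0 : 0 < C by rewrite mulr_gt0 ?expR_gt0 // addr_gt0 // mulr_gt0 ?expR_gt0.
  pose t := Num.min (Num.min (ln s0) (t0 - 1)) (Num.min (ln (e / C) / 2) 0).
  have t1 : t <= ln s0 by rewrite /t !ge_min lexx.
  have t2 : t <= t0 - 1 by rewrite /t !ge_min lexx orbT.
  have t3 : t <= ln (e / C) / 2 by rewrite /t !ge_min lexx !orbT.
  have t4 : t <= 0 by rewrite /t !ge_min lexx !orbT.
  exists t; first lra.
  have et := expR_gt0 t.
  have ets0 : expR t <= s0 by rewrite -(lnK (s00 : s0 \is Num.pos)) ler_expR.
  have [/andP[L0 L1] E] := range 1 _ ler01 (ltW et) (le_trans (Yle _ _ ets0) Ys0).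
  have e2t : expR t ^+ 2 <= e / C.
    by rewrite -expRM_natl -[leRHS]lnK ?posrE ?divr_gt0 // ler_expR; lra.
  have bL : `|b * L (expR t)| <= `|b|.
    by rewrite normrM ler_piMr // ger0_norm.
  have p0 : 0 <= 1 - y t.
    by rewrite /y opprB addrC subrK mulr_ge0 ?expR_ge0 // mulr_ge0 ?expR_ge0.
  have p2 : (1 - y t) ^+ 2 <= E1 * expR t ^+ 2.
    have -> : E1 = expR `|b| ^+ 2 by rewrite /E1 -expRM_natl.
    have -> : 1 - y t = expR t * L' (expR t) by rewrite /y; ring.
    rewrite -exprMn lerXn2r ?nnegrE ?mulr_ge0 ?expR_ge0 // mulrC ler_wpM2r ?expR_ge0 //.
    rewrite /L' -[leRHS]mulr1; apply: ler_pM; rewrite ?expR_ge0 //.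
      by rewrite ler_expR; move: bL; rewrite ler_norml; lra.
    apply: le_trans (ler_norm _) (le_trans (Yb _) _).
    by rewrite gtr0_norm // -expR0 ler_expR.
  have q1 : expR (2 * x t) <= expR t ^+ 2.
    by rewrite -expRM_natl ler_expR /x ln1; lra.
  have m1 : expR ((NN - 2 * d) * t + 2 * (d - 1) * x t) <= E1.
    rewrite /E1 ler_expR /x ln1.
    have NN2 : 2 <= NN by rewrite /NN ler_nat.
    have : 0 <= (NN - 2) * - t by rewrite mulr_ge0 // ?subr_ge0 // oppr_ge0.
    by move: bL; rewrite ler_norml => /andP[_]; rewrite /b; lra.
  have F1 : - ((d * E1 + 1) * expR t ^+ 2) <= pohF NN d x y t.
    rewrite /pohF; have : 0 <= NN * (1 - y t) by rewrite mulr_ge0.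
    have := ler_wpM2l (ltW d0) p2; rewrite expr2; lra.
  have d1 : 0 <= d * E1 + 1 by rewrite addr_ge0 // mulr_ge0 ?expR_ge0 // ltW.
  apply: (@le_trans _ _ (- (C * expR t ^+ 2))).
    by rewrite lerN2 mulrC -ler_pdivlMr.
  case: (leP 0 (pohF NN d x y t)) => [F0|F0].
    apply: (@le_trans _ _ 0); last by rewrite mulr_ge0 // expR_ge0.
    by rewrite oppr_le0 mulr_ge0 ?exprn_ge0 // ltW.
  rewrite /pohM lerNl -mulrN /C -[X in _ <= X]mulrA.
  by apply: ler_pM; [exact: expR_ge0|rewrite oppr_ge0 ltW|exact: m1|rewrite lerNl].
have orb t : 0 <= L (expR t) -> Y (expR t) = Phi b (L (expR t)) ->
    orbit (NN - 2 * d) (1 - d) (NN - 1 - d) x y t.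
  by move=> L0 E; exact: (lsol_orbit ltr01 (sol _ (expR_gt0 t) L0 E)).
(* The integral from [s0], where [L <= 1], of the Pohozaev bound N / (d s) on [L']. *)
pose B s := 1 + NN / d * (ln s - ln s0).
have NN0 : 0 < NN by rewrite /NN ltr0n.
have Nd : 0 < NN / d by rewrite divr_gt0.
have B0 s : s0 <= s -> 0 <= B s.
  by move=> h; rewrite /B addr_ge0 // mulr_ge0 ?(ltW Nd) // subr_ge0 ler_ln ?posrE //; lra.
(* Otherwise [Y] takes this value at some [s3]. Being monotone, it lies in the range before [s3], so
   the equation and the Pohozaev bound hold up to there and give [L s3 <= B s3], against
   [L s3 = B s2 + 1]. *)
have bound s2 : s0 <= s2 -> Y s2 <= Phi b (B s2 + 1).
  move=> s02; rewrite leNgt; apply/negP => big.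
  have BB := B0 _ s02.
  have [|||s3 [s03 s32 Ys3]] := @IVTc _ Y s0 s2 (Phi b (B s2 + 1)) s02.
  - by move=> z _ _; exact: dd_cont (dY z).
  - by apply: le_trans Ys0 _; apply: Phi_le; lra.
  - exact: ltW.
  have L3 : L s3 = B s2 + 1 by rewrite /L Ys3 PhiK.
  have s30 : 0 < s3 by lra.
  have rng s : 0 <= s -> s <= s3 -> 0 <= L s /\ Y s = Phi b (L s).
    move=> h1 h2; have h3 : 0 <= B s2 + 1 by lra.
    have h4 : Y s <= Phi b (B s2 + 1) by rewrite -Ys3 Yle.
    by have [/andP[]] := range _ _ h3 h1 h4.
  have orb3 u : u <= ln s3 -> orbit (NN - 2 * d) (1 - d) (NN - 1 - d) x y u.
    move=> us; have [|h1 h2] := rng (expR u) (expR_ge0 u).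
      by rewrite -(lnK (s30 : s3 \is Num.pos)) ler_expR.
    exact: orb.
  have pF := pohozaev dn orb3 fr.
  have L's s : 0 < s -> s <= s3 -> L' s <= NN / d / s.
    move=> h1 h2; have h3 : ln s <= ln s3 by rewrite ler_ln ?posrE.
    have [_ + _] := pohF_bounds d0 NN0 (pF _ h3).
    rewrite /y lnK ?posrE // opprB addrC subrK => h; rewrite ler_pdivlMr // mulrC; lra.
  have dL3 s : s0 <= s -> s <= s3 -> dd s L (L' s).
    by move=> h1 h2; apply: dL; have [||] := rng s; lra.
  have dB s : s0 <= s -> s <= s3 -> dd s B (NN / d / s).
    by move=> h1 h2; have : 0 < s by [lra]; move=> ?; dby => //; rewrite /=; field; rewrite !gt_eqF.
  have := @dd_le _ L B _ _ s0 s3 s03 dL3 dB.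
  move=> /(_ _) h; have {}h : L s3 - L s0 <= B s3 - B s0.
    by apply: h => s h1 h2; apply: L's => //; lra.
  have [/andP[_ Ls0] _] := range 1 _ ler01 (ltW s00) Ys0.
  have Bs0 : B s0 = 1 by rewrite /B subrr mulr0 addr0.
  have : B s3 <= B s2 by rewrite /B lerD2l ler_wpM2l ?(ltW Nd) // lerD2r ler_ln ?posrE //; lra.
  lra.
have all s : 0 <= s -> 0 <= L s /\ Y s = Phi b (L s).
  move=> h; case: (leP s0 s) => ss.
    have h2 := B0 _ ss.
    by have [|/andP[]] := range (B s + 1) s _ h (bound s ss); [lra|].
  by have [/andP[]] := range 1 s ler01 h (le_trans (Yle _ _ (ltW ss)) Ys0).
have Lneg s : s <= 0 -> Y s = Phi b (L s).
  move=> h; have E : Y s = 0.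
    apply/eqP; rewrite -normr_le0.
    have := @dd_lip _ Y _ s 0 0 h (fun x _ _ => dY x).
    by rewrite mul0r Y0 sub0r normrN; apply => z _ z0; rewrite Yn ?normr0.
  by rewrite /L E -(Phi0 b) PhiK.
exists L, L'; split.
- by rewrite /L Y0 -[X in Psi _ X](Phi0 b) PhiK; split => // s h; rewrite /L' Yn ?mulr0.
- move=> s; split; first by apply: dL; case: (leP s 0) => [/Lneg|/ltW/all[]].
  by move=> h; have [? ?] := all _ (ltW h); exact: sol.
- by move=> s /all[].
(* The error is 2 w from [Y'] plus w from the factor e^(- b L), hence [e / 3]; [w <= 1] keeps that
   factor below 2. *)
- move=> e e0; pose w := Num.min 1 (e / 3).
  have w0 : 0 < w by rewrite lt_min ltr01 divr_gt0.
  have w1 : w <= 1 by rewrite ge_min lexx.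
  have we : w <= e / 3 by rewrite ge_min lexx orbT.
  have L00 : L 0 = 0 by rewrite /L Y0 -[X in Psi _ X](Phi0 b) PhiK.
  have fY0 : f (Y 0) = 1 by rewrite Y0 -(Phi0 b) fPhi // mulr0 oppr0 expR0.
  have /cont_eps/(_ _ w0)[r1 r10 H1] : {for 0, continuous (fun s => expR (- (b * L s)))}.
    by have h := dL 0 (Lneg 0 (lexx 0)); apply: dd_cont; dsolve.
  have /cont_eps/(_ _ w0)[r2 r20 H2] : {for 0, continuous (f \o Y)}.
    by apply: continuous_comp; [exact: dd_cont (dY 0)|exact: f_cont k0 flip _].
  exists (Num.min r1 r2) => [|s s_gt0]; first by rewrite lt_min r10.
  rewrite lt_min => /andP[sr1 sr2].
  have := H1 s; rewrite subr0 gtr0_norm // L00 mulr0 oppr0 expR0 => /(_ sr1) h1.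
  have Pest : `|P s - s ^+ n.+1 / NN| <= w * s ^+ n * s.
    have := @dd_lip _ (fun x => P x - x ^+ n.+1 / NN)
      (fun x => x ^+ n * (f (Y x) - 1)) 0 s (w * s ^+ n) (ltW s_gt0).
    rewrite P0 expr0n /= mul0r !subr0; apply => z z0 zs.
      have := dP z => ?; dby; rewrite /= -/NN; field.
      by rewrite gt_eqF.
    have := H2 z; rewrite /= fY0 subr0 ger0_norm // => /(_ ltac:(lra)) h.
    rewrite normrM (ger0_norm (exprn_ge0 _ z0)) mulrC; apply: ler_pM; rewrite ?exprn_ge0 //.
      exact: ltW.
    by rewrite lerXn2r // nnegrE // ltW.
  have Yest : `|Y' s / s - NN^-1| <= w.
    have sn : 0 < s ^+ n * s by rewrite mulr_gt0 // exprn_gt0.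
    rewrite -(ler_pM2l sn) -{1}(gtr0_norm sn) -normrM.
    have -> : s ^+ n * s * (Y' s / s - NN^-1) = P s - s ^+ n.+1 / NN.
      by rewrite -YP // exprS; field; rewrite !gt_eqF.
    by rewrite (mulrC _ w) mulrA.
  have -> : L' s / s - NN^-1 = expR (- (b * L s)) * (Y' s / s - NN^-1) +
      (expR (- (b * L s)) - 1) / NN by rewrite /L'; ring.
  apply: le_trans (ler_normD _ _) _; rewrite !normrM (gtr0_norm (expR_gt0 _)).
  have t1 : expR (- (b * L s)) * `|Y' s / s - NN^-1| <= 2 * w.
    by apply: ler_pM; rewrite ?expR_ge0 //; move: h1; rewrite ltr_norml; lra.
  have t2 : `|expR (- (b * L s)) - 1| * `|NN^-1| <= w.
    rewrite -[leRHS]mulr1; apply: ler_pM => //; first exact: ltW.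
    by rewrite normfV gtr0_norm // invf_le1 // /NN ler1n.
  by lra.
- have orb3 T u (_ : u <= T) : orbit (NN - 2 * d) (1 - d) (NN - 1 - d) x y u.
    by have [? ?] := all _ (expR_ge0 u); exact: orb.
  by move=> t; exact: (pohozaev dn (orb3 t) fr (lexx t)).
Qed.
End Existence.
End Profile.

(** * The phase plane *)

Section PhasePlane.
Context {R : realType}.
Variables (NN d : R).
Hypotheses (NN2 : 2 <= NN) (d0 : 0 < d) (c0 : 0 < NN - 2 * d).
Let l : R := NN - 1 - d.
Implicit Types (x y : R -> R) (t s u k e T B : R).

Lemma l_gt0 : 0 < l.
Proof. by move: NN2 c0; rewrite /l => h1 h2; lra. Qed.

(** The potential of the energy: a primitive of (e^(2 u) - l) e^(2 (d - 1) u). Using [Phi] includes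
    the case [d = 1]. Its strict minimum is the equilibrium [xs]. *)
Definition G u : R := expR (2 * d * u) / (2 * d) - l * Phi (2 * (d - 1)) u.
Definition xs : R := ln l / 2.

Lemma expR_xs : expR (2 * xs) = l.
Proof. by rewrite /xs (mulrC 2) divfK // lnK // posrE l_gt0. Qed.

Lemma dG u : dd u G ((expR (2 * u) - l) * expR (2 * (d - 1) * u)).
Proof.
have dP := dPhi (2 * (d - 1)) u; rewrite /G.
apply: (@dval _ _ _ (expR (2 * d * u) - l * expR (2 * (d - 1) * u))).
  by dby; rewrite /=; field; rewrite gt_eqF.
rewrite [RHS]mulrBl -expRD; congr (expR _ - _); ring.
Qed.

Lemma G_cont u : {for u, continuous G}. Proof. exact: dd_cont (dG u). Qed.

Lemma G_incr u1 u2 : xs <= u1 -> u1 < u2 -> G u1 < G u2.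
Proof.
move=> h1 h2; apply: (@dd_incr _ G _ _ _ h2 (fun u _ _ => dG u)) => u h3 h4.
by rewrite mulr_gt0 ?expR_gt0 // subr_gt0 -expR_xs ltr_expR; lra.
Qed.

Lemma G_decr u1 u2 : u2 <= xs -> u1 < u2 -> G u2 < G u1.
Proof.
move=> h1 h2; rewrite -ltrN2.
apply: (@dd_incr _ (fun u => - G u) _ _ _ h2 (fun u _ _ => dN (dG u))) => u h3 h4.
by rewrite oppr_gt0 pmulr_llt0 ?expR_gt0 // subr_lt0 -expR_xs ltr_expR; lra.
Qed.

Lemma G_min u : u != xs -> G xs < G u.
Proof. by rewrite neq_lt => /orP[h|h]; [exact: G_decr|exact: G_incr]. Qed.

Lemma G_min_le u : G xs <= G u.
Proof. by have [->//|h] := eqVneq u xs; exact/ltW/G_min. Qed.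

Lemma xs_le u : l <= expR (2 * u) -> xs <= u.
Proof. by rewrite -expR_xs ler_expR; lra. Qed.

(* The energy level reached at a maximum of [x] is below the (possibly finite)
   value of [G] at [-oo]; this uses [2 d < NN] when [1 < d]. *)
Lemma G_lower : exists g, forall X u, l <= expR (2 * X) -> expR (2 * X) <= NN - d ->
  G u <= G X -> g <= u.
Proof.
pose X1 := ln (NN - d) / 2.
have Nd : 0 < NN - d by move: NN2 c0 => h1 h2; lra.
have E1 : expR (2 * X1) = NN - d by rewrite /X1 (mulrC 2) divfK // lnK.
have GX X : l <= expR (2 * X) -> expR (2 * X) <= NN - d -> G X <= G X1.
  move=> h1 h2; have : X <= X1 by move: h2; rewrite -E1 ler_expR; lra.
  by rewrite le_eqVlt => /predU1P[->//|h]; apply/ltW/G_incr => //; exact: xs_le.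
have l0 := l_gt0.
case: (leP d 1) => d1.
  (* For [d <= 1] convexity of the exponential gives Phi(u) <= u for the exponent 2 (d - 1), so G u
     >= - l u, and the level [G X1] bounds [u] from below. *)
  exists (- G X1 / l) => X u h1 h2 h3; have {}h3 := le_trans h3 (GX X h1 h2).
  rewrite ler_pdivrMr //.
  have : 0 <= expR (2 * d * u) / (2 * d) by rewrite divr_ge0 ?expR_ge0 // mulr_ge0 // ltW.
  suff : Phi (2 * (d - 1)) u <= u.
    by rewrite -(ler_pM2l l0); move: h3; rewrite {1}/G => *; lra.
  rewrite /Phi; case: eqVneq => // a0.
  have : d - 1 < 0 by rewrite lt_neqAle; apply/andP; split; [apply: contra a0 => /eqP ->; rewrite mulr0|lra].
  move=> a1; rewrite ler_ndivrMr; last lra.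
  by have := expR_ge1Dx (2 * (d - 1) * u); lra.
pose a := d - 1; have a0 : 0 < a by rewrite subr_gt0.
(* For [1 < d] the limit of [G] at -oo is l / (2 a), and the level [G X1] lies below it by exactly
   kap e^(2 a X1). Positivity of [kap] is the condition 2 d < N. *)
pose kap := l / (2 * a) - (NN - d) / (2 * d).
have kap0 : 0 < kap.
  have -> : kap = (NN - 2 * d) / (2 * a * d) by rewrite /kap /a /l; field; rewrite !gt_eqF.
  by rewrite divr_gt0 // !mulr_gt0.
pose m := 2 * a * expR (2 * a * X1) * kap / l.
have m0 : 0 < m by rewrite divr_gt0 // !mulr_gt0 ?expR_gt0.
have GE u : G u = expR (2 * d * u) / (2 * d) - l * ((expR (2 * a * u) - 1) / (2 * a)).
  by rewrite /G /Phi -/a ifF //; apply/negbTE; rewrite mulf_neq0 // gt_eqF.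
exists (ln m / (2 * a)) => X u h1 h2 h3; have {}h3 := le_trans h3 (GX X h1 h2).
rewrite ler_pdivrMr; last by rewrite mulr_gt0.
rewrite -ler_expR lnK ?posrE // (mulrC u).
have : 0 <= expR (2 * d * u) / (2 * d) by rewrite divr_ge0 ?expR_ge0 // mulr_ge0 // ltW.
have EX1 : expR (2 * d * X1) = expR (2 * a * X1) * (NN - d).
  by rewrite -E1 -expRD; congr expR; rewrite /a; ring.
move: h3; rewrite !GE EX1 => h3 h4.
have -> : m = (l / (2 * a) * expR (2 * a * X1) - (NN - d) / (2 * d) * expR (2 * a * X1)) * (2 * a) / l.
  by rewrite /m /kap; ring.
rewrite ler_pdivrMr // -ler_pdivlMr ?mulr_gt0 //.
lra.
Qed.

(** The exponential is the integrating factor of the term (1 - d) y^2: with it only the damping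
    contributes to the derivative. *)
Definition En x y t : R := y t ^+ 2 * expR (2 * (d - 1) * x t) / 2 + G (x t).

Lemma dEn k x y t : orbit k (1 - d) l x y t ->
  dd t (En x y) (- k * (y t ^+ 2 * expR (2 * (d - 1) * x t))).
Proof.
move=> [dx dy]; have h := dcomp (dG (x t)) dx; rewrite /En.
by dby; rewrite /=; field.
Qed.

Lemma En_ge x y t : G (x t) <= En x y t.
Proof. by rewrite /En lerDr divr_ge0 // mulr_ge0 ?sqr_ge0 ?expR_ge0. Qed.

Lemma norm_tri3 u1 u2 u3 u4 : `|u1 + u2 + u3 + u4| <= `|u1| + `|u2| + `|u3| + `|u4|.
Proof. by do 2 ?[apply: le_trans (ler_normD _ _) _; rewrite lerD2r]; exact: ler_normD. Qed.

Lemma orbit_bounded_cvg k x y T B : k != 0 ->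
  (forall t, T <= t -> orbit k (1 - d) l x y t) ->
  (forall t, T <= t -> `|x t| <= B /\ `|y t| <= B) ->
  forall e, 0 < e -> exists2 S, T <= S &
    forall t, S <= t -> `|y t| < e /\ `|expR (2 * x t) - l| < e.
Proof.
move=> k0 orb bnd.
have B0 : 0 <= B by have [h _] := bnd T (lexx _); apply: le_trans h.
pose a := d - 1.
pose Ea (t : R) := expR (2 * a * x t).
pose yd (t : R) := l - k * y t + (1 - d) * y t ^+ 2 - expR (2 * x t).
pose A1 := expR (2 * `|a| * B).
pose Y1 := `|l| + `|k| * B + `|1 - d| * B ^+ 2 + expR (2 * B).
have ybd (t : R) : T <= t -> `|yd t| <= Y1.
  move=> /bnd[xB yB]; apply: le_trans (norm_tri3 _ _ _ _) _.
  rewrite !normrN (normrM k) (normrM (1 - d)) normrX (ger0_norm (expR_ge0 _)) /Y1.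
  apply: lerD; [apply: lerD; [apply: lerD|]|] => //.
  - by rewrite ler_wpM2l.
  - by rewrite ler_wpM2l // lerXn2r // nnegrE.
  - by rewrite ler_expR ler_pM2l //; apply: le_trans (ler_norm _) xB.
have Eab (t : R) : T <= t -> Ea t <= A1 /\ A1^-1 <= Ea t.
  move=> /bnd[xB _]; rewrite /Ea /A1 -expRN !ler_expR.
  have : `|a * x t| <= `|a| * B by rewrite normrM ler_wpM2l.
  by rewrite ler_norml => /andP[? ?]; split; lra.
have A10 : 0 < A1 by exact: expR_gt0.
have [MG _ HG] := @cont_bounded _ G (- B) B (fun u _ _ => @G_cont u).
(* The factor [- k] makes the derivative k^2 y^2 times a positive weight, so the function increases
   for either sign of [k]. *)
pose f (t : R) := - k * En x y t.
pose f1 (t : R) := k ^+ 2 * (y t ^+ 2 * Ea t).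
pose f2 (t : R) := k ^+ 2 * ((2 * y t * yd t + 2 * a * y t ^+ 3) * Ea t).
have df (t : R) : T <= t -> dd t f (f1 t).
  by move=> /orb/dEn h; rewrite /f; dby; rewrite /= /f1 /Ea /a; ring.
have df1 (t : R) : T <= t -> dd t f1 (f2 t).
  by move=> /orb[dx dy]; rewrite /f1 /Ea; dby; rewrite /= /f2 /Ea /yd; ring.
have dyd (t : R) : T <= t -> dd t yd (- k * yd t + 2 * (1 - d) * y t * yd t - 2 * y t * expR (2 * x t)).
  by move=> /orb[dx dy]; rewrite {1}/yd; dby; rewrite /= /yd; ring.
have f2b (t : R) : T <= t -> `|f2 t| <= k ^+ 2 * ((2 * B * Y1 + 2 * `|a| * B ^+ 3) * A1).
  move=> Tt; have [xB yB] := bnd t Tt; have := ybd t Tt => yd1; have [E1 _] := Eab t Tt.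
  rewrite /f2 normrM ger0_norm ?sqr_ge0 // ler_wpM2l ?sqr_ge0 // normrM.
  apply: ler_pM => //; last by rewrite ger0_norm // expR_ge0.
  apply: le_trans (ler_normD _ _) _; rewrite (normrM _ (yd t)) (normrM 2 (y t)) (normrM _ (y t ^+ 3)) (normrM 2 a) normrX !(ger0_norm (ler0n _ _)).
  apply: lerD; first by apply: ler_pM; rewrite ?mulr_ge0 // ler_wpM2l.
  by rewrite ler_wpM2l ?mulr_ge0 // lerXn2r // nnegrE.
have fm (s t : R) : T <= s -> s <= t -> f s <= f t.
  move=> Ts st; apply: (@dd_ndecr _ f f1 _ _ st) => u su ut; first by apply: df; lra.
  by rewrite /f1 mulr_ge0 ?sqr_ge0 // mulr_ge0 ?sqr_ge0 ?expR_ge0.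
have fb (t : R) : T <= t -> f t <= `|k| * (B ^+ 2 * A1 / 2 + MG).
  move=> Tt; have [xB yB] := bnd t Tt; have [E1 _] := Eab t Tt.
  apply: le_trans (ler_norm _) _; rewrite /f normrM normrN ler_wpM2l //.
  rewrite /En; apply: le_trans (ler_normD _ _) _; apply: lerD; last first.
    by apply: HG; move: xB; rewrite ler_norml => /andP[].
  rewrite ger0_norm; last by rewrite divr_ge0 // mulr_ge0 ?sqr_ge0 ?expR_ge0.
  apply: ler_wpM2r => //.
  apply: ler_pM; rewrite ?sqr_ge0 ?expR_ge0 // -(real_normK (num_real (y t))).
  by rewrite lerXn2r // nnegrE.
have [lim _ cvf] := mono_bounded_cvg fm fb.
have f1c := landau df df1 f2b cvf.
have yc (e : R) : 0 < e -> exists2 S, T <= S & forall t, S <= t -> `|y t| < e.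
  move=> e0; have k2 : 0 < k ^+ 2 by rewrite lt_neqAle sqr_ge0 eq_sym expf_neq0.
  have [|S TS H] := f1c (k ^+ 2 * (e ^+ 2 / A1)).
    by rewrite mulr_gt0 // divr_gt0 // exprn_gt0.
  exists S => // t St; have [_ E2] := Eab t (le_trans TS St).
  have := H t St; rewrite /f1 ger0_norm; last first.
    by rewrite mulr_ge0 ?sqr_ge0 // mulr_ge0 ?sqr_ge0 ?expR_ge0.
  rewrite ltr_pM2l // => h.
  rewrite -(ltr_pXn2r (ltn0Sn 1)) ?nnegrE ?(ltW e0) // real_normK; last exact: num_real.
  rewrite -(ltr_pM2r (_ : 0 < A1^-1)) ?invr_gt0 //; apply: le_lt_trans h.
  by rewrite ler_wpM2l ?sqr_ge0.
have ydc : forall e, 0 < e -> exists2 S, T <= S & forall t, S <= t -> `|yd t| < e.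
  have y0 (e : R) : 0 < e -> exists2 S, T <= S & forall t, S <= t -> `|y t - 0| < e.
    by move=> /yc[S TS H]; exists S => // t /H; rewrite subr0.
  have dy (t : R) : T <= t -> dd t y (yd t) by move=> /orb[].
  apply: (landau dy dyd _ y0).
  instantiate (1 := `|k| * Y1 + 2 * `|1 - d| * B * Y1 + 2 * B * expR (2 * B)).
  move=> t Tt; have [xB yB] := bnd t Tt; have := ybd t Tt => yd1.
  apply: le_trans (ler_normD _ _) _; rewrite normrN; apply: lerD; last first.
    rewrite !normrM (ger0_norm (ler0n _ _)) (ger0_norm (expR_ge0 _)).
    apply: ler_pM; rewrite ?mulr_ge0 ?expR_ge0 ?ler_wpM2l // ler_expR ler_pM2l //.
    by apply: le_trans (ler_norm _) xB.
  apply: le_trans (ler_normD _ _) _; rewrite !normrM normrN (ger0_norm (ler0n _ _)).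
  apply: lerD; first by rewrite ler_wpM2l.
  by apply: ler_pM => //; rewrite ?mulr_ge0 // ler_wpM2l // mulr_ge0.
move=> e e0.
pose w := e / (2 * (1 + `|k| + `|1 - d| * B)).
have den : 0 < 1 + `|k| + `|1 - d| * B by rewrite -addrA ltr_wpDr // addr_ge0 // mulr_ge0.
have w0 : 0 < w by rewrite divr_gt0 // mulr_gt0.
have we : w + w * `|k| + w * (`|1 - d| * B) = e / 2 by rewrite /w; field; rewrite gt_eqF.
have [S1 TS1 H1] := yc w w0; have [S2 TS2 H2] := ydc w w0.
exists (Num.max S1 S2) => [|t]; first by rewrite le_max TS1.
rewrite ge_max => /andP[h1 h2]; have := H1 t h1 => yw; have := H2 t h2 => ydw.
have [xB yB] := bnd t (le_trans TS1 h1).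
have wk : 0 <= w * `|k| by rewrite mulr_ge0 // ltW.
have wb : 0 <= w * (`|1 - d| * B) by rewrite mulr_ge0 ?(ltW w0) // mulr_ge0.
split; first by apply: lt_trans yw _; lra.
have -> : expR (2 * x t) - l = - yd t + (- (k * y t) + (1 - d) * y t ^+ 2) by rewrite /yd; ring.
apply: le_lt_trans (ler_normD _ _) _; rewrite normrN.
apply: (@le_lt_trans _ _ (w + (w * `|k| + w * (`|1 - d| * B)))).
  apply: lerD; first exact: ltW.
  apply: le_trans (ler_normD _ _) _; rewrite normrN (normrM k) (normrM (1 - d)); apply: lerD.
    by rewrite mulrC ler_wpM2r // ltW.
  by rewrite normrX expr2 mulrCA; apply: ler_pM; rewrite ?mulr_ge0 ?(ltW yw) // ler_wpM2l.
lra.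
Qed.
End PhasePlane.

(** * Forward orbits *)

Lemma dd_ndecr_oo (R : realType) (f f' : R -> R) (a b : R) : a <= b ->
  (forall x, a <= x -> x <= b -> dd x f (f' x)) ->
  (forall x, a < x -> x < b -> 0 <= f' x) -> f a <= f b.
Proof.
rewrite le_eqVlt => /predU1P[->//|ab] H P; have [c [ac cb E]] := MVTdd ab H.
have := P c ac cb; rewrite -(subr_ge0 (f a)) E => h; apply: mulr_ge0 => //; lra.
Qed.

Lemma first_zero (R : realType) (f : R -> R) (a b : R) : a <= b ->
  (forall x, a <= x -> x <= b -> {for x, continuous f}) -> 0 < f a -> f b <= 0 ->
  exists c, [/\ a < c, c <= b, f c = 0 & forall x, a <= x -> x < c -> 0 < f x].
Proof.
move=> ab C fa fb.
have ab' : a < b by rewrite lt_neqAle ab andbT; apply/eqP => E; move: fb; rewrite -E; lra.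
have [||||c [c1 c2 c3 c4]] := @sup_last _ (fun s => - f (- s)) (- b) (- a).
- by rewrite ltrN2.
- move=> x x1 x2; apply: (@continuousN _ _ _ (fun s => f (- s))).
  apply: (@continuous_comp _ _ _ (fun s => - s) f); first exact: opp_continuous.
  by apply: C; lra.
- by rewrite opprK oppr_ge0.
- by rewrite opprK oppr_lt0.
exists (- c); split; first lra.
- lra.
- by apply: oppr_inj; rewrite c3 oppr0.
- by move=> x ax xc; have := c4 (- x); rewrite opprK oppr_lt0; apply; lra.
Qed.

Section Dynamics.
Context {R : realType}.
Variables (NN d : R).
Hypotheses (NN2 : 2 <= NN) (d0 : 0 < d) (c0 : 0 < NN - 2 * d).
Let l : R := NN - 1 - d.
Let c : R := NN - 2 * d.
Local Notation xs := (xs NN d).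
Local Notation G := (G NN d).
Local Notation En := (En NN d).
Implicit Types (x y : R -> R) (t s u k e T B : R).

Let l0 : 0 < l. Proof. exact: l_gt0. Qed.
Let lexp : l = expR (2 * xs). Proof. by rewrite (expR_xs NN2 c0). Qed.
Let NN0 : 0 < NN. Proof. by move: NN2 => h; lra. Qed.

Lemma pohF_x x y t : 0 <= pohF NN d x y t -> x t <= ln (NN * (NN / d)) / 2.
Proof.
move=> /(pohF_bounds d0 NN0)[p0 pN qb].
have m0 : 0 < NN * (NN / d) by rewrite mulr_gt0 // divr_gt0.
rewrite ler_pdivlMr // -ler_expR lnK ?posrE // mulrC (le_trans qb) //.
have : NN * (1 - y t) <= NN * (NN / d) by rewrite ler_pM2l // ltW.
have : 0 <= d * (1 - y t) ^+ 2 by rewrite mulr_ge0 ?sqr_ge0 // ltW.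
lra.
Qed.

Lemma pohF_y x y t : 0 <= pohF NN d x y t -> `|y t| <= 1 + NN / d.
Proof.
move=> /(pohF_bounds d0 NN0)[p0 pN _]; have : 0 < NN / d by rewrite divr_gt0.
by rewrite ler_norml => ?; lra.
Qed.

(** The Pohozaev bound at p = 1; this is the ceiling on maxima of [x] under which [G_lower]
    operates. *)
Lemma pohF_turn x y t : 0 <= pohF NN d x y t -> y t = 0 -> expR (2 * x t) <= NN - d.
Proof. by move=> /(pohF_bounds d0 NN0)[_ _] + y0; rewrite y0 subr0 expr1n !mulr1. Qed.

Lemma orbit_bounds x y T m : (forall t, T <= t -> 0 <= pohF NN d x y t) ->
  (forall t, T <= t -> m <= x t) ->
  exists B, forall t, T <= t -> `|x t| <= B /\ `|y t| <= B.
Proof.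
move=> F M; pose b1 := ln (NN * (NN / d)) / 2; pose b2 := 1 + NN / d.
exists (`|b1| + `|m| + b2) => t Tt.
have := pohF_x (F t Tt); have := pohF_y (F t Tt); have := M t Tt; rewrite -/b1 -/b2.
have := ler_norm b1; have := ler_norm (- m); rewrite normrN.
have : 0 <= `|b1| by []. have : 0 <= `|m| by [].
have : 0 <= b2 by rewrite addr_ge0 // divr_ge0 // ltW.
by move=> *; rewrite ler_norml; split; lra.
Qed.

Lemma En_decr x y s t : s <= t ->
  (forall u, s <= u -> u <= t -> orbit c (1 - d) l x y u) -> En x y t <= En x y s.
Proof.
move=> st H; apply: (@dd_nincr _ (En x y) (fun u => - c * (y u ^+ 2 * expR (2 * (d - 1) * x u))) _ _ st).
  by move=> u su ut; exact: dEn (H u su ut).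
move=> u su ut; rewrite mulNr oppr_le0 mulr_ge0 ?(ltW c0) //.
by rewrite mulr_ge0 ?sqr_ge0 ?expR_ge0.
Qed.

Lemma En_turn x y t : y t = 0 -> En x y t = G (x t).
Proof. by move=> y0; rewrite /En y0 expr0n /= !mul0r add0r. Qed.

(** Only a lower bound for [x] is at stake. If [y] stays positive, [x] increases. Otherwise [y]
    vanishes at some [t1], after which G(x) stays below G(x t1): this bounds [x] by [G_lower] if
    [x t1] is above the equilibrium, and by [x t1] itself if it is below, where [G] decreases. *)
Lemma forward_bounded x y T : (forall t, T <= t -> orbit c (1 - d) l x y t) ->
  (forall t, T <= t -> 0 <= pohF NN d x y t) -> 0 <= y T ->
  exists B, forall t, T <= t -> `|x t| <= B /\ `|y t| <= B.
Proof.
move=> orb F yT.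
suff [m M] : exists m, forall t, T <= t -> m <= x t by exact: orbit_bounds F M.
case: (pselect (exists2 t0, T <= t0 & y t0 <= 0)) => [[t0 Tt0 yt0]|no]; last first.
  exists (x T) => t Tt; apply: (@dd_ndecr _ x y _ _ Tt) => u Tu _.
    by case: (orb u Tu).
  by rewrite leNgt; apply/negP => yu; apply: no; exists u => //; exact: ltW.
have [|||t1 [Tt1 t10 yt1]] := @IVTc _ (fun t => - y t) T t0 0 Tt0.
- by move=> u Tu _; have [_ /dN/dd_cont] := orb u Tu.
- by rewrite oppr_le0.
- by rewrite oppr_ge0.
move/eqP: yt1; rewrite oppr_eq0 => /eqP yt1.
have [M1 M10 HM1] := @cont_bounded _ x T t1 (fun u Tu _ => dd_cont (orb u Tu).1).
have [g Hg] := G_lower NN2 d0 c0.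
exists (Num.min (- M1) (Num.min g (x t1))) => t Tt; rewrite !ge_min.
case: (leP t t1) => [tt1|/ltW tt1].
  by have := HM1 t Tt tt1; rewrite ler_norml => /andP[-> _].
have EG : G (x t) <= G (x t1).
  apply: le_trans (En_ge NN d x y t) _; rewrite -(En_turn x yt1).
  by apply: En_decr => // u t1u _; apply: orb; lra.
case: (leP l (expR (2 * x t1))) => ql.
  by rewrite (Hg (x t1) (x t) ql (pohF_turn (F t1 Tt1) yt1) EG) orbT.
suff -> : x t1 <= x t by rewrite !orbT.
rewrite leNgt; apply/negP => xx; suff : G (x t1) < G (x t) by lra.
by apply: G_decr => //; move: ql; rewrite lexp ltr_expR; lra.
Qed.

(** The dissipation rate is at most 2 c times the excess energy, so the excess times e^(2 c t) is
    nondecreasing. The equilibrium is thus not reached in finite time, without an appeal to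
    uniqueness for the system. *)
Lemma En_gt x y s t : s <= t -> (forall u, s <= u -> orbit c (1 - d) l x y u) ->
  G xs < En x y s -> G xs < En x y t.
Proof.
move=> st H Es.
have D u : s <= u -> u <= t -> dd u (fun u => (En x y u - G xs) * expR (2 * c * u))
   ((- c * (y u ^+ 2 * expR (2 * (d - 1) * x u)) + 2 * c * (En x y u - G xs)) * expR (2 * c * u)).
  by move=> su _; have h := dEn d0 (H u su); dby; rewrite /=; ring.
have := @dd_ndecr _ _ _ s t st D.
have P u : s <= u -> u <= t ->
  0 <= (- c * (y u ^+ 2 * expR (2 * (d - 1) * x u)) + 2 * c * (En x y u - G xs)) * expR (2 * c * u).
  move=> _ _; rewrite mulr_ge0 ?expR_ge0 //.
  have -> : - c * (y u ^+ 2 * expR (2 * (d - 1) * x u)) + 2 * c * (En x y u - G xs) =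
     2 * c * (G (x u) - G xs) by rewrite /En; field.
  by rewrite mulr_ge0 ?subr_ge0 ?G_min_le // mulr_ge0 // ltW.
move=> /(_ P) h; rewrite -subr_gt0 -(pmulr_lgt0 _ (expR_gt0 (2 * c * t))).
by apply: lt_le_trans h; rewrite mulr_gt0 ?expR_gt0 // subr_gt0.
Qed.

Lemma xs_near u e : e <= l / 2 -> `|expR (2 * u) - l| < e -> `|u - xs| <= e / l.
Proof.
move=> el; have E : expR (2 * u) = l * expR (2 * (u - xs)).
  by rewrite lexp -expRD; congr expR; ring.
rewrite E; set w := u - xs; rewrite ltr_norml => /andP[h1 h2].
have w1 := expR_ge1Dx (2 * w); have w2 := expR_ge1Dx (- (2 * w)).
have e0 := expR_gt0 (2 * w).
have inv : expR (- (2 * w)) * expR (2 * w) = 1 by rewrite mulrC expRxMexpNx_1.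
rewrite ler_norml -mulNr ler_pdivlMr // ler_pdivrMr //.
set E2 := expR (2 * w) in h1 h2 w1 e0 inv *; set E3 := expR (- _) in w2 inv.
have lE : l * (1 + 2 * w) <= l * E2 by rewrite ler_pM2l.
have E2h : 1 / 2 <= E2 by rewrite -(ler_pM2l l0); lra.
have : (1 - 2 * w) * E2 <= 1 by rewrite -[leRHS]inv ler_wpM2r ?(ltW e0).
move=> h3; have h4 : - (2 * w) * E2 <= 1 - E2 by lra.
apply/andP; split; last lra.
case: (leP 0 w) => w0; first by have : 0 <= w * l by [rewrite mulr_ge0 // ltW]; lra.
have : - w <= 1 - E2 by nra.
move=> h5; have : - w * l <= (1 - E2) * l by rewrite ler_pM2r.
lra.
Qed.

(* Riccati: a solution avoiding the equilibrium value makes atan (y / (x - xs))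
   decrease at a fixed rate, the characteristic roots being complex. *)
Lemma orbit_oscillates x y T : c ^+ 2 < 8 * l ->
  (forall t, T <= t -> orbit c (1 - d) l x y t) ->
  (forall e, 0 < e -> exists2 S, T <= S &
    forall t, S <= t -> `|y t| < e /\ `|expR (2 * x t) - l| < e) ->
  exists2 t, T <= t & x t = xs.
Proof.
move=> cl orb cv; apply: contrapT => no.
have u0 t : T <= t -> x t - xs != 0.
  by move=> Tt; rewrite subr_eq0; apply/eqP => E; apply: no; exists t.
(* The value for which completing the square in [quad] leaves the remainder 4 eta^2: the
   characteristic polynomial v^2 + c v + 2 l then dominates 2 eta (1 + v^2). *)
pose eta := (8 * l - c ^+ 2) / (8 + 16 * l).
have den : 0 < 8 + 16 * l by rewrite addr_gt0 // mulr_gt0.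
have eta0 : 0 < eta by rewrite divr_gt0 // subr_gt0.
have etaE : eta * (8 + 16 * l) = 8 * l - c ^+ 2 by rewrite divfK // gt_eqF.
have eta1 : 0 < 1 - 2 * eta.
  rewrite -(pmulr_lgt0 _ den) mulrBl mul1r -mulrA etaE.
  by have := sqr_ge0 c; lra.
have quad v : 2 * eta * (1 + v ^+ 2) <= v ^+ 2 + c * v + 2 * l.
  rewrite -subr_ge0 -(pmulr_rge0 _ eta1).
  have -> : (1 - 2 * eta) * (v ^+ 2 + c * v + 2 * l - 2 * eta * (1 + v ^+ 2)) =
     (((1 - 2 * eta) * v + c / 2) ^+ 2) + (8 * l - c ^+ 2 - eta * (8 + 16 * l) + 16 * eta ^+ 2) / 4.
    by field.
  by rewrite etaE subrr add0r addr_ge0 ?sqr_ge0 // divr_ge0 // mulr_ge0 ?sqr_ge0.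
pose w := Num.min (l / 2) (eta / 8).
have w0 : 0 < w by rewrite lt_min; apply/andP; split; apply: divr_gt0.
have w1 : w <= l / 2 by rewrite ge_min lexx.
have w2 : w <= eta / 8 by rewrite ge_min lexx orbT.
(* [w] keeps (e^(2 u) - 1) / u close to its limit 2; the second term makes (1 - d) y v a small part
   of eta (1 + v^2). Together they use up half of the rate 2 eta at most. *)
pose w' := Num.min w (eta / (2 * (`|1 - d| + 1))).
have b1 : 0 < `|1 - d| + 1 by rewrite ltr_wpDl.
have w'0 : 0 < w' by rewrite lt_min w0 divr_gt0 // mulr_gt0.
have [S TS HS] := cv w' w'0.
pose v t := y t / (x t - xs).
pose dv t := (l - c * y t + (1 - d) * y t ^+ 2 - expR (2 * x t)) / (x t - xs) - v t ^+ 2.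
have Dv t : T <= t -> dd t v (dv t).
  move=> Tt; have [dx dy] := orb t Tt; have h := u0 t Tt; rewrite /v; dby; first exact: h.
  by rewrite /= /dv /v; field.
have rate t : S <= t -> dv t <= - (eta * (1 + v t ^+ 2)).
  move=> St; have Tt : T <= t by lra.
  have [yw qw] := HS t St; have h := u0 t Tt.
  have xw : `|x t - xs| <= w / l.
    by apply: xs_near => //; apply: lt_le_trans qw _; rewrite ge_min lexx.
  set u := x t - xs in h xw *.
  have E : expR (2 * x t) = l * expR (2 * u) by rewrite lexp -expRD; congr expR; rewrite /u; ring.
  have -> : dv t = - (v t ^+ 2 + c * v t + l * ((expR (2 * u) - 1) / u)) + (1 - d) * y t * v t.
    by rewrite /dv E /v -/u; field.
  have Q : 2 * l - 4 * w <= l * ((expR (2 * u) - 1) / u).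
    case: (ltrP 0 u) => u_s.
      have : 2 <= (expR (2 * u) - 1) / u.
        by rewrite ler_pdivlMr //; have := expR_ge1Dx (2 * u); lra.
      by rewrite -(ler_pM2l l0); lra.
    have {}u_s : u < 0 by rewrite lt_neqAle h.
    have uw : - u * l <= w by rewrite -ler_pdivlMr // (le_trans _ xw) // -normrN ler_norm.
    have e1 := expR_gt0 (- (2 * u)); have e2 := expR_ge1Dx (- (2 * u)).
    have e3 : expR (2 * u) * expR (- (2 * u)) = 1 by rewrite expRxMexpNx_1.
    have e4 : expR (2 * u) - 1 <= 2 * u + 4 * u ^+ 2.
      have : expR (2 * u) * (1 - 2 * u) <= 1 by rewrite -[leRHS]e3 ler_wpM2l ?expR_ge0.
      have : 0 <= u ^+ 2 * (- u) by rewrite mulr_ge0 ?sqr_ge0 // oppr_ge0 ltW.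
      move=> h1 h2; have u1 : 0 < 1 - 2 * u by lra.
      rewrite -(ler_pM2r u1); rewrite !expr2 in h1 *; lra.
    have e5 : 2 + 4 * u <= (expR (2 * u) - 1) / u.
      by rewrite ler_ndivlMr //; rewrite expr2 in e4; lra.
    by move: e5; rewrite -(ler_pM2l l0); lra.
  have V : (1 - d) * y t * v t <= eta / 4 * (1 + v t ^+ 2).
    apply: le_trans (ler_norm _) _; rewrite (normrM _ (v t)) (normrM _ (y t)).
    have yw' : `|1 - d| * `|y t| <= eta / 2.
      have : `|y t| <= eta / (2 * (`|1 - d| + 1)).
        by rewrite (le_trans (ltW yw)) // ge_min lexx orbT.
      rewrite ler_pdivlMr ?mulr_gt0 //; have : 0 <= `|y t| by [].
      lra.
    have vv : `|v t| <= (1 + v t ^+ 2) / 2.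
      by have := sqr_ge0 (`|v t| - 1); rewrite sqrrB1 real_normK ?num_real //; lra.
    have -> : eta / 4 * (1 + v t ^+ 2) = eta / 2 * ((1 + v t ^+ 2) / 2) by field.
    by apply: ler_pM => //; rewrite mulr_ge0.
  have := quad (v t); have : 0 <= eta * v t ^+ 2 by rewrite mulr_ge0 ?sqr_ge0 // ltW.
  lra.
(* In this time the arctangent would drop by pi, the full length of its open range. *)
pose h := pi / eta.
have h0 : 0 < h by rewrite divr_gt0 // pi_gt0.
have A t : S <= t -> dd t (fun t => atan (v t) + eta * t)
   ((1 + v t ^+ 2)^-1 * dv t + eta).
  move=> St; have dva := dcomp (is_derive1_atan (v t)) (Dv t (le_trans TS St)).
  by dby; rewrite /=; ring.
have := @dd_nincr _ _ _ S (S + h) _ (fun t St _ => A t St).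
have le1 : S <= S + h by lra.
have neg t : S <= t -> t <= S + h -> (1 + v t ^+ 2)^-1 * dv t + eta <= 0.
  move=> St _; have v2 : 0 < 1 + v t ^+ 2 by rewrite ltr_wpDr ?sqr_ge0.
  have := rate t St; rewrite -(ler_pM2l (_ : 0 < (1 + v t ^+ 2)^-1)) ?invr_gt0 //.
  by rewrite mulrN mulrCA mulVf ?gt_eqF // mulr1; lra.
move=> /(_ le1 neg); have := atan_gtNpi2 (v (S + h)); have := atan_ltpi2 (v S).
have : eta * h = pi by rewrite /h mulrC divfK // gt_eqF.
lra.
Qed.

(** The region 0 <= y <= k (l - e^(2 x)) is invariant. On its upper edge the sign is that of 1 - c k
    + 2 l k^2, and k = c / (4 l) minimises this quadratic, with minimum (8 l - c^2) / (8 l) <= 0. *)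
Lemma orbit_monotone x y T : 8 * l <= c ^+ 2 ->
  (forall t, T <= t -> orbit c (1 - d) l x y t) ->
  expR (2 * x T) < l -> 0 <= y T -> y T <= c / (4 * l) * (l - expR (2 * x T)) ->
  forall t, T <= t -> expR (2 * x t) < l /\ (T < t -> 0 < y t).
Proof.
move=> cl orb qT yT DT.
pose k := c / (4 * l).
have k0 : 0 < k by rewrite divr_gt0 // mulr_gt0.
have kE : 1 - c * k + 2 * l * k ^+ 2 <= 0.
  have -> : 1 - c * k + 2 * l * k ^+ 2 = (8 * l - c ^+ 2) / (8 * l).
    by rewrite /k; field; rewrite gt_eqF.
  by rewrite pmulr_lle0 ?invr_gt0 ?mulr_gt0 // subr_le0.
pose th t := l - expR (2 * x t).
have dth t : T <= t -> dd t th (- (2 * expR (2 * x t) * y t)).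
  by move=> /orb[dx dy]; rewrite /th; dby; rewrite /=; ring.
pose D t := k * th t - y t.
pose dD t := - (k * (2 * expR (2 * x t) * y t)) -
   (l - c * y t + (1 - d) * y t ^+ 2 - expR (2 * x t)).
have DD t : T <= t -> dd t D (dD t).
  move=> Tt; have h1 := dth t Tt; have [_ h2] := orb t Tt.
  by rewrite /D; dby; rewrite /= /dD; ring.
have Dpos t : 0 < th t -> D t = 0 -> 0 < dD t.
  move=> th0 D0; have yE : y t = k * th t by rewrite /D in D0; lra.
  have -> : dD t = th t * (- (1 - c * k + 2 * l * k ^+ 2) + (1 + d) * k ^+ 2 * th t).
    by rewrite /dD yE /th; ring.
  rewrite mulr_gt0 // ltr_wpDl ?oppr_ge0 //.
  by rewrite mulr_gt0 // mulr_gt0 ?exprn_gt0 // addr_gt0.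
have thpos t : T <= t -> 0 < th t.
  move=> Tt; rewrite ltNge; apply/negP => tht.
  have thT : 0 < th T by rewrite subr_gt0.
  have [|b [Tb bt thb bef]] := first_zero Tt _ thT tht.
    by move=> u Tu _; exact: dd_cont (dth u Tu).
  have DT0 : 0 <= D T by rewrite subr_ge0.
  have D0 := @barrier _ D dD T b (fun u Tu _ => DD u Tu) (fun u Tu ub => Dpos u (bef u Tu ub)) DT0.
  (* Inside the region [th] decays at most at the exponential rate 2 l k, so it cannot vanish at
     [b]. *)
  have dthe u : T <= u -> u <= b -> dd u (fun u => th u * expR (2 * l * k * u))
     ((2 * l * k * th u - 2 * expR (2 * x u) * y u) * expR (2 * l * k * u)).
    by move=> Tu _; have := dth u Tu => h; dby; rewrite /=; ring.
  have := dd_ndecr_oo (ltW Tb) dthe.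
  have P u : T < u -> u < b ->
     0 <= (2 * l * k * th u - 2 * expR (2 * x u) * y u) * expR (2 * l * k * u).
    move=> Tu ub; rewrite mulr_ge0 ?expR_ge0 //.
    have := D0 u (ltW Tu) ub; have := bef u (ltW Tu) ub; rewrite /D => th0 Du.
    have q0 := expR_gt0 (2 * x u); have ql : expR (2 * x u) <= l by rewrite /th in th0; lra.
    have h1 : expR (2 * x u) * y u <= expR (2 * x u) * (k * th u).
      by rewrite ler_pM2l //; lra.
    have h2 : expR (2 * x u) * (k * th u) <= l * (k * th u).
      by rewrite ler_pM2r // mulr_gt0.
    by lra.
  move=> /(_ P); rewrite thb mul0r => h.
  by have := mulr_gt0 thT (expR_gt0 (2 * l * k * T)); lra.
have dy t : T <= t -> y t = 0 -> 0 < l - c * y t + (1 - d) * y t ^+ 2 - expR (2 * x t).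
  by move=> Tt ->; rewrite mulr0 expr0n /= mulr0 subr0 addr0; exact: thpos.
move=> t Tt; split; first by have := thpos t Tt; rewrite subr_gt0.
move=> Tt'.
have yge u : T <= u -> u < t + 1 -> 0 <= y u.
  by apply: (@barrier _ y _ T (t + 1) (fun u Tu _ => (orb u Tu).2)) => // v Tv _; exact: dy.
have yt : 0 <= y t by apply: yge => //; lra.
(* At a zero of [y] its derivative is [th], which is positive, so [y] would be negative just
   before. *)
rewrite lt_neqAle yt andbT eq_sym; apply/eqP => y0.
have [e e0 He] := dd_pos_left (orb t Tt).2 (dy t Tt y0).
pose s := Num.max T (t - e / 2).
have s1 : T <= s by rewrite le_max lexx.
have s2 : t - e / 2 <= s by rewrite le_max lexx orbT.
have s3 : s < t by rewrite gt_max Tt' /=; lra.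
by have := He s ltac:(lra) s3; have := yge s s1 ltac:(lra); lra.
Qed.

End Dynamics.

(** * Backward orbits *)

Section Backward.
Context {R : realType}.
Variables (NN d : R).
Hypotheses (NN2 : 2 <= NN) (d0 : 0 < d) (c0 : 0 < NN - 2 * d).
Let l : R := NN - 1 - d.
Let c : R := NN - 2 * d.
Local Notation xs := (xs NN d).
Local Notation G := (G NN d).
Local Notation En := (En NN d).
Implicit Types (x y : R -> R) (t s u k e T B : R).

Let l0 : 0 < l. Proof. exact: l_gt0. Qed.
Let lexp : l = expR (2 * xs). Proof. by rewrite (expR_xs NN2 c0). Qed.
Let NN0 : 0 < NN. Proof. by move: NN2 => h; lra. Qed.

Section Orbit.
Variables (x y : R -> R) (T : R).
(** Time is reversed: t -> +oo is the approach to the origin, [- y] is the original velocity, and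
    [coll] says that [V] tends to 0 there. *)
Hypotheses (orb : forall t, T <= t -> orbit (- c) (1 - d) l x y t)
  (F : forall t, T <= t -> 0 <= pohF NN d x (fun t => - y t) t)
  (coll : forall A, exists2 S, T <= S & forall t, S <= t -> A <= t + x t).

Let dx t : T <= t -> dd t x (y t). Proof. by move=> /orb[]. Qed.
Let dyE t : l - - c * y t + (1 - d) * y t ^+ 2 - expR (2 * x t) =
  (NN - 2) * (1 + y t) + (1 - d) * (1 + y t) ^+ 2 - expR (2 * x t).
Proof. by rewrite /l /c; ring. Qed.
Let dy t : T <= t -> dd t y ((NN - 2) * (1 + y t) + (1 - d) * (1 + y t) ^+ 2 - expR (2 * x t)).
Proof. by move=> /orb[_]; rewrite dyE. Qed.
Let p0 t : T <= t -> 0 < 1 + y t.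
Proof. by move=> /F/(pohF_bounds d0 NN0)[]; rewrite opprK. Qed.

Lemma En_incr s t : T <= s -> s <= t -> En x y s <= En x y t.
Proof.
move=> Ts st; apply: (@dd_ndecr _ (En x y)
   (fun u => - - c * (y u ^+ 2 * expR (2 * (d - 1) * x u))) _ _ st) => u su _.
  by apply: (dEn d0); apply: orb; lra.
by rewrite opprK mulr_ge0 ?(ltW c0) // mulr_ge0 ?sqr_ge0 ?expR_ge0.
Qed.

Lemma below_from_late S m : T <= S -> (forall t, S <= t -> m <= x t) ->
  exists m, forall t, T <= t -> m <= x t.
Proof.
move=> TS H; have [M1 _ HM] := @cont_bounded _ x T S (fun u Tu _ => dd_cont (dx Tu)).
exists (Num.min (- M1) m) => t Tt; rewrite ge_min; case: (leP t S) => tS.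
  by have := HM t Tt tS; rewrite ler_norml => /andP[-> _].
by rewrite (H t (ltW tS)) orbT.
Qed.

(** If l p^2 exceeded e^(2 x) once, with p = 1 + y, it would stay above; [y] would then increase at
    a rate bounded below and become positive. Hence p is at most a multiple of e^x, which makes t +
    x bounded above, against [coll]. *)
Lemma no_escape S : T <= S -> (forall t, S <= t -> y t < 0) ->
  ~ (forall e, 0 < e -> exists2 t, S <= t & expR (2 * x t) < e).
Proof.
move=> TS yneg small.
have xdec s t : S <= s -> s <= t -> expR (2 * x t) <= expR (2 * x s).
  move=> Ss st; rewrite ler_expR ler_pM2l //.
  apply: (@dd_nincr _ x y _ _ st) => u su _; first by apply: dx; lra.
  by apply/ltW/yneg; lra.
have ev e : 0 < e -> exists2 t0, S <= t0 & forall t, t0 <= t -> expR (2 * x t) < e.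
  move=> /small[t0 St0 h]; exists t0 => // t t0t.
  by apply: le_lt_trans h; exact: xdec.
pose phi t := l * (1 + y t) ^+ 2 - expR (2 * x t).
pose yd t := (NN - 2) * (1 + y t) + (1 - d) * (1 + y t) ^+ 2 - expR (2 * x t).
have dphi t : S <= t -> dd t phi (2 * l * (1 + y t) * yd t - 2 * expR (2 * x t) * y t).
  move=> St; have h1 := dx (le_trans TS St); have h2 := dy (le_trans TS St).
  by rewrite /phi; dby; rewrite /= /yd; ring.
have ydphi t : S <= t -> phi t <= yd t.
  move=> St; have := yneg t St; have := p0 (le_trans TS St); rewrite /phi /yd /l => h1 h2.
  rewrite -subr_ge0.
  have -> : (NN - 2) * (1 + y t) + (1 - d) * (1 + y t) ^+ 2 - expR (2 * x t) -
    ((NN - 1 - d) * (1 + y t) ^+ 2 - expR (2 * x t)) = (NN - 2) * ((1 + y t) * - y t) by ring.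
  by rewrite mulr_ge0 ?subr_ge0 // mulr_ge0 ?(ltW h1) // oppr_ge0 ltW.
have sub t : S <= t -> l * (1 + y t) ^+ 2 <= expR (2 * x t).
  move=> St; rewrite leNgt; apply/negP => pos.
  have phi0 : 0 <= phi t by rewrite subr_ge0 ltW.
  pose phid v := 2 * l * (1 + y v) * yd v - 2 * expR (2 * x v) * y v.
  have ph u : t <= u -> 0 <= phi u.
    move=> tu; have Hd v : t <= v -> v < u + 1 -> dd v phi (phid v).
      by move=> tv _; apply: dphi; lra.
    have Hz v : t <= v -> v < u + 1 -> phi v = 0 -> 0 < phid v.
      move=> tv _ E; have Sv : S <= v by lra.
      have := ydphi v Sv; rewrite E => h; have := yneg v Sv => yv.
      have := p0 (le_trans TS Sv) => pv.
      have t1 : 0 <= 2 * l * (1 + y v) * yd v.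
        by rewrite mulr_ge0 // mulr_ge0 ?(ltW pv) // mulr_ge0 // ltW.
      have t2 : 0 < expR (2 * x v) * - y v by rewrite mulr_gt0 ?expR_gt0 // oppr_gt0.
      by rewrite /phid; lra.
    by apply: (barrier Hd Hz phi0 tu); lra.
  have pinc u : t <= u -> y t <= y u.
    move=> tu; apply: (@dd_ndecr _ y yd _ _ tu) => v tv _; first by apply: dy; lra.
    by apply: le_trans (ph v tv) _; apply: ydphi; lra.
  pose kap := l * (1 + y t) ^+ 2 / 2.
  have pt := p0 (le_trans TS St).
  have kap0 : 0 < kap by rewrite divr_gt0 // mulr_gt0 // exprn_gt0.
  have [t0 St0 Ht0] := ev kap kap0.
  pose t1 := Num.max t t0.
  have tt1 : t <= t1 by rewrite le_max lexx.
  have t01 : t0 <= t1 by rewrite le_max lexx orbT.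
  have rate u : t1 <= u -> kap <= yd u.
    move=> t1u; have tu : t <= u by lra.
    apply: le_trans (ydphi u _); last lra.
    have : l * (1 + y t) ^+ 2 <= l * (1 + y u) ^+ 2.
      by rewrite ler_pM2l // lerXn2r // ?nnegrE ?lerD2l ?pinc // ltW // p0 //; lra.
    by have := Ht0 u ltac:(lra); rewrite /phi /kap; lra.
  (* [y] lies between -1 and 0, and over the time 1 / kap it would increase by at least 1. *)
  have h := @dd_ndecr _ (fun u => y u - kap * u) (fun u => yd u - kap) t1 (t1 + kap^-1).
  have : y t1 - kap * t1 <= y (t1 + kap^-1) - kap * (t1 + kap^-1).
    apply: h => [|u t1u _|u t1u _].
    - by rewrite lerDl invr_ge0 ltW.
    - have hy : dd u y (yd u) by apply: dy; lra.
      by dby; rewrite /=; ring.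
    - by rewrite subr_ge0 rate.
  have e1 : S <= t1 + kap^-1 by have : 0 < kap^-1 by [rewrite invr_gt0]; lra.
  have := yneg _ e1; have := p0 (_ : T <= t1) => /(_ ltac:(lra)).
  by rewrite mulrDr divff ?gt_eqF //; lra.
have [t0 St0 Ht0] := ev (l / 4) ltac:(by rewrite divr_gt0).
pose sl := Num.sqrt l; have sl0 : 0 < sl by rewrite sqrtr_gt0.
have sl2 : sl ^+ 2 = l by rewrite sqr_sqrtr // ltW.
have px t : S <= t -> sl * (1 + y t) <= expR (x t).
  move=> St; have := sub t St; rewrite -sl2 -exprMn expRM_natl ler_pXn2r //.
    by rewrite nnegrE mulr_ge0 // ltW // p0 //; lra.
  by rewrite nnegrE expR_ge0.
have phalf t : t0 <= t -> y t <= - (1 / 2).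
  move=> t0t; have St : S <= t by lra.
  have := sub t St; have := Ht0 t t0t => h1 h2.
  have : l * (1 + y t) ^+ 2 < l * (1 / 2) ^+ 2 by rewrite expr2; lra.
  rewrite ltr_pM2l // ltr_pXn2r ?nnegrE //; first lra.
  by rewrite ltW // p0 //; lra.
(* The derivative of t + x is p <= e^x / sl, and since y <= - 1 / 2 the derivative of the last term
   is at most - e^x / sl. *)
pose H t := t + x t + 2 / sl * expR (x t).
have Hdec t : t0 <= t -> H t <= H t0.
  move=> t0t; apply: (@dd_nincr _ H (fun t => 1 + y t + 2 / sl * (expR (x t) * y t)) _ _ t0t).
    move=> u t0u _; have hx : dd u x (y u) by apply: dx; lra.
    by rewrite /H; dby; rewrite /=; ring.
  move=> u t0u _; have := phalf u t0u; have := px u ltac:(lra); have := expR_gt0 (x u).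
  set E := expR (x u) => E0 h1 h2.
  rewrite -(pmulr_rle0 _ sl0).
  have -> : sl * (1 + y u + 2 / sl * (E * y u)) = sl * (1 + y u) + 2 * (E * y u).
    by field; rewrite gt_eqF.
  have : E * y u <= E * - (1 / 2) by rewrite ler_pM2l.
  lra.
have [S1 TS1 HS1] := coll (H t0 + 1).
have := HS1 (Num.max S1 t0); have := Hdec (Num.max S1 t0).
rewrite !le_max !lexx orbT => /(_ isT) h1 /(_ isT) h2.
have : 0 <= 2 / sl * expR (x (Num.max S1 t0)) by rewrite mulr_ge0 ?expR_ge0 // divr_ge0 // ltW.
by move: h1; rewrite {1}/H; lra.
Qed.

(** Turning points above the equilibrium at arbitrarily late times bound every earlier energy by a
    level to which [G_lower] applies. Otherwise, from some time on, y' > 0 at each zero of [y]: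
    either [y] becomes nonnegative, remains so and [x] increases, or [y] stays negative and
    [no_escape] applies. *)
Lemma backward_below : exists m, forall t, T <= t -> m <= x t.
Proof.
have [C|/existsNP[S /not_implyP[TS nC]]] := pselect (forall S, T <= S -> exists2 t, S <= t &
    y t = 0 /\ l <= expR (2 * x t)).
  have [g Hg] := G_lower NN2 d0 c0; exists g => t Tt.
  have [t1 tt1 [yt1 qt1]] := C t Tt.
  have Tt1 : T <= t1 by lra.
  apply: (Hg (x t1) (x t) qt1).
    by apply: (pohF_turn NN2 d0 (F Tt1)); rewrite yt1 oppr0.
  apply: le_trans (En_ge NN d x y t) _; rewrite -(En_turn NN d x yt1).
  exact: En_incr.
have qs t : S <= t -> y t = 0 -> expR (2 * x t) < l.
  by move=> St yt; rewrite ltNge; apply/negP => h; apply: nC; exists t.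
have [[t1 St1 yt1]|no] := pselect (exists2 t, S <= t & 0 <= y t).
  pose yd v := (NN - 2) * (1 + y v) + (1 - d) * (1 + y v) ^+ 2 - expR (2 * x v).
  have yge t : t1 <= t -> 0 <= y t.
    move=> t1t; have Hd v : t1 <= v -> v < t + 1 -> dd v y (yd v).
      by move=> tv _; apply: dy; lra.
    have Hz v : t1 <= v -> v < t + 1 -> y v = 0 -> 0 < yd v.
      by move=> tv _ yv; have := qs v ltac:(lra) yv; rewrite /yd yv /l; lra.
    by apply: (barrier Hd Hz yt1 t1t); lra.
  apply: (@below_from_late t1 (x t1)) => [|t t1t]; first lra.
  apply: (@dd_ndecr _ x y _ _ t1t) => u su _; first by apply: dx; lra.
  exact: yge.
have yneg t : S <= t -> y t < 0.
  by move=> St; rewrite ltNge; apply/negP => h; apply: no; exists t.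
have /existsNP[e /not_implyP[e0 He]] := no_escape TS yneg.
apply: (@below_from_late S (ln e / 2)) => // t St.
rewrite ler_pdivrMr // -ler_expR lnK ?posrE // leNgt; apply/negP => h.
by apply: He; exists t => //; rewrite mulrC.
Qed.

(** In reversed time the energy increases, while convergence to the equilibrium brings it down to
    its minimum; so there is no excess energy at any time. *)
Lemma backward_constant t : T <= t -> x t = xs.
Proof.
move=> Tt; have [m M] := backward_below.
have [B HB] := orbit_bounds NN2 d0 F M.
have HB' s : T <= s -> `|x s| <= B /\ `|y s| <= B by move=> /HB; rewrite normrN.
have nc : - c != 0 by rewrite oppr_eq0 gt_eqF.
have cv := orbit_bounded_cvg d0 nc orb HB'.
apply: contrapT => /eqP/(G_min NN2 d0 c0) Gx.
have Et : G xs < En x y t by apply: lt_le_trans (En_ge NN d x y t).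
pose gap := En x y t - G xs; have gap0 : 0 < gap by rewrite subr_gt0.
have gap2 : 0 < gap / 2 by rewrite divr_gt0.
have [r r0 Hr] := (cont_eps G xs).1 (@G_cont _ _ _ d0 xs) _ gap2.
pose A1 := expR (2 * `|d - 1| * B).
have A10 : 0 < A1 by exact: expR_gt0.
(* At this distance from the equilibrium the kinetic part is at most, and the potential excess less
   than, half of the gap. *)
pose e := Num.min (Num.min (l / 2) (l * r / 2)) (Num.min 1 (gap / A1)).
have e0 : 0 < e by rewrite !lt_min ltr01 !divr_gt0 // mulr_gt0.
have e1 : e <= l / 2 by rewrite !ge_min lexx.
have e2 : e <= l * r / 2 by rewrite !ge_min lexx orbT.
have e3 : e <= 1 by rewrite !ge_min lexx !orbT.
have e4 : e <= gap / A1 by rewrite !ge_min lexx !orbT.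
have [S TS HS] := cv e e0; pose s := Num.max S t.
have Ss : S <= s by rewrite le_max lexx.
have ts : t <= s by rewrite le_max lexx orbT.
have [ys qs] := HS s Ss; have [xB _] := HB' s (le_trans TS Ss).
have := En_incr Tt ts; rewrite leNgt => /negP; apply.
have xr : `|x s - xs| < r.
  apply: le_lt_trans (xs_near NN2 c0 e1 qs) _.
  rewrite -/l ltr_pdivrMr //; have lr : 0 < l * r by rewrite mulr_gt0.
  lra.
have := Hr (x s) xr; rewrite ltr_norml => /andP[_ Gs].
have E1 : expR (2 * (d - 1) * x s) <= A1.
  rewrite ler_expR; have : `|(d - 1) * x s| <= `|d - 1| * B by rewrite normrM ler_wpM2l.
  by rewrite ler_norml => /andP[_]; lra.
have y2 : y s ^+ 2 <= e.
  rewrite -real_normK ?num_real //; apply: (@le_trans _ _ (e ^+ 2)).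
    by rewrite lerXn2r // ?nnegrE // ltW.
  by rewrite expr2 ler_piMr // ltW.
have : y s ^+ 2 * expR (2 * (d - 1) * x s) <= gap.
  apply: (@le_trans _ _ (e * A1)); last by rewrite -ler_pdivlMr.
  by apply: ler_pM; rewrite ?sqr_ge0 ?expR_ge0.
have -> : En x y s = y s ^+ 2 * expR (2 * (d - 1) * x s) / 2 + G (x s) by [].
have : gap + G xs = En x y t by rewrite /gap subrK.
lra.
Qed.

End Orbit.
End Backward.

(** * Uniqueness for the singular problem *)

Section Uniqueness.
Context {R : realType}.
Variables (n : nat) (d : R).
Hypotheses (n0 : (0 < n)%N) (d0 : 0 < d).
Let b : R := 1 - d.
Let NN : R := n.+1%:R.
Implicit Types (L : R -> R) (s X e r : R).

(** A genuine right limit 0, in contrast to [vanishes0]. *)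
Definition tends0 (h : R -> R) := forall e : R, 0 < e -> exists2 r : R, 0 < r &
  forall s, 0 < s -> s < r -> `|h s| <= e.

Lemma tends0_vanishes (h : R -> R) : tends0 h -> vanishes0 h.
Proof.
move=> H e r e0 r0; have [q q0 Hq] := H e e0.
have m0 : 0 < Num.min q r by rewrite lt_min q0.
have mq : Num.min q r <= q by rewrite ge_min lexx.
have mr : Num.min q r <= r by rewrite ge_min lexx orbT.
by exists (Num.min q r / 2); split; [lra|lra|apply: Hq; lra].
Qed.

Lemma tends0_Phi L : tends0 L -> tends0 (fun s => Phi b (L s)).
Proof.
move=> H e e0; have /cont_eps/(_ _ e0)[q q0 Hq] := dd_cont (dPhi b 0).
have [r r0 Hr] := H (q / 2) ltac:(by rewrite divr_gt0).
exists r => // s s0 sr; have h := Hr s s0 sr.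
by have := Hq (L s); rewrite Phi0 !subr0 => /(_ _)/ltW; apply; lra.
Qed.

(** The differentiated quantity is s^n Y' for Y = Phi(L), whose equation contains no gradient
    term. *)
Lemma weighted_flux (L L' : R -> R) s : 0 < s -> lsol NN d 1 L L' s ->
  dd s (fun s => s ^+ n * (expR (b * L s) * L' s)) (s ^+ n * expR (- ((1 + d) * L s))).
Proof.
move=> s0 [dL dL']; have nN : n%:R = NN - 1 :> R by rewrite /NN -natr1 addrK.
have sn1 : s ^+ n.-1 != 0 by rewrite expf_neq0 // gt_eqF.
have -> : expR (- ((1 + d) * L s)) = expR (b * L s) * expR (- (2 * L s)).
  by rewrite -expRD; congr expR; rewrite /b; ring.
dby; rewrite /= -nN -(prednK n0) /= exprS /b; field.
by rewrite gt_eqF.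
Qed.

(** The contraction behind [picard], applied to the difference of two solutions: any weighted bound
    on it can be halved, so iterating makes it 0. *)
Lemma lsol_unique (L1 L1' L2 L2' : R -> R) X :
  (forall s, 0 < s -> s < X -> lsol NN d 1 L1 L1' s /\ 0 <= L1 s) ->
  (forall s, 0 < s -> s < X -> lsol NN d 1 L2 L2' s /\ 0 <= L2 s) ->
  tends0 L1 -> tends0 L2 ->
  vanishes0 (fun s => s ^+ n * (expR (b * L1 s) * L1' s) - s ^+ n * (expR (b * L2 s) * L2' s)) ->
  forall s, 0 < s -> s < X -> L1 s = L2 s.
Proof.
move=> S1 S2 T1 T2 VP s s0 sX.
have [f [fPhi f01 flip]] := nonlinearity d0.
pose k := 1 + d; have k0 : 0 < k by rewrite addr_gt0.
pose K := Num.sqrt (2 * k).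
have K0 : 0 < K by rewrite sqrtr_gt0 mulr_gt0.
have K2 : K ^+ 2 = 2 * k by rewrite sqr_sqrtr // mulr_ge0 // ltW.
pose Z s := Phi b (L1 s) - Phi b (L2 s).
pose Z' s := expR (b * L1 s) * L1' s - expR (b * L2 s) * L2' s.
pose P s := s ^+ n * (expR (b * L1 s) * L1' s) - s ^+ n * (expR (b * L2 s) * L2' s).
pose g s := f (Phi b (L1 s)) - f (Phi b (L2 s)).
(* Stopping short of [X] makes the difference bounded by compactness, which starts the halving. *)
pose Y := (s + X) / 2; have sY : s < Y by rewrite /Y; lra.
have YX : Y < X by rewrite /Y; lra.
have dP r : 0 < r -> r < X -> dd r P (r ^+ n * g r).
  move=> r0 rX; have [s1 l1] := S1 r r0 rX; have [s2 l2] := S2 r r0 rX.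
  rewrite /g fPhi // fPhi // mulrBr.
  by have h1 := weighted_flux r0 s1; have h2 := weighted_flux r0 s2; exact: dD h1 (dN h2).
have dZ r : 0 < r -> r < X -> dd r Z (Z' r).
  move=> r0 rX; have [[h1 _] _] := S1 r r0 rX; have [[h2 _] _] := S2 r r0 rX.
  exact: dD (dcomp (dPhi b _) h1) (dN (dcomp (dPhi b _) h2)).
have Zt : tends0 Z.
  move=> e e0; have e2 : 0 < e / 2 by rewrite divr_gt0.
  have [r1 r10 H1] := tends0_Phi T1 e2; have [r2 r20 H2] := tends0_Phi T2 e2.
  exists (Num.min r1 r2) => [|r r0]; first by rewrite lt_min r10.
  rewrite lt_min => /andP[h1 h2]; rewrite /Z (le_trans (ler_normB _ _)) //.
  by have := H1 r r0 h1; have := H2 r r0 h2; lra.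
have ZP r : 0 < r -> r < Y -> r ^+ n * Z' r = P r by move=> _ _; rewrite /Z' /P mulrBr.
have contract A : 0 <= A -> (forall r, 0 < r -> r < Y -> `|Z r| <= A * expR (K * r)) ->
    forall r, 0 < r -> r < Y -> `|Z r| <= A / 2 * expR (K * r).
  move=> A0 H r r0 rY.
  have -> : A / 2 = (k * A) / K ^+ 2 by rewrite K2; field; rewrite gt_eqF.
  have kA : 0 <= k * A by rewrite mulr_ge0 // ltW.
  have dP' v : 0 < v -> v < Y -> dd v P (v ^+ n * g v) by move=> ? ?; apply: dP; lra.
  have dZ' v : 0 < v -> v < Y -> dd v Z (Z' v) by move=> ? ?; apply: dZ; lra.
  have gb v : 0 < v -> v < Y -> `|g v| <= k * A * expR (K * v).
    move=> v0 vY; apply: le_trans (flip _ _) _; rewrite -mulrA ler_wpM2l ?(ltW k0) //.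
    exact: H.
  exact: (weighted_bound K0 kA dP' dZ' ZP gb VP (tends0_vanishes Zt)).
have [A A0 HA] : exists2 A, 0 <= A & forall r, 0 < r -> r < Y -> `|Z r| <= A * expR (K * r).
  have [r1 r10 H1] := Zt 1 ltr01.
  have [M M0 HM] : exists2 M, 0 < M & forall r, r1 / 2 <= r -> r <= Y -> `|Z r| <= M.
    by apply: cont_bounded => r h1 h2; apply: dd_cont (dZ r _ _); lra.
  exists (1 + M) => [|r r0 rY]; first by rewrite addr_ge0 // ltW.
  have e1 : 1 <= expR (K * r) by rewrite -expR0 ler_expR mulr_ge0 // ltW.
  have : `|Z r| <= 1 + M.
    case: (leP (r1 / 2) r) => rr; first by have := HM r rr (ltW rY); lra.
    by have := H1 r r0 ltac:(lra); lra.
  have M1 : 0 <= 1 + M by rewrite addr_ge0 // ltW.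
  by move=> h; apply: le_trans h _; rewrite ler_peMr.
have geo j : forall r, 0 < r -> r < Y -> `|Z r| <= A / 2 ^+ j * expR (K * r).
  elim: j => [|j IH]; first by rewrite expr0 divr1.
  rewrite exprS invfM mulrCA mulrC; apply: contract => //.
  by rewrite divr_ge0 // exprn_ge0.
have Zs : Z s = 0.
  apply/eqP; rewrite -normr_le0; apply: (@le_geom _ _ _ (A * expR (K * s))) => j.
  by rewrite add0r mulrAC; exact: geo.
by rewrite -(PhiK b (L1 s)) -(PhiK b (L2 s)); congr (Psi b _); move/subr0_eq: Zs.
Qed.

(* In the radial problem, positivity of [1 - u] is not assumed: it follows from
   the monotonicity of [r ^ n * V'] as long as [V = 1 - u] stays positive. *)
Section Bvp.
Variables (alpha lambda : R) (u : R -> R).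
Hypotheses (a01 : 0 < alpha < 1) (lam0 : 0 < lambda)
  (H : radial_bvp n.+1 d alpha lambda u).
Let V (r : R) : R := 1 - u r.
Let V' (r : R) : R := - derive1 u r.
Let a : R := 1 - alpha.
Let a0 : 0 < a. Proof. by rewrite subr_gt0; case/andP: a01. Qed.

Lemma bvp_V r : 0 < r < 1 -> dd r V (V' r) /\
  dd r V' (- (n%:R / r * V' r) + (lambda + d * V' r ^+ 2) / V r).
Proof.
move=> r01; have [_ _ _ _ /(_ r r01)[d1 d2 E]] := H.
have h1 := derivable_dd d1; have h2 := derivable_dd d2.
split; first by rewrite /V; dby; rewrite /V' /=; ring.
apply: dval (dN h2) _; move: E; rewrite /V' /V -natr1 addrK sqrrN => E.
by rewrite mulrN opprK; apply/eqP; rewrite -subr_eq0 -[X in _ == X]oppr0 -[X in _ == - X]E; apply/eqP; ring.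
Qed.

Lemma bvp_at0 : forall e, 0 < e -> exists2 r, 0 < r & forall h, 0 < h -> h < r ->
  `|V h - a| <= e * h.
Proof.
move=> e e0; have [_ u0 /cvgrPdist_le/(_ e e0) + _ _] := H.
rewrite near_withinE => /near_eps[r r0 Hr]; exists r => // h h0 hr.
have := Hr h; rewrite subr0 gtr0_norm // => /(_ hr h0).
rewrite sub0r normrN normrM normfV (gtr0_norm h0) ler_pdivrMr // u0.
by rewrite /V /a -normrN; congr (`|_| <= _); ring.
Qed.

Let Pv (r : R) : R := r ^+ n * V' r.

Lemma dPv r : 0 < r < 1 -> dd r Pv (r ^+ n * ((lambda + d * V' r ^+ 2) / V r)).
Proof.
move=> /[dup] r01 /andP[r0 _]; have [_ h] := bvp_V r01.
have sn1 : r ^+ n.-1 != 0 by rewrite expf_neq0 // gt_eqF.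
rewrite /Pv; dby; rewrite /= -(prednK n0) /= exprS.
by move: (_ / V r) => Q; field; rewrite gt_eqF.
Qed.

Section Positive.
Variable c : R.
Hypotheses (c0 : 0 < c) (c1 : c <= 1) (Vpos : forall r, 0 < r -> r < c -> 0 < V r).

Let Pv_incr r s : 0 < r -> r < s -> s < c -> Pv r < Pv s.
Proof.
have c1' := c1; have c0' := c0; move=> r0 rs sc; apply: (dd_incr rs (f' := fun r => r ^+ n * ((lambda + d * V' r ^+ 2) / V r))).
  by move=> x rx xs; apply: dPv; apply/andP; split; lra.
move=> x rx xs; rewrite mulr_gt0 ?exprn_gt0 //; first lra.
rewrite divr_gt0 ?Vpos //; try lra.
by rewrite ltr_wpDr // mulr_ge0 ?sqr_ge0 // ltW.
Qed.

(** The boundary condition at 0 controls only difference quotients of [V]; the mean value theorem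
    between h / 2 and h turns this into small values of [V'] at some points near 0. *)
Let MVT_V e : 0 < e -> forall s, 0 < s -> s < 1 -> exists2 r, 0 < r < s & `|V' r| <= e.
Proof.
move=> e0 s s0 s1; have [q q0 Hq] := bvp_at0 (e := e / 4) ltac:(by rewrite divr_gt0).
pose h := Num.min (q / 2) (s / 2).
have h0 : 0 < h by rewrite lt_min !divr_gt0.
have hq : h <= q / 2 by rewrite ge_min lexx.
have hs : h <= s / 2 by rewrite ge_min lexx orbT.
have [||x [x1 x2 E]] := @MVTdd _ V V' (h / 2) h; first lra.
  by move=> x x1 x2; have [] := @bvp_V x ltac:(apply/andP; split; lra).
exists x; first by apply/andP; split; lra.
have := Hq h h0 ltac:(lra); have := Hq (h / 2) ltac:(lra) ltac:(lra).
rewrite !ler_norml => /andP[e1 e2] /andP[e3 e4].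
have h2 : 0 < h / 2 by rewrite divr_gt0.
have E' : V h - V (h / 2) = V' x * (h / 2) by rewrite E; field.
have eh : 0 < e * h by rewrite mulr_gt0.
by apply/andP; split; rewrite -(ler_pM2r h2); lra.
Qed.

(** The flux r^n V' is strictly increasing. A nonpositive value at [r] would keep it below a
    negative constant on the left of r / 2, against [MVT_V]. *)
Lemma bvp_flux_pos r : 0 < r -> r < c -> 0 < V' r.
Proof.
have c1' := c1; have c0' := c0; move=> r0 rc; rewrite -(pmulr_rgt0 _ (exprn_gt0 n r0)) ltNge; apply/negP => Pr.
have r2 : 0 < r / 2 by rewrite divr_gt0.
have P2 : Pv (r / 2) < 0 by have := Pv_incr r2 (_ : r / 2 < r) rc => /(_ ltac:(lra)); rewrite /Pv; lra.
have [x /andP[x0 xr] Vx] := MVT_V (e := - Pv (r / 2) / 2) ltac:(by rewrite divr_gt0 // oppr_gt0) r2 ltac:(lra).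
have := Pv_incr x0 xr ltac:(lra); rewrite {1}/Pv.
have xn : x ^+ n <= 1 by apply: exprn_ile1; lra.
have xn0 : 0 < x ^+ n by rewrite exprn_gt0.
move: Vx; rewrite ler_norml => /andP[+ _]; nra.
Qed.

Lemma bvp_flux0 : vanishes0 Pv.
Proof.
have c1' := c1; have c0' := c0; move=> e r e0 r0; pose s := Num.min r c.
have s0 : 0 < s by rewrite lt_min r0.
have sr : s <= r by rewrite ge_min lexx.
have sc : s <= c by rewrite ge_min lexx orbT.
have s2 : 0 < s / 2 by lra.
have s21 : s / 2 < 1 by lra.
have [x /andP[x0 xs] Vx] := MVT_V e0 s2 s21.
exists x; split => //; first lra.
rewrite /Pv normrM (ger0_norm (exprn_ge0 _ (ltW x0))) (le_trans _ Vx) // ler_piMl //.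
by apply: exprn_ile1; lra.
Qed.

Lemma bvp_V_ge r : 0 < r -> r < c -> a <= V r.
Proof.
have c1' := c1; have c0' := c0; have a0' := a0; move=> r0 rc; rewrite leNgt; apply/negP => Va.
have [q q0 Hq] := bvp_at0 (e := (a - V r) / 2) ltac:(by rewrite divr_gt0 // subr_gt0).
pose h := Num.min (q / 2) (r / 2).
have h0 : 0 < h by rewrite lt_min !divr_gt0.
have hq : h <= q / 2 by rewrite ge_min lexx.
have hs : h <= r / 2 by rewrite ge_min lexx orbT.
have : V h <= V r.
  have hr : h <= r by lra.
  apply: (@dd_ndecr _ V V' _ _ hr) => x x1 x2.
    by have [] := @bvp_V x ltac:(apply/andP; split; lra).
  by apply/ltW/bvp_flux_pos; lra.
have := Hq h h0 ltac:(lra); rewrite ler_norml => /andP[+ _].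
by have : h <= 1 by [lra]; nra.
Qed.
End Positive.

(** Before the first point where [V] equals a / 2 it is positive, hence at least [a] by [bvp_V_ge];
    continuity forbids the jump. *)
Lemma bvp_V_pos r : 0 < r -> r < 1 -> 0 < V r.
Proof.
move=> r0 r1; rewrite ltNge; apply/negP => Vr.
have [q q0 Hq] := bvp_at0 (e := a / 2) ltac:(by rewrite divr_gt0).
pose h := Num.min (q / 2) (r / 2).
have h0 : 0 < h by rewrite lt_min !divr_gt0.
have hq : h <= q / 2 by rewrite ge_min lexx.
have hs : h <= r / 2 by rewrite ge_min lexx orbT.
have small s : 0 < s -> s <= h -> a / 2 < V s.
  move=> s0 sh; have := Hq s s0 ltac:(lra); rewrite ler_norml => /andP[+ _].
  have : a / 2 * s < a / 2 * 1 by rewrite ltr_pM2l ?divr_gt0 //; lra.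
  lra.
have [||||c [hc cr Vc bef]] := @first_zero _ (fun r => V r - a / 2) h r; first lra.
- move=> x x1 x2; have [dV _] := @bvp_V x ltac:(apply/andP; split; lra).
  exact: dd_cont (dD dV (dN (dcst (a / 2) x))).
- by rewrite subr_gt0 small.
- by have := a0; lra.
have Vp x : 0 < x -> x < c -> a / 2 < V x.
  move=> x0 xc; case: (leP x h) => xh; first exact: small.
  by have := bef x (ltW xh) xc; rewrite subr_gt0.
have pos x : 0 < x -> x < c -> 0 < V x by move=> x0 xc; have := Vp x x0 xc; have := a0; lra.
have [] := @bvp_V c ltac:(apply/andP; split; lra) => /dd_cont/cont_eps C _.
have [s s0 Hs] := C (a / 4) ltac:(by rewrite divr_gt0).
pose y := Num.max (c / 2) (c - s / 2).
have y1 : c / 2 <= y by rewrite le_max lexx.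
have y2 : c - s / 2 <= y by rewrite le_max lexx orbT.
have y3 : y < c by rewrite gt_max; apply/andP; split; lra.
have := @bvp_V_ge c ltac:(lra) ltac:(lra) pos y ltac:(lra) y3.
have := Hs y; rewrite ltr_norml => /(_ ltac:(apply/andP; split; lra)).
by rewrite ltr_norml => /andP[_ +]; have := a0; lra.
Qed.
End Bvp.
End Uniqueness.

(** * Solutions of the radial problem *)

Lemma within_eps (R : realType) (f : R -> R) (a b x : R) :
  {within `[a, b], continuous f} -> a <= x -> x <= b ->
  forall e, 0 < e -> exists2 r, 0 < r & forall y, a <= y -> y <= b -> `|y - x| < r ->
    `|f y - f x| < e.
Proof.
move=> /subspace_continuousP C ax xb e e0.
have /cvgrPdist_lt/(_ e e0) := C x ltac:(by rewrite /= in_itv /= ax xb).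
rewrite near_withinE => /near_eps[r r0 Hr]; exists r => // y ay yb yr.
by rewrite distrC; apply: Hr => //=; rewrite in_itv /= ay yb.
Qed.

Section Curve.
Context {R : realType}.
Variables (n : nat) (d : R).
Hypotheses (n0 : (0 < n)%N) (d0 : 0 < d) (dn : 0 < n.+1%:R - 2 * d).
Let b : R := 1 - d.
Let NN : R := n.+1%:R.
Variables (L L' : R -> R).
Hypothesis prof : is_profile NN d L L'.

Let NN2 : 2 <= NN. Proof. by rewrite /NN ler_nat. Qed.
Let NN0 : 0 < NN. Proof. by rewrite /NN ltr0n. Qed.
Let nN : n%:R = NN - 1 :> R. Proof. by rewrite /NN -natr1 addrK. Qed.
Let L0 : L 0 = 0. Proof. by have [[]] := prof. Qed.
Let L'0 : L' 0 = 0. Proof. by have [[_ ->]] := prof. Qed.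
Let dL (s : R) : dd s L (L' s). Proof. by have [_ /(_ s)[]] := prof. Qed.
Let solL (s : R) : 0 < s -> lsol NN d 1 L L' s. Proof. by have [_ /(_ s)[]] := prof. Qed.
Let L_ge0 (s : R) : 0 <= s -> 0 <= L s. Proof. by have [_ _ /(_ s)] := prof. Qed.

(* The summand [ln 1 / 2] keeps the shape of [lsol_orbit] for [lambda = 1]. *)
Definition xo (t : R) : R := t + ln 1 / 2 - L (expR t).
Definition yo (t : R) : R := 1 - expR t * L' (expR t).

Lemma prof_orbit t : orbit (NN - 2 * d) (1 - d) (NN - 1 - d) xo yo t.
Proof. exact: (lsol_orbit ltr01 (solL (expR_gt0 t))). Qed.

Lemma prof_F t : 0 <= pohF NN d xo yo t.
Proof. by have [_ _ _ _] := prof; exact. Qed.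

Lemma prof_L'_gt0 s : 0 < s -> 0 < L' s.
Proof.
move=> s0; have [p0 _ _] := pohF_bounds d0 NN0 (prof_F (ln s)).
by move: p0; rewrite /yo lnK ?posrE // opprB addrC subrK pmulr_rgt0.
Qed.

Lemma prof_L_lt s t : 0 <= s -> s < t -> L s < L t.
Proof.
move=> s0 st; apply: (@dd_incr _ L L' _ _ st) => [x _ _|x sx _]; first exact: dL.
by apply: prof_L'_gt0; lra.
Qed.

Lemma prof_L'_small e : 0 < e -> exists2 r, 0 < r & forall s, 0 < s -> s < r ->
  0 <= L' s /\ L' s <= 2 * s /\ s < e /\ L s < e.
Proof.
move=> e0; have [_ _ _ /(_ 1 ltr01)[r1 r10 H1] _] := prof.
have /cont_eps/(_ e e0)[r2 r20 H2] := dd_cont (dL 0).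
exists (Num.min r1 (Num.min r2 e)) => [|s s0]; first by rewrite !lt_min r10 r20.
rewrite !lt_min => /and3P[s1 s2 s3]; split; first exact: ltW (prof_L'_gt0 s0).
split; last first.
  split => //; have := H2 s; rewrite subr0 gtr0_norm // L0 subr0 => /(_ s2).
  by apply: le_lt_trans; exact: ler_norm.
rewrite -ler_pdivrMr //; have := H1 s s0 s1; rewrite ler_norml => /andP[_].
have : NN^-1 <= 1 by rewrite invf_le1 // /NN ler1n.
by move: (NN^-1) => i h1 h2; lra.
Qed.

Definition W (s : R) : R := expR (L s).
Definition qc (k : R) : R := k ^+ 2 / W k ^+ 2.

Lemma W_gt0 s : 0 < W s. Proof. exact: expR_gt0. Qed.
Lemma W_neq0 s : W s != 0. Proof. by rewrite gt_eqF ?W_gt0. Qed.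
Lemma W0 : W 0 = 1. Proof. by rewrite /W L0 expR0. Qed.
Lemma W_lt s t : 0 <= s -> s < t -> W s < W t.
Proof. by move=> s0 st; rewrite ltr_expR prof_L_lt. Qed.

Lemma qc_xo t : qc (expR t) = expR (2 * xo t).
Proof.
rewrite /qc /W /xo ln1 mul0r addr0 mulrBr -!expRM_natl -expRN -expRD; congr expR; ring.
Qed.

(** [xo] is bounded above by the Pohozaev bound, so L(e^t) = t - xo t is unbounded and [W] takes
    every value above 1. *)
Lemma W_surj a : 0 < a -> a < 1 -> exists2 k, 0 < k & W k = a^-1.
Proof.
move=> a0 a1; have ia : 1 < a^-1 by rewrite invf_gt1.
pose t := ln (a^-1) + ln (NN * (NN / d)) / 2.
have big : a^-1 <= W (expR t).
  have := pohF_x NN2 d0 (prof_F t); rewrite /xo ln1 /t => h.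
  rewrite -[leLHS]lnK ?posrE ?invr_gt0 // /W ler_expR; lra.
have [|||k [k0 _ E]] := @IVTc _ W 0 (expR t) a^-1 (expR_ge0 t).
- by move=> s _ _; have h := dL s; have : dd s W (expR (L s) * L' s) by [exact: dexp]; exact: dd_cont.
- by rewrite W0 ltW.
- exact: big.
exists k => //; rewrite lt_neqAle k0 andbT; apply/eqP => E0.
by move: ia; rewrite -E -E0 W0 ltxx.
Qed.

Lemma W_inj k1 k2 : 0 <= k1 -> 0 <= k2 -> W k1 = W k2 -> k1 = k2.
Proof.
move=> h1 h2 E; case: (ltgtP k1 k2) => // h.
  by have := W_lt h1 h; rewrite E ltxx.
by have := W_lt h2 h; rewrite E ltxx.
Qed.

(** Rescaled to central value 1 and parameter 1, the function 1 - u solves the equation of the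
    profile and has a vanishing flux, so it is the profile; the condition at r = 1 then determines
    [W k]. *)
Lemma bvp_char (alpha lambda : R) (u : R -> R) : 0 < alpha < 1 -> 0 < lambda ->
  radial_bvp n.+1 d alpha lambda u ->
  exists k, [/\ 0 < k, W k = (1 - alpha)^-1, lambda = qc k &
    forall r, 0 <= r -> r <= 1 -> u r = 1 - W (k * r) / W k].
Proof.
move=> a01 lam0 H; pose a : R := 1 - alpha; pose V (r : R) : R := 1 - u r; pose V' (r : R) : R := - derive1 u r.
have a0 : 0 < a by rewrite subr_gt0; case/andP: a01.
have [cu u0 _ u1 _] := H.
have Vpos := bvp_V_pos n0 d0 a01 lam0 H.
have Vge := bvp_V_ge n0 d0 a01 lam0 H ltr01 (lexx 1) Vpos.
have V'pos := bvp_flux_pos n0 d0 lam0 H ltr01 (lexx 1) Vpos.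
have flux0 := bvp_flux0 H ltr01 (lexx 1).
have dV := bvp_V H; have at0 := bvp_at0 H.
(* With r = s / k the function V(r) / a satisfies the equation with parameter lambda / (k a)^2 =
   1. *)
pose k := Num.sqrt lambda / a.
have k0 : 0 < k by rewrite divr_gt0 // sqrtr_gt0.
have kE : lambda = k ^+ 2 * a ^+ 2.
  by rewrite /k exprMn sqr_sqrtr ?ltW // exprVn divfK // expf_neq0 // gt_eqF.
have rng (s : R) : 0 < s -> s < k -> 0 < s / k < 1.
  by move=> s0 sk; rewrite divr_gt0 //= ltr_pdivrMr // mul1r.
pose L1 (s : R) : R := ln (V (s / k) / a); pose L1' (s : R) : R := V' (s / k) / (k * V (s / k)).
have S1 (s : R) : 0 < s -> s < k -> lsol NN d 1 L1 L1' s /\ 0 <= L1 s.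
  move=> s0 sk; have /andP[r0 r1] := rng s s0 sk; have V0 := Vpos _ r0 r1.
  have h1 : dd (s / k) V (V' (s / k)) := (dV (s / k) (rng s s0 sk)).1.
  have h2 : dd (s / k) V' (- (n%:R / (s / k) * V' (s / k)) +
      (lambda + d * V' (s / k) ^+ 2) / V (s / k)) := (dV (s / k) (rng s s0 sk)).2.
  have dk : dd s (fun s => s / k) (k^-1) by dby; rewrite /=; ring.
  have g1 : dd s (fun s => V (s / k)) _ := dcomp (g := fun s => s / k) h1 dk; have g2 : dd s (fun s => V' (s / k)) _ := dcomp (g := fun s => s / k) h2 dk.
  have Vk0 : V (s / k) != 0 by rewrite gt_eqF.
  split; last by rewrite ln_ge0 // ler_pdivlMr // mul1r Vge.
  split.
    rewrite /L1; dby; first by rewrite divr_gt0.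
    by rewrite /= /L1' -/(V _) -/(V' _); field; rewrite Vk0 !gt_eqF.
  have E2 : expR (- (2 * L1 s)) = a ^+ 2 / V (s / k) ^+ 2.
    rewrite expRN expRM_natl /L1 lnK ?posrE ?divr_gt0 // expr_div_n invf_div //.
  rewrite /L1'; dby; first by rewrite mulf_neq0 // gt_eqF.
  rewrite /= E2 kE nN /L1' -/(V _) -/(V' _); field.
  by rewrite Vk0 !gt_eqF.
have T1 : tends0 L1.
  move=> e e0; have eak : 0 < e * a * k by rewrite mulr_gt0 // mulr_gt0.
  have [r r0 Hr] := at0 _ eak.
  have m0 : 0 < Num.min r 1 by rewrite lt_min r0 ltr01.
  exists (Num.min (Num.min r 1 * k) 1) => [|s s0].
    by rewrite lt_min ltr01 andbT mulr_gt0.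
  rewrite lt_min -(ltr_pdivrMr _ _ k0) lt_min => /andP[/andP[sr s1] s11].
  have r1 : 0 < s / k by rewrite divr_gt0.
  have sk : s < k by move: s1; rewrite ltr_pdivrMr // mul1r.
  have [_ l0] := S1 s s0 sk; rewrite ger0_norm //.
  have := Hr _ r1 sr; rewrite ler_norml => /andP[_ h].
  have /le_ln1Dx : -1 < V (s / k) / a - 1.
    by rewrite ltrBrDl subrr divr_gt0 // Vpos.
  rewrite addrC subrK => h2; apply: le_trans h2 _.
  have E : e * a * k * (s / k) = e * a * s by field; rewrite gt_eqF.
  have {}h : V (s / k) - a <= e * a * s by rewrite -E.
  rewrite lerBlDr ler_pdivrMr //.
  have : e * a * s <= e * a * 1 by rewrite ler_pM2l ?mulr_gt0 // ltW.
  lra.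
have T2 : tends0 L.
  move=> e e0; have [r r0 Hr] := prof_L'_small e0; exists r => // s s0 sr.
  by have [_ [_ [_ /ltW h]]] := Hr s s0 sr; rewrite ger0_norm // L_ge0 // ltW.
(* The flux of the rescaled solution is small only at the points given by [bvp_flux0]; at the same
   points that of the profile is small because L' <= 2 s. *)
have VP : vanishes0 (fun s => s ^+ n * (expR (b * L1 s) * L1' s) - s ^+ n * (expR (b * L s) * L' s)).
  move=> e r e0 r0.
  have [r1 r10 H1] := T1 1 ltr01; have [r2 r20 H2] := T2 1 ltr01.
  pose B := expR `|b|; have B0 : 0 < B by exact: expR_gt0.
  have m0 : 0 < Num.min 1 (e / (4 * B)) by rewrite lt_min ltr01 divr_gt0 // mulr_gt0.
  have [r3 r30 H3] := prof_L'_small m0.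
  pose C := k ^+ n * B / (k * a).
  have C0 : 0 < C by apply: divr_gt0; apply: mulr_gt0 => //; exact: exprn_gt0.
  pose rho := Num.min (Num.min r r1) (Num.min r2 (Num.min r3 k)).
  have rho0 : 0 < rho by rewrite !lt_min r0 r10 r20 r30.
  have eC : 0 < e / (2 * C) by apply: divr_gt0 => //; exact: mulr_gt0.
  have rhok : 0 < rho / k by exact: divr_gt0.
  have [s' [s'0 s'rho Hs']] := flux0 _ _ eC rhok.
  pose s := k * s'; have s0 : 0 < s by rewrite mulr_gt0.
  have sk' : s / k = s' by rewrite /s mulrC mulKf // gt_eqF.
  have : s < rho by rewrite /s mulrC -ltr_pdivlMr.
  rewrite !lt_min => /andP[/andP[sr sr1] /and3P[sr2 sr3 sk]].
  exists s; split => //; rewrite (le_trans (ler_normB _ _)) //.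
  have Eb (z : R) : `|z| <= 1 -> expR (b * z) <= B.
    move=> z1; rewrite ler_expR (le_trans (ler_norm _)) // normrM ler_piMr //.
  have /andP[q1 q2] := rng s s0 sk; rewrite sk' in q1 q2.
  have t1 : `|s ^+ n * (expR (b * L1 s) * L1' s)| <= e / 2.
    have V's := ltW (V'pos _ q1 q2).
    have Va : a <= V s' := Vge _ q1 q2; have V0 : 0 < V s' := Vpos _ q1 q2.
    have kV : 0 <= k * V s' by rewrite mulr_ge0 // ltW.
    have kn : 0 <= k ^+ n by rewrite exprn_ge0 // ltW.
    have -> : s ^+ n * (expR (b * L1 s) * L1' s) =
      (s' ^+ n * V' s') * (k ^+ n * expR (b * L1 s) / (k * V s')).
      by rewrite /L1' sk' /s exprMn; field; rewrite /V !gt_eqF.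
    have -> : e / 2 = e / (2 * C) * C by field; rewrite gt_eqF.
    rewrite normrM; apply: ler_pM => //.
    rewrite ger0_norm; last by rewrite divr_ge0 // mulr_ge0 ?expR_ge0.
    have -> : C = k ^+ n * (B / (k * a)) by rewrite /C [RHS]mulrA.
    rewrite -[leLHS]mulrA ler_wpM2l //; apply: ler_pM.
    - exact: expR_ge0.
    - by rewrite invr_ge0.
    - by apply: Eb; exact: H1.
    - have ka : 0 < k * a by rewrite mulr_gt0.
      have kV' : 0 < k * V s' by rewrite mulr_gt0.
      by rewrite lef_pV2 ?posrE // ler_pM2l.
  have t2 : `|s ^+ n * (expR (b * L s) * L' s)| <= e / 2.
    have [g0 [g1 [g2 g3]]] := H3 s s0 sr3; move: g2 g3; rewrite !lt_min => /andP[s1 se] _.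
    have sn0 : 0 <= s ^+ n by rewrite exprn_ge0 // ltW.
    rewrite ger0_norm; last by rewrite mulr_ge0 // mulr_ge0 ?expR_ge0.
    have sn : s ^+ n <= 1 by apply: exprn_ile1; apply: ltW.
    have -> : e / 2 = 1 * (B * (2 * (e / (4 * B)))) by field; rewrite gt_eqF.
    apply: ler_pM => //; [by rewrite mulr_ge0 ?expR_ge0|].
    apply: ler_pM; [exact: expR_ge0|exact: g0|by apply: Eb; exact: H2|].
    by apply: le_trans g1 _; rewrite ler_pM2l // ltW.
  by rewrite [leRHS]splitr lerD.
have uniq := lsol_unique n0 d0 S1 (fun s s0 _ => conj (solL s0) (L_ge0 (ltW s0))) T1 T2 VP.
have inside r : 0 < r -> r < 1 -> V r = a * W (k * r).
  move=> r0 r1; have kr : 0 < k * r by rewrite mulr_gt0.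
  have := uniq (k * r) kr; rewrite -[ltRHS]mulr1 ltr_pM2l // => /(_ r1).
  have E : k * r / k = r by rewrite mulrC mulKf // gt_eqF.
  rewrite /L1 E /W => <-; rewrite lnK ?posrE ?divr_gt0 ?Vpos //.
  by rewrite mulrC divfK // gt_eqF.
(* The identity holds for r < 1 and is carried to the boundary by the continuity of [u] from
   inside. *)
have Wk : a * W k = 1.
  have cW : dd (1 : R) (fun r : R => a * W (k * r)) (a * (W (k * 1) * (k * L' (k * 1)))).
    have h := dL (k * 1); have dk : dd (1 : R) (fun r : R => k * r) k by dby; rewrite /=; ring.
    by have := dcomp (g := fun r => k * r) h dk => h'; rewrite /W; dby; rewrite /=; ring.
  apply/eqP; rewrite -subr_eq0 -normr_le0; apply/ler_addgt0Pr => e e0; rewrite add0r.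
  have e2 : 0 < e / 2 by rewrite divr_gt0.
  have /cont_eps/(_ _ e2)[r1 r10 H1] := dd_cont cW.
  have [r2 r20 H2] := within_eps cu ler01 (lexx 1) e2.
  have [m [m0 m2 mr1 mr2]] : exists m : R, [/\ 0 < m, m <= 1 / 2, m < r1 & m < r2].
    have half (z : R) : 0 < z -> z / 2 < z by move=> z0; rewrite ltr_pdivrMr // ltr_pMr // ltr1n.
    exists (Num.min (1 / 2) (Num.min (r1 / 2) (r2 / 2))); split.
    - by rewrite !(lt_min, divr_gt0).
    - by rewrite ge_min lexx.
    - by rewrite !gt_min half ?orbT.
    - by rewrite !gt_min half ?orbT.
  have [q0 q1] : 0 < 1 - m /\ 1 - m < 1 by split; lra.
  have rr : `|1 - m - 1| = m by rewrite addrAC subrr add0r normrN gtr0_norm.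
  have := H1 (1 - m); rewrite rr => /(_ mr1) h1.
  have := H2 (1 - m) (ltW q0) (ltW q1); rewrite rr => /(_ mr2) h2.
  rewrite u1 subr0 in h2; rewrite mulr1 -inside // in h1.
  rewrite ler_norml; move: h1 h2; rewrite /V !ltr_norml; lra.
have ai : W k = a^-1.
  by apply: (mulfI (lt0r_neq0 a0)); rewrite Wk divff // gt_eqF.
exists k; split => //; first by rewrite /qc ai kE exprVn invrK.
move=> r r0 r1; rewrite ai invrK mulrC.
case: (ltrP 0 r) => r0'; last first.
  have -> : r = 0 by lra.
  by rewrite mulr0 W0 mulr1 u0 /a; ring.
case: (ltrP r 1) => r1'; first by rewrite -inside // /V; ring.
have -> : r = 1 by lra.
by rewrite mulr1 Wk subrr.
Qed.

End Curve.

(** * The bifurcation curve *)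

Section Types.
Context {R : realType}.
Variables (n : nat) (d : R).
Hypotheses (n0 : (0 < n)%N) (d0 : 0 < d) (dn : 0 < n.+1%:R - 2 * d).
Let NN : R := n.+1%:R.
Variables (L L' : R -> R).
Hypothesis prof : is_profile NN d L L'.
Local Notation l := (NN - 1 - d).
Local Notation W := (W L).
Local Notation qc := (qc L).
Local Notation xo := (xo L).
Local Notation yo := (yo L').

Let NN2 : 2 <= NN. Proof. by rewrite /NN ler_nat. Qed.
Let NN0 : 0 < NN. Proof. by rewrite /NN ltr0n. Qed.
Let nN : n%:R = NN - 1 :> R. Proof. by rewrite /NN -natr1 addrK. Qed.
Let L'0 : L' 0 = 0. Proof. by have [[_ ->]] := prof. Qed.
Let dL (s : R) : dd s L (L' s). Proof. by have [_ /(_ s)[]] := prof. Qed.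
Let solL (s : R) : 0 < s -> lsol NN d 1 L L' s. Proof. by have [_ /(_ s)[]] := prof. Qed.
Let l0 : 0 < l. Proof. exact: l_gt0. Qed.

Definition uc (k r : R) : R := 1 - W (k * r) / W k.
Definition uc1 (k r : R) : R := - (k * L' (k * r) * (W (k * r) / W k)).
(** The second derivative is written through the equation instead of [L''], so the equation holds by
    definition and the limit at 0 follows from those of u and u' / r. Its value at r = 0 has no
    meaning. *)
Definition uc2 (k r : R) : R :=
  - (n%:R / r * uc1 k r) - (qc k + d * uc1 k r ^+ 2) / (1 - uc k r).

Lemma d_uc (k r : R) : dd r (uc k) (uc1 k r).
Proof.
have dk : dd r (fun r : R => k * r) k by dby; rewrite /=; ring.
have h : dd r (fun r : R => L (k * r)) (L' (k * r) * k) := dcomp (g := fun r => k * r) (dL _) dk.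
by rewrite /uc /W; dby; rewrite /uc1 /W /=; ring.
Qed.

Lemma d_uc1 (k r : R) : 0 < k -> 0 < r -> dd r (uc1 k) (uc2 k r).
Proof.
move=> k0 r0; have kr : 0 < k * r by rewrite mulr_gt0.
have dk : dd r (fun r : R => k * r) k by dby; rewrite /=; ring.
have [h1 h2] := solL kr.
have g1 : dd r (fun r : R => L (k * r)) _ := dcomp (g := fun r => k * r) h1 dk.
have g2 : dd r (fun r : R => L' (k * r)) _ := dcomp (g := fun r => k * r) h2 dk.
rewrite {1}/uc1 /W; dby; rewrite /= /uc2 /uc /uc1 /qc -nN mul1r subKr.
have -> : expR (- (2 * L (k * r))) = (W (k * r)) ^- 2 by rewrite expRN expRM_natl.
rewrite -/(W k) -/(W (k * r)); have := W_neq0 L k; have := W_neq0 L (k * r).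
move: (W k) (W (k * r)) => Wk Wr w1 w2.
by field; rewrite ?w1 ?w2 ?gt_eqF.
Qed.

Lemma uc_lt1 k r : 0 < 1 - uc k r.
Proof. by rewrite /uc subKr divr_gt0 ?W_gt0. Qed.

Lemma bvp_exists k : 0 < k -> radial_bvp n.+1 d (1 - (W k)^-1) (qc k) (uc k).
Proof.
move=> k0; have d1 : derive1 (uc k) = uc1 k by apply/funext => r; exact: dd_derive1 (d_uc k r).
have u0 : uc k 0 = 1 - (W k)^-1 by rewrite /uc mulr0 (W0 prof) div1r.
split => //.
- by apply: within_cont => r _ _; exact: dd_cont (d_uc k r).
- have /dd_eps D : dd (0 : R) (uc k) 0.
    by apply: dval (d_uc k 0) _; rewrite /uc1 mulr0 L'0 mulr0 mul0r oppr0.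
  apply/cvgrPdist_le => e e0; have [r r0 Hr] := D e e0.
  rewrite near_withinE; apply/near_eps; exists r => // h; rewrite subr0 => hr h0.
  have := Hr h hr; rewrite add0r mul0r subr0 sub0r normrN normrM normfV.
  by rewrite ler_pdivrMr // normr_gt0 gt_eqF.
- by rewrite /uc mulr1 divff ?W_neq0 // subrr.
- move=> r /andP[r0 _]; have D1 := d_uc1 k0 r0; rewrite d1; split.
  + exact: dd_derivable (d_uc k r).
  + exact: dd_derivable D1.
  + by rewrite (dd_derive1 D1) /uc2 -natr1 addrK; ring.
Qed.

Lemma qc_gt0 k : 0 < k -> 0 < qc k.
Proof. by move=> k0; rewrite divr_gt0 ?exprn_gt0 ?W_gt0. Qed.

Lemma W_gt1 k : 0 < k -> 1 < W k.
Proof. by move=> k0; rewrite -(W0 prof) (W_lt d0 prof). Qed.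

Lemma alpha_of k : 0 < k -> 0 < 1 - (W k)^-1 < 1.
Proof.
move=> k0; have := W_gt1 k0; have := W_gt0 L k => w0 w1.
by rewrite subr_gt0 invf_lt1 // w1 /= ltrBlDr ltrDl invr_gt0.
Qed.

Lemma bvp_k k lambda u : 0 < k -> 0 < lambda -> radial_bvp n.+1 d (1 - (W k)^-1) lambda u ->
  lambda = qc k /\ forall r, 0 <= r -> r <= 1 -> u r = uc k r.
Proof.
move=> k0 lam0 /(bvp_char n0 d0 prof (alpha_of k0) lam0)[k' [k'0 Wk' -> ur]].
suff E : k' = k by rewrite E in ur *; split.
by apply: (W_inj d0 prof (ltW k'0) (ltW k0)); rewrite Wk' subKr invrK.
Qed.

Lemma curve_exists : exists lam : R -> R, bifurcation_map n.+1 d lam /\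
  (forall k, 0 < k -> lam (1 - (W k)^-1) = qc k).
Proof.
have C (alpha : R) : exists k : R, 0 < alpha < 1 -> 0 < k /\ alpha = 1 - (W k)^-1.
  case: (pselect (0 < alpha < 1)) => [a01|na]; last by exists 0.
  have [a0 a1] : 0 < 1 - alpha /\ 1 - alpha < 1 by move: a01 => /andP[? ?]; split; lra.
  have [k k0 Wk] := W_surj n0 d0 prof a0 a1; exists k => _; split => //.
  by rewrite Wk invrK; ring.
have [kf Hk] := choice C.
have lamE k : 0 < k -> kf (1 - (W k)^-1) = k.
  move=> k0; have [h1 h2] := Hk _ (alpha_of k0).
  apply: (W_inj d0 prof (ltW h1) (ltW k0)); apply: invr_inj.
  by move: h2 => /(congr1 (fun z => 1 - z)); rewrite !subKr.
exists (fun alpha => qc (kf alpha)); split => [alpha a01 lambda|k k0]; last by rewrite lamE.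
have [k0 ->] := Hk _ a01; rewrite lamE //; split => [[lam0 [u H]]|->].
  by have [] := bvp_k k0 lam0 H.
by split; [exact: qc_gt0|exists (uc (kf alpha)); exact: bvp_exists].
Qed.

(** The profile starts from x = -oo, y = 1, as 0 <= L' <= 2 s and L >= 0 near the origin. *)
Lemma early e : 0 < e -> exists T0, forall T, T <= T0 ->
  [/\ 0 < yo T, yo T <= 1 & expR (2 * xo T) < e].
Proof.
move=> e0; have m0 : 0 < Num.min (1 / 2) (Num.min 1 e) by rewrite !lt_min ltr01 e0 !andbT divr_gt0.
have [r r0 Hr] := prof_L'_small d0 prof m0.
exists (ln (r / 2)) => T TT0; have eT := expR_gt0 T.
have er : expR T < r.
  have : expR T <= r / 2 by rewrite -[leRHS]lnK ?posrE ?divr_gt0 // ler_expR.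
  lra.
have [p0 [p1 [+ _]]] := Hr _ eT er; rewrite !lt_min => /and3P[s1 s2 s3].
have h1 : 0 <= expR T * L' (expR T) by rewrite mulr_ge0 // ltW.
have h2 : expR T * L' (expR T) < 1.
  have : expR T * L' (expR T) <= expR T * (2 * expR T) by rewrite ler_pM2l.
  by move: (expR T) s1 eT => s s1 eT; nra.
rewrite /yo; split; [lra|lra|].
rewrite -qc_xo /qc ltr_pdivrMr ?exprn_gt0 ?W_gt0 //.
have w2 : 1 < W (expR T) ^+ 2 by rewrite exprn_egt1 // W_gt1.
have s4 : expR T ^+ 2 < e.
  by rewrite expr2; move: (expR T) s2 s3 eT => s s2 s3 eT; nra.
by apply: lt_trans s4 _; rewrite ltr_pMr.
Qed.

Lemma prof_cvg e : 0 < e -> exists S, forall t, S <= t ->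
  `|yo t| < e /\ `|expR (2 * xo t) - l| < e.
Proof.
move=> e0; have [T0 /(_ T0 (lexx _))[y0 _ _]] := early ltr01.
have orb t (_ : T0 <= t) := prof_orbit prof t.
have [B HB] := forward_bounded NN2 d0 dn orb (fun t _ => prof_F prof t) (ltW y0).
have cne : NN - 2 * d != 0 by rewrite gt_eqF.
by have [S _ HS] := orbit_bounded_cvg d0 cne orb HB e0; exists S.
Qed.

(** At early times [xo] differs from the equilibrium value, and by [En_gt] the excess energy never
    vanishes. *)
Lemma prof_energy t : G NN d (xs NN d) < En NN d xo yo t.
Proof.
have [T0 H] := early l0; pose T := Num.min T0 t.
have T1 : T <= T0 by rewrite ge_min lexx.
have T2 : T <= t by rewrite ge_min lexx orbT.
have [_ _ q1] := H T T1.
apply: (En_gt NN2 d0 dn T2 (fun u _ => prof_orbit prof u)).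
apply: lt_le_trans (En_ge NN d xo yo T); apply: (G_min NN2 d0 dn).
by apply: contraTneq q1 => ->; rewrite (expR_xs NN2 dn) ltxx.
Qed.

Lemma prof_zero T : (NN - 2 * d) ^+ 2 < 8 * l ->
  exists2 t, T <= t & xo t = xs NN d.
Proof.
move=> cl; apply: (orbit_oscillates NN2 dn cl (fun t _ => prof_orbit prof t)) => e e0.
have [S HS] := prof_cvg e0; exists (Num.max S T); first by rewrite le_max lexx orbT.
by move=> t; rewrite ge_max => /andP[h _]; exact: HS.
Qed.

(** At a crossing of the equilibrium value the excess energy is all kinetic, so [yo] is nonzero
    there and both sides are visited nearby. *)
Lemma prof_signs T (s : bool) : (NN - 2 * d) ^+ 2 < 8 * l ->
  exists2 t, T < t & if s then l < expR (2 * xo t) else expR (2 * xo t) < l.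
Proof.
move=> cl; have [t Tt xt] := prof_zero (T + 1) cl.
have [dx _] := prof_orbit prof t.
have y0 : yo t != 0.
  apply/eqP => y0; have := prof_energy t.
  by rewrite (En_turn NN d xo y0) xt ltxx.
suff [t1 [t2 [h1 h2 h3 h4]]] : exists t1 t2, [/\ T < t1, T < t2, xo t1 < xs NN d & xs NN d < xo t2].
  by case: s; [exists t2|exists t1] => //; rewrite -(expR_xs NN2 dn) ltr_expR ltr_pM2l.
case: (ltgtP (yo t) 0) y0 => // yt _.
- have dx' := dN dx; have ny : 0 < - yo t by rewrite oppr_gt0.
  have [e1 e10 H1] := dd_pos_right dx' ny; have [e2 e20 H2] := dd_pos_left dx' ny.
  (* The crossing was taken beyond [T + 1], so stepping back by at most 1 / 2 stays beyond [T]. *)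
  pose m := Num.min e2 1; have m0 : 0 < m by rewrite lt_min e20 ltr01.
  have m1 : m <= e2 by rewrite ge_min lexx.
  have m2 : m <= 1 by rewrite ge_min lexx orbT.
  exists (t + e1 / 2), (t - m / 2); split; [lra|lra| |].
    by have := H1 (t + e1 / 2) ltac:(lra) ltac:(lra); rewrite xt ltrN2.
  by have := H2 (t - m / 2) ltac:(lra) ltac:(lra); rewrite xt ltrN2.
- have [e1 e10 H1] := dd_pos_right dx yt; have [e2 e20 H2] := dd_pos_left dx yt.
  pose m := Num.min e2 1; have m0 : 0 < m by rewrite lt_min e20 ltr01.
  have m1 : m <= e2 by rewrite ge_min lexx.
  have m2 : m <= 1 by rewrite ge_min lexx orbT.
  exists (t - m / 2), (t + e1 / 2); split; [lra|lra| |].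
    by have := H2 (t - m / 2) ltac:(lra) ltac:(lra); rewrite xt.
  by have := H1 (t + e1 / 2) ltac:(lra) ltac:(lra); rewrite xt.
Qed.

Lemma alpha_lt k1 k2 : 0 < k1 -> k1 < k2 -> 1 - (W k1)^-1 < 1 - (W k2)^-1.
Proof.
move=> k10 k12; rewrite ltrD2l ltrN2 ltf_pV2 ?posrE ?W_gt0 //.
by apply: (W_lt d0 prof) => //; exact: ltW.
Qed.

Lemma alpha_surj a : 0 < a -> a < 1 -> exists2 k, 0 < k & a = 1 - (W k)^-1.
Proof.
move=> a0 a1; have [k k0 Wk] := W_surj n0 d0 prof (a := 1 - a) ltac:(lra) ltac:(lra).
by exists k => //; rewrite Wk invrK; ring.
Qed.

Lemma alpha_le k1 k2 : 0 < k1 -> 0 < k2 -> 1 - (W k1)^-1 < 1 - (W k2)^-1 -> k1 < k2.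
Proof.
move=> h1 h2; rewrite ltNge => h; rewrite ltNge; apply: contra h.
by rewrite le_eqVlt => /predU1P[->//|h]; apply/ltW/alpha_lt.
Qed.

Lemma curve_limit (lam : R -> R) : (forall k, 0 < k -> lam (1 - (W k)^-1) = qc k) ->
  lam alpha @[alpha --> (1 : R)^'-] --> l.
Proof.
move=> lamE; apply/cvgrPdist_lt => e e0; have [S HS] := prof_cvg e0.
have eS := expR_gt0 S; have /andP[a0 a1] := alpha_of eS.
rewrite near_withinE; apply/near_eps; exists ((W (expR S))^-1); first by rewrite invr_gt0 W_gt0.
move=> a; rewrite ltr_norml => /andP[h _] /= a1'.
have a2 : 1 - (W (expR S))^-1 < a by lra.
have [k k0 ak] := alpha_surj (lt_trans a0 a2) a1'.
rewrite ak lamE // distrC -[k]lnK ?posrE // qc_xo.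
apply: (HS _ _).2; apply/ltW; rewrite -ltr_expR lnK ?posrE //.
by apply: alpha_le => //; rewrite -ak.
Qed.

Lemma curve_typeII : (NN - 2 * d) ^+ 2 < 8 * l -> typeII n.+1 d l.
Proof.
move=> cl; have [lam [bm lamE]] := curve_exists; exists lam; split => //.
  exact: curve_limit.
have [g Hg] := choice (fun p : R * bool => ex2_ind (fun t h1 h2 =>
   ex_intro (fun t => p.1 < t /\ if p.2 then l < expR (2 * xo t) else expR (2 * xo t) < l)
     t (conj h1 h2)) (prof_signs p.1 p.2 cl)).
(* Even indices lie above the equilibrium and odd ones below; steps longer than 1 give [t j >= j],
   hence [a j] tends to 1. *)
pose t := fix t j := match j with 0%N => g (0, true) | i.+1 => g (t i + 1, ~~ odd i.+1) end.
have tS j : t j + 1 < t j.+1 by have [] := Hg (t j + 1, ~~ odd j.+1).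
have tj j : j%:R <= t j.
  elim: j => [|j IH]; first by have [/= /ltW] := Hg (0, true).
  by apply: le_trans (ltW (tS j)); rewrite -natr1 lerD2r.
have ts j : if ~~ odd j then l < expR (2 * xo (t j)) else expR (2 * xo (t j)) < l.
  by case: j => [|j]; [have [] := Hg (0, true)|have [] := Hg (t j + 1, ~~ odd j.+1)].
pose a j := 1 - (W (expR (t j)))^-1.
have aE j : lam (a j) = expR (2 * xo (t j)) by rewrite lamE ?expR_gt0 // qc_xo.
have ainc i j : t i < t j -> a i < a j by move=> h; apply: alpha_lt; rewrite ?expR_gt0 // ltr_expR.
exists a; split.
- by move=> j; exact: alpha_of (expR_gt0 _).
- by move=> j; apply: ainc; have := tS j; lra.
- apply/cvgrPdist_lt => e e0.
  pose e' := Num.min e (1 / 2); have e'0 : 0 < e' by rewrite lt_min e0 divr_gt0.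
  have e'e : e' <= e by rewrite ge_min lexx.
  have e'1 : e' <= 1 / 2 by rewrite ge_min lexx orbT.
  have [k k0 Ek] := alpha_surj (a := 1 - e') ltac:(lra) ltac:(lra).
  exists (Num.trunc `|ln k|).+1 => // j /= jk.
  have kt : ln k < t j.
    apply: lt_le_trans (tj j); apply: le_lt_trans (ler_norm _) _.
    by apply: lt_le_trans (truncnS_gt _) _; rewrite ler_nat.
  have : 1 - (W k)^-1 < a j.
    by apply: alpha_lt => //; rewrite -(lnK (k0 : k \is Num.pos)) ltr_expR.
  have /andP[aj0 aj1] := alpha_of (expR_gt0 (t j)).
  rewrite -Ek -/(a j) in aj1 * => h; rewrite gtr0_norm; lra.
- move=> j; rewrite !aE; have := ts j; have := ts j.+1; rewrite /=.
  by case: (odd j) => /= h1 h2; [rewrite nmulr_rlt0|rewrite pmulr_rlt0]; rewrite ?subr_gt0 ?subr_lt0.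
Qed.

(** The profile starts with y close to 1 and e^(2 x) close to 0, where the upper edge of the region
    in [orbit_monotone] tends to c / 4. The condition c > 4 puts the orbit inside, from where [x]
    increases for ever. *)
Lemma qc_mono : 8 * l <= (NN - 2 * d) ^+ 2 -> 4 < NN - 2 * d ->
  (forall k, 0 < k -> qc k < l) /\ (forall k1 k2, 0 < k1 -> k1 < k2 -> qc k1 < qc k2).
Proof.
move=> cl c4.
(* The value of e^(2 x) at which the upper edge c / (4 l) (l - e^(2 x)) equals 1. *)
have e0 : 0 < l * (1 - 4 / (NN - 2 * d)).
  by rewrite mulr_gt0 // subr_gt0 ltr_pdivrMr // mul1r.
have el : l * (1 - 4 / (NN - 2 * d)) < l.
  by rewrite -[ltRHS]mulr1 ltr_pM2l // ltrBlDr ltrDl divr_gt0.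
have [T0 H] := early e0.
have mono T t : T <= T0 -> T <= t -> expR (2 * xo t) < l /\ (T < t -> 0 < yo t).
  move=> TT0; have [y0 y1 q1] := H T TT0.
  apply: (orbit_monotone NN2 d0 dn cl (fun t _ => prof_orbit prof t) (lt_trans q1 el) (ltW y0)).
  apply: le_trans y1 _; rewrite mulrC mulrA ler_pdivlMr ?mulr_gt0 //.
  have : expR (2 * xo T) * (NN - 2 * d) <= l * (1 - 4 / (NN - 2 * d)) * (NN - 2 * d).
    by rewrite ler_pM2r // ltW.
  have -> : l * (1 - 4 / (NN - 2 * d)) * (NN - 2 * d) = l * (NN - 2 * d - 4).
    by move: (l) (NN - 2 * d) (lt0r_neq0 dn) => l1 c1 c1n; field.
  lra.
split=> [k k0|k1 k2 k10 k12].
  rewrite -[k]lnK ?posrE // qc_xo; pose T := Num.min T0 (ln k).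
  by apply: (mono T _ _ _).1; rewrite ge_min lexx ?orbT.
have k20 : 0 < k2 by lra.
have ll : ln k1 < ln k2 by rewrite ltr_ln.
rewrite -[k1]lnK ?posrE // -[k2]lnK ?posrE // !qc_xo ltr_expR ltr_pM2l //.
apply: (@dd_incr _ xo yo _ _ ll) => u u1 u2; first by have [] := prof_orbit prof u.
pose T := Num.min T0 (ln k1).
have T1 : T <= T0 by rewrite ge_min lexx.
have T2 : T <= ln k1 by rewrite ge_min lexx orbT.
by apply: (mono T u T1 _).2; lra.
Qed.

Lemma curve_typeI : 8 * l <= (NN - 2 * d) ^+ 2 -> 4 < NN - 2 * d -> typeI n.+1 d l.
Proof.
move=> cl c4; have [lam [bm lamE]] := curve_exists; exists lam; split => //.
  exact: curve_limit.
move=> a b a0 ab b1; have [_ mono] := qc_mono cl c4.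
have [k1 k10 E1] := alpha_surj a0 (lt_trans ab b1).
have [k2 k20 E2] := alpha_surj (lt_trans a0 ab) b1.
by rewrite E1 E2 !lamE // mono // alpha_le // -E1 -E2.
Qed.

Lemma qc_surj lambda : 0 < lambda -> lambda < l -> exists2 k, 0 < k & qc k = lambda.
Proof.
move=> lam0 laml; have [T0 /(_ T0 (lexx _))[_ _ h1]] := early lam0.
have [S HS] := prof_cvg (e := l - lambda) ltac:(by rewrite subr_gt0).
pose S' := Num.max S T0; have S1 : S <= S' by rewrite le_max lexx.
have S2 : T0 <= S' by rewrite le_max lexx orbT.
have [_ h2] := HS S' S1.
have [|||t [_ _ <-]] := @IVTc _ (fun t => expR (2 * xo t)) T0 S' lambda S2.
- move=> t _ _; have [dx _] := prof_orbit prof t.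
  have : dd t (fun t => expR (2 * xo t)) (expR (2 * xo t) * (2 * yo t)).
    by dby; rewrite /=; ring.
  exact: dd_cont.
- exact: ltW.
- by move: h2; rewrite ltr_norml => /andP[]; lra.
by exists (expR t); rewrite ?expR_gt0 // qc_xo.
Qed.
End Types.

(** * Rupture profiles *)

Section RuptureOde.
Context {R : realType}.
Variables (n : nat) (d : R).
Hypotheses (n0 : (0 < n)%N) (d0 : 0 < d) (dn : 0 < n.+1%:R - 2 * d).
Let NN : R := n.+1%:R.
Local Notation l := (NN - 1 - d).
Local Notation c := (NN - 2 * d).
Let NN2 : 2 <= NN. Proof. by rewrite /NN ler_nat. Qed.
Let NN0 : 0 < NN. Proof. by rewrite /NN ltr0n. Qed.
Let nN : n%:R = NN - 1 :> R. Proof. by rewrite /NN -natr1 addrK. Qed.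
Let l0 : 0 < l. Proof. exact: l_gt0. Qed.

Variables (lambda : R) (V V' : R -> R).
Hypotheses (lam0 : 0 < lambda)
  (dV : forall r : R, 0 < r -> r < 1 -> dd r V (V' r))
  (dV' : forall r : R, 0 < r -> r < 1 ->
    dd r V' (- (n%:R / r * V' r) + (lambda + d * V' r ^+ 2) / V r))
  (Vpos : forall r : R, 0 < r -> r < 1 -> 0 < V r)
  (V0 : tends0 V).

Implicit Types (r s t e A rho : R).

Let Pv (r : R) : R := r ^+ n * V' r.

Let dPv r : 0 < r -> r < 1 -> dd r Pv (r ^+ n * ((lambda + d * V' r ^+ 2) / V r)).
Proof.
move=> r0 r1; have h := dV' r0 r1.
have sn1 : r ^+ n.-1 != 0 by rewrite expf_neq0 // gt_eqF.
rewrite /Pv; dby; rewrite /= -(prednK n0) /= exprS.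
by move: (_ / V r) => Q; field; rewrite gt_eqF.
Qed.

(** The flux is increasing, so V' r <= 0 would make [V] nonincreasing up to [r], against V -> 0 at
    the origin and V r > 0. *)
Lemma rupture_V'_gt0 r : 0 < r -> r < 1 -> 0 < V' r.
Proof.
move=> r0 r1; rewrite -(pmulr_rgt0 _ (exprn_gt0 n r0)) ltNge; apply/negP => Pr.
have neg s : 0 < s -> s <= r -> V' s <= 0.
  move=> s0; rewrite le_eqVlt => /predU1P[->|sr].
    by move: Pr; rewrite pmulr_rle0 // exprn_gt0.
  have : Pv s < Pv r.
    apply: (@dd_incr _ Pv (fun r => r ^+ n * ((lambda + d * V' r ^+ 2) / V r)) _ _ sr).
      by move=> x x1 x2; apply: dPv; lra.
    move=> x x1 x2; have x0 : 0 < x by lra.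
    have lp : 0 < lambda + d * V' x ^+ 2 by rewrite ltr_wpDr // mulr_ge0 ?sqr_ge0 // ltW.
    by rewrite mulr_gt0 ?exprn_gt0 // divr_gt0 // Vpos //; lra.
  move=> h; have {h} : Pv s < 0 by apply: lt_le_trans h Pr.
  by rewrite /Pv pmulr_rlt0 ?exprn_gt0 // => /ltW.
have [q q0 Hq] := V0 (e := V r / 2) ltac:(by rewrite divr_gt0 // Vpos).
pose h := Num.min (q / 2) (r / 2).
have h0 : 0 < h by rewrite lt_min !divr_gt0.
have hq : h <= q / 2 by rewrite ge_min lexx.
have hs : h <= r / 2 by rewrite ge_min lexx orbT.
have hr : h <= r by lra.
have : V r <= V h.
  apply: (@dd_nincr _ V V' _ _ hr) => x x1 x2; first by apply: dV; lra.
  by apply: neg; lra.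
have := Hq h h0 ltac:(lra); rewrite ler_norml => /andP[_ h2] h3.
by have := Vpos r0 r1; lra.
Qed.

(** The derivative of r^n V V' - lambda r^(n+1) / N is (1 + d) r^n V'^2. Integrated once more this
    gives e^(2 x) <= N, an upper bound on [x] available before the Pohozaev bound. *)
Lemma rupture_VV' r : 0 < r -> r < 1 -> lambda * r / NN <= V r * V' r.
Proof.
move=> r0 r1.
have H : 0 <= Pv r * V r - lambda * r ^+ n.+1 / NN.
  apply: (@ge0_from0 _ (fun r => Pv r * V r - lambda * r ^+ n.+1 / NN)
     (fun r => (1 + d) * r ^+ n * V' r ^+ 2) 1) => // [s s0 s1|s s0 s1|e q e0 q0].
  - have h1 := dPv s0 s1; have h2 := dV s0 s1; dby; rewrite /= -/NN /Pv.
    by field; rewrite !gt_eqF ?Vpos.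
  - by rewrite mulr_ge0 ?sqr_ge0 // mulr_ge0 ?exprn_ge0 ?addr_ge0 // ltW.
  - pose s := Num.min (Num.min (q / 2) (1 / 2)) (e * NN / lambda).
    have s0 : 0 < s by rewrite !lt_min !divr_gt0 // mulr_gt0.
    have s1 : s <= q / 2 by rewrite !ge_min lexx.
    have s2 : s <= 1 / 2 by rewrite !ge_min lexx orbT.
    have s3 : s <= e * NN / lambda by rewrite !ge_min lexx orbT.
    exists s; split => //; first lra.
    have : 0 <= Pv s * V s.
      rewrite mulr_ge0 ?mulr_ge0 ?exprn_ge0 ?(ltW s0) //; apply: ltW.
        by apply: rupture_V'_gt0 => //; lra.
      by apply: Vpos => //; lra.
    have : lambda * s ^+ n.+1 / NN <= e.
      rewrite ler_pdivrMr //; apply: (@le_trans _ _ (lambda * s)).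
        rewrite ler_pM2l // exprS ler_piMr ?(ltW s0) //; apply: exprn_ile1; lra.
      by rewrite mulrC -ler_pdivlMr.
    by move: (lambda * s ^+ n.+1 / NN) (Pv s * V s) => u v h1 h2; lra.
have rn : 0 < r ^+ n by rewrite exprn_gt0.
rewrite -(ler_pM2l rn); move: H; rewrite /Pv exprS.
have -> : lambda * (r * r ^+ n) / NN = r ^+ n * (lambda * r / NN) by ring.
by move: (r ^+ n * (lambda * r / NN)) => u; lra.
Qed.

Lemma rupture_V2 r : 0 < r -> r < 1 -> lambda * r ^+ 2 / NN <= V r ^+ 2.
Proof.
move=> r0 r1; rewrite -subr_ge0.
apply: (@ge0_from0 _ (fun r => V r ^+ 2 - lambda * r ^+ 2 / NN)
     (fun r => 2 * (V r * V' r - lambda * r / NN)) 1) => // [s s0 s1|s s0 s1|e q e0 q0].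
- by have h2 := dV s0 s1; dby; rewrite /=; field; rewrite gt_eqF.
- by rewrite mulr_ge0 // subr_ge0 rupture_VV'.
- pose s := Num.min (Num.min (q / 2) (1 / 2)) (e * NN / lambda).
  have s0 : 0 < s by rewrite !lt_min !divr_gt0 // mulr_gt0.
  have s1 : s <= q / 2 by rewrite !ge_min lexx.
  have s2 : s <= 1 / 2 by rewrite !ge_min lexx orbT.
  have s3 : s <= e * NN / lambda by rewrite !ge_min lexx orbT.
  exists s; split => //; first lra.
  have : 0 <= V s ^+ 2 by exact: sqr_ge0.
  have : lambda * s ^+ 2 / NN <= e.
    rewrite ler_pdivrMr //; apply: (@le_trans _ _ (lambda * s)).
      rewrite ler_pM2l // expr2 ler_piMr ?(ltW s0) //; lra.
    by rewrite mulrC -ler_pdivlMr.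
  by move: (lambda * s ^+ 2 / NN) (V s ^+ 2) => u v h1 h2; lra.
Qed.

Let L (r : R) : R := ln (V r).
Let L' (r : R) : R := V' r / V r.
Let x (t : R) : R := t + ln lambda / 2 - L (expR t).
Let y (t : R) : R := 1 - expR t * L' (expR t).
Let et1 t : t < 0 -> expR t < 1. Proof. by rewrite -expR0 ltr_expR. Qed.

Let orb t : t < 0 -> orbit c (1 - d) l x y t.
Proof.
move=> t0; apply: lsol_orbit => //; have r1 := et1 t0; have r0 := expR_gt0 t.
move: (expR t) r0 r1 => r r0 r1; have Vr := Vpos r0 r1.
have h1 := dV r0 r1; have h2 := dV' r0 r1; split.
  by rewrite /L; dby; rewrite /L'.
have E2 : expR (- (2 * L r)) = V r ^- 2 by rewrite expRN expRM_natl /L lnK.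
rewrite {1}/L'; dby; rewrite ?gt_eqF //= E2 -nN /L'; field.
by rewrite !gt_eqF.
Qed.

Let qE t : t < 0 -> expR (2 * x t) = lambda * expR t ^+ 2 / V (expR t) ^+ 2.
Proof.
move=> t0; have Vr := Vpos (expR_gt0 t) (et1 t0).
have -> : 2 * x t = ln lambda + (2 * t - 2 * L (expR t)) by rewrite /x; field.
by rewrite expRD lnK ?posrE // expRB -mulrA !expRM_natl /L lnK.
Qed.

Let qN t : t < 0 -> expR (2 * x t) <= NN.
Proof.
move=> t0; have Vr := Vpos (expR_gt0 t) (et1 t0).
rewrite qE // ler_pdivrMr ?exprn_gt0 // (mulrC NN) -ler_pdivrMr //.
by rewrite rupture_V2 ?expR_gt0 ?et1.
Qed.

Let p0 t : t < 0 -> 0 < 1 - y t.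
Proof.
move=> t0; rewrite /y subKr mulr_gt0 ?expR_gt0 // divr_gt0 ?Vpos ?expR_gt0 ?et1 //.
by rewrite rupture_V'_gt0 ?expR_gt0 ?et1.
Qed.

(** If r V' / V were at least 2 near the origin, V / r^2 would be nondecreasing and V = O(r^2),
    against the linear lower bound [rupture_V2]. *)
Lemma rupture_p_small rho : 0 < rho -> exists r, [/\ 0 < r, r < rho, r < 1 & r * L' r < 2].
Proof.
move=> rho0; apply: contrapT => no.
pose m := Num.min (rho / 2) (1 / 2).
have m0 : 0 < m by rewrite lt_min !divr_gt0.
have m1 : m <= rho / 2 by rewrite ge_min lexx.
have m2 : m <= 1 / 2 by rewrite ge_min lexx orbT.
have big s : 0 < s -> s <= m -> 2 * V s <= s * V' s.
  move=> s0 sm; have Vs : 0 < V s by apply: Vpos => //; lra.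
  rewrite leNgt; apply/negP => h; apply: no; exists s; split => //; [lra|lra|].
  by rewrite /L' mulrA ltr_pdivrMr.
pose C := V m / m ^+ 2.
have Vm : 0 < V m by apply: Vpos => //; lra.
have C0 : 0 < C by rewrite divr_gt0 // exprn_gt0.
have up s : 0 < s -> s <= m -> V s <= C * s ^+ 2.
  move=> s0 sm.
  have : V s / s ^+ 2 <= V m / m ^+ 2.
    apply: (@dd_ndecr _ (fun s => V s / s ^+ 2) (fun s => (s * V' s - 2 * V s) / s ^+ 3) _ _ sm).
      move=> z z1 z2; have z0 : 0 < z by lra.
      have h : dd z V (V' z) by apply: dV => //; lra.
      have z2' : z ^+ 2 != 0 by rewrite expf_neq0 // gt_eqF.
      by dby => //; rewrite /=; field; rewrite gt_eqF.
    move=> z z1 z2; have z0 : 0 < z by lra.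
    by rewrite divr_ge0 ?exprn_ge0 ?(ltW z0) // subr_ge0 big.
  by rewrite ler_pdivrMr ?exprn_gt0.
pose k := lambda / NN / C ^+ 2.
have k0 : 0 < k by rewrite !divr_gt0 // exprn_gt0.
pose s := Num.min m (k / 2).
have s0 : 0 < s by rewrite lt_min m0 divr_gt0.
have s1 : s <= m by rewrite ge_min lexx.
have s2 : s <= k / 2 by rewrite ge_min lexx orbT.
have h1 := up s s0 s1.
have h2 : lambda * s ^+ 2 / NN <= V s ^+ 2 by apply: rupture_V2 => //; lra.
have Vs : 0 < V s by apply: Vpos => //; lra.
have h3 : V s ^+ 2 <= (C * s ^+ 2) ^+ 2.
  apply: lerXn2r; rewrite ?nnegrE ?(ltW Vs) //.
  by rewrite mulr_ge0 ?exprn_ge0 ?(ltW C0) ?(ltW s0).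
have h4 : lambda / NN <= C ^+ 2 * s ^+ 2.
  have ss : 0 < s ^+ 2 by rewrite exprn_gt0.
  rewrite -(ler_pM2r ss); move: (le_trans h2 h3).
  have -> : (C * s ^+ 2) ^+ 2 = C ^+ 2 * s ^+ 2 * s ^+ 2 by ring.
  by have -> : lambda * s ^+ 2 / NN = lambda / NN * s ^+ 2 by ring.
have h5 : k <= s ^+ 2 by rewrite /k ler_pdivrMr ?exprn_gt0 // (mulrC (s ^+ 2)).
have s_1 : s <= 1 by lra.
have : s ^+ 2 <= s by rewrite expr2 ler_piMr ?(ltW s0).
lra.
Qed.

Lemma rupture_collapse A : exists2 t0, t0 < 0 & forall t, t <= t0 -> L (expR t) <= A.
Proof.
have [r r0 Hr] := V0 (expR_gt0 A).
exists (Num.min (-1) (ln (r / 2))); first by rewrite gt_min; apply/orP; left; lra.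
move=> t; rewrite le_min => /andP[t1 t2].
have er : expR t < r.
  have : expR t <= r / 2 by rewrite -[leRHS]lnK ?posrE ?divr_gt0 // ler_expR.
  lra.
have Vr : 0 < V (expR t) by apply: Vpos; rewrite ?expR_gt0 // et1 //; lra.
rewrite -ler_expR /L lnK //; have := Hr _ (expR_gt0 t) er.
by rewrite ger0_norm // ltW.
Qed.

(** The Pohozaev weight tends to 0 at the origin. For [1 <= d], [x] is bounded above and c t -> -oo.
    For [d < 1] the exponent is (N - 2) t + (1 - d) (2 L - ln lambda) and L -> -oo, which also
    covers N = 2. *)
Lemma rupture_weight A : exists2 t0, t0 < 0 & forall t, t <= t0 -> c * t + 2 * (d - 1) * x t <= A.
Proof.
case: (leP 1 d) => d1.
  exists (Num.min (-1) ((A - (d - 1) * ln NN) / c)); first by rewrite gt_min; apply/orP; left; lra.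
  move=> t; rewrite le_min => /andP[t1]; rewrite ler_pdivlMr // => t2.
  have := qN (_ : t < 0) => /(_ ltac:(lra)); rewrite -[leRHS]lnK ?posrE // ler_expR => h.
  have d1' : 0 <= d - 1 by lra.
  by have := ler_wpM2l d1' h; lra.
have b0 : 0 < 2 * (1 - d) by lra.
have [t0 t00 H] := rupture_collapse ((A + (1 - d) * ln lambda) / (2 * (1 - d))).
exists t0 => // t tt; have := H t tt; rewrite ler_pdivlMr // => h.
have : 0 <= (NN - 2) * - t by rewrite mulr_ge0 ?subr_ge0 // oppr_ge0; lra.
by rewrite /x; lra.
Qed.

Lemma rupture_F t : t < 0 -> 0 <= pohF NN d x y t.
Proof.
move=> t0; have orbt u : u <= t -> orbit c (1 - d) l x y u by move=> ut; apply: orb; lra.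
suff fr e s : 0 < e -> exists2 u, u < s & - e <= pohM NN d x y u.
  exact: (pohozaev dn orbt fr (lexx t)).
move=> e0.
(* Where 0 < 1 - y < 2, [pohF] is at least [- K], by d (1 - y)^2 <= 4 d and e^(2 x) <= N. *)
pose K := 4 * d + NN; have K0 : 0 < K by rewrite addr_gt0 // mulr_gt0.
have [t1 t10 H1] := rupture_weight (ln (e / K)).
pose s' := Num.min s t1; have s1 : s' <= s by rewrite ge_min lexx.
have s2 : s' <= t1 by rewrite ge_min lexx orbT.
have [r [r0 rs r1 pr]] := rupture_p_small (expR_gt0 s').
pose u := ln r; have us : u < s' by rewrite -ltr_expR lnK.
have u0 : u < 0 by lra.
exists u; first lra.
have p2 : 1 - y u < 2 by rewrite /y subKr lnK.
have pp := p0 u0; have qq := qN u0.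
have F1 : - K <= pohF NN d x y u.
  rewrite /pohF; have : 0 <= NN * (1 - y u) by rewrite mulr_ge0 // ltW.
  have : d * ((1 - y u) * (1 - y u)) <= d * 4.
    by rewrite ler_pM2l //; move: (1 - y u) pp p2 => p *; nra.
  by rewrite /K; lra.
have E1 : expR (c * u + 2 * (d - 1) * x u) <= e / K.
  by rewrite -[leRHS]lnK ?posrE ?divr_gt0 // ler_expR; apply: H1; lra.
have E0 := expR_gt0 (c * u + 2 * (d - 1) * x u).
rewrite /pohM; apply: (@le_trans _ _ (expR (c * u + 2 * (d - 1) * x u) * - K)).
  by rewrite mulrN lerN2 -ler_pdivlMr.
by rewrite ler_pM2l.
Qed.

Lemma rupture_constant t : t < 0 -> x t = xs NN d.
Proof.
move=> t0; pose X (s : R) : R := x (- s); pose Y (s : R) : R := - y (- s).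
have T0 : 0 < - t by rewrite oppr_gt0.
have dm (s : R) : dd s (fun s : R => - s) (-1) by dby.
have orbX s : - t <= s -> orbit (- c) (1 - d) l X Y s.
  move=> ts; have [h1' h2'] : orbit c (1 - d) l x y (- s) by apply: orb; lra.
  have g1 : dd s (fun s => x (- s)) _ := dcomp (g := fun s => - s) h1' (dm s).
  have g2 : dd s (fun s => y (- s)) _ := dcomp (g := fun s => - s) h2' (dm s).
  split; first by rewrite /X; apply: dval g1 _; rewrite /Y mulrN1.
  by rewrite /Y; dby; rewrite /= /X /Y; ring.
have FX s : - t <= s -> 0 <= pohF NN d X (fun s => - Y s) s.
  move=> ts; have -> : pohF NN d X (fun s => - Y s) s = pohF NN d x y (- s).
    by rewrite /pohF /Y opprK.
  by apply: rupture_F; lra.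
have coll A : exists2 S, - t <= S & forall s, S <= s -> A <= s + X s.
  have [t1 t10 H] := rupture_collapse (ln lambda / 2 - A).
  exists (Num.max (- t) (- t1)) => [|s]; first by rewrite le_max lexx.
  rewrite ge_max => /andP[_ s1]; have := H (- s) ltac:(lra).
  by rewrite /X /x; lra.
have := backward_constant NN2 d0 dn orbX FX coll (lexx _).
by rewrite /X opprK.
Qed.

Lemma rupture_linear r : 0 < r -> r < 1 -> V r = Num.sqrt (lambda / l) * r.
Proof.
move=> r0 r1; have lr : ln r < 0 by rewrite ln_lt0 // r0.
have := qE lr; rewrite rupture_constant // (expR_xs NN2 dn) lnK // => E.
have Vr := Vpos r0 r1.
apply: (pexpIrn (ltn0Sn 1)); rewrite ?nnegrE; [exact: ltW|by rewrite mulr_ge0 ?sqrtr_ge0 // ltW|].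
rewrite exprMn sqr_sqrtr; last by rewrite divr_ge0 // ltW.
by rewrite E; field; rewrite !gt_eqF.
Qed.

Lemma rupture_ode_unique :
  (forall e, 0 < e -> exists2 r, 0 < r & forall s, 0 < s -> s < 1 -> 1 - s < r -> `|V s - 1| < e) ->
  lambda = l /\ forall r, 0 < r -> r < 1 -> V r = r.
Proof.
move=> V1; pose k := Num.sqrt (lambda / l).
have k0 : 0 < k by rewrite sqrtr_gt0 divr_gt0.
have k1 : k = 1.
  apply/eqP; rewrite -subr_eq0 -normr_le0; apply/ler_addgt0Pr => e e0; rewrite add0r.
  have [r r0 Hr] := V1 (e / 2) ltac:(by rewrite divr_gt0).
  pose m := Num.min (1 / 2) (Num.min (r / 2) (e / (2 * k))).
  have m0 : 0 < m by rewrite !lt_min !divr_gt0 // mulr_gt0.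
  have m1 : m <= 1 / 2 by rewrite !ge_min lexx.
  have m2 : m <= r / 2 by rewrite !ge_min lexx orbT.
  have m3 : m <= e / (2 * k) by rewrite !ge_min lexx !orbT.
  have s0 : 0 < 1 - m by lra.
  have s1 : 1 - m < 1 by lra.
  have := Hr _ s0 s1 ltac:(lra); rewrite rupture_linear // -/k.
  have : k * m <= e / 2.
    by rewrite mulrC -ler_pdivlMr // -mulrA -invfM.
  have : 0 < k * m by rewrite mulr_gt0.
  by rewrite ltr_norml ler_norml => *; lra.
split.
  have := sqr_sqrtr (_ : 0 <= lambda / l) => /(_ ltac:(by rewrite divr_ge0 // ltW)).
  rewrite -/k k1 expr1n => /esym/eqP; rewrite -subr_eq0 => /eqP E.
  by apply/eqP; rewrite -subr_eq0; apply/eqP; move: E => /(congr1 (fun z => z * l)); rewrite mulrBl mul1r mul0r divfK // gt_eqF.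
by move=> r r0 r1; rewrite rupture_linear // -/k k1 mul1r.
Qed.

End RuptureOde.

(** * Radial functions *)

Section Radial.
Context {R : realType}.
Variable N : nat.
Implicit Types (x y : 'rV[R]_N) (i j : 'I_N) (U : 'rV[R]_N -> R).

(** Directional derivatives become one-variable derivatives at 0, to which the calculus rules
    apply. *)
Lemma is_derive_line U x (v : 'rV[R]_N) (D : R) :
  is_derive x v U D <-> dd (0 : R) (fun h : R => U (h *: v + x)) D.
Proof.
have E : (fun h : R => h^-1 *: ((U \o shift x) (h *: v) - U x)) =
    (fun h => h^-1 *: (((fun h : R => U (h *: v + x)) \o shift 0) (h *: 1) - U (0 *: v + x))).
  by apply/funext => h /=; rewrite addr0 scale0r add0r [_%:A]mulr1.
split=> -[h1 h2].
  by constructor; [exact: ((derivable1P U x v).1 h1)|rewrite -h2 /derive E].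
by constructor; [exact: ((derivable1P U x v).2 h1)|rewrite -h2 /derive E].
Qed.

Lemma partial_line i U x (D : R) : dd (0 : R) (fun h : R => U (h *: basis_vec R i + x)) D ->
  derivable U x (basis_vec R i) /\ partial i U x = D.
Proof. by move=> /is_derive_line[]. Qed.

Lemma line_partial i U x : derivable U x (basis_vec R i) ->
  dd (0 : R) (fun h : R => U (h *: basis_vec R i + x)) (partial i U x).
Proof. by move=> /derivableP/is_derive_line. Qed.

Lemma enorm_ge0 x : 0 <= enorm x. Proof. exact: sqrtr_ge0. Qed.

Lemma enorm_sqr x : enorm x ^+ 2 = \sum_(i < N) x 0 i ^+ 2.
Proof. by rewrite sqr_sqrtr // sumr_ge0 // => i _; rewrite sqr_ge0. Qed.

Lemma coord_le x i : `|x 0 i| <= enorm x.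
Proof.
rewrite -(@ler_pXn2r _ 2) ?nnegrE ?enorm_ge0 // real_normK ?num_real // enorm_sqr.
by rewrite (bigD1 i) //= lerDl sumr_ge0 // => j _; rewrite sqr_ge0.
Qed.

Lemma enorm_eq0 x : (enorm x == 0) = (x == 0).
Proof.
apply/eqP/eqP => [E|->].
  apply/rowP => i; rewrite mxE; apply/eqP; rewrite -normr_le0 -E; exact: coord_le.
by rewrite /enorm big1 ?sqrtr0 // => i _; rewrite mxE expr0n.
Qed.

Lemma enorm_gt0 x : x != 0 -> 0 < enorm x.
Proof. by move=> x0; rewrite lt_neqAle eq_sym enorm_eq0 x0 enorm_ge0. Qed.

Lemma enorm0 : enorm (0 : 'rV[R]_N) = 0. Proof. by apply/eqP; rewrite enorm_eq0. Qed.

Lemma line_coord x i j (h : R) : (h *: basis_vec R j + x) 0 i = x 0 i + (i == j)%:R * h.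
Proof. by rewrite !mxE eqxx /= addrC mulrC. Qed.

Lemma enorm_line x j (h : R) :
  enorm (h *: basis_vec R j + x) ^+ 2 = enorm x ^+ 2 + 2 * h * x 0 j + h ^+ 2.
Proof.
rewrite !enorm_sqr (bigD1 j) //= [in RHS](bigD1 j) //=.
under eq_bigr => i ij do rewrite line_coord (negbTE ij) mul0r addr0.
by rewrite line_coord eqxx mul1r; ring.
Qed.

Lemma enorm_scale i (r : R) : enorm (r *: basis_vec R i) = `|r|.
Proof.
rewrite /enorm (bigD1 i) //= big1 => [|j ij]; rewrite !mxE eqxx /=.
  by rewrite eqxx mulr1 addr0 sqrtr_sqr.
by rewrite (negbTE ij) mulr0 expr0n.
Qed.

Lemma coord_cont i : continuous (fun x => x 0 i).
Proof. exact: coord_continuous. Qed.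

Lemma enorm_cont : continuous (@enorm R N).
Proof.
move=> x; rewrite /enorm.
apply: (@continuous_comp _ _ _ (fun x : 'rV[R]_N => \sum_(i < N) x 0 i ^+ 2) Num.sqrt);
  last exact: sqrt_continuous.
apply: (@continuous_big _ _ _ _ _ _ _ _ (fun i (x : 'rV[R]_N) => x 0 i ^+ 2)) => [|i _ z].
  exact: add_continuous.
apply: (@continuous_comp _ _ _ (fun x : 'rV[R]_N => x 0 i) (fun z : R => z ^+ 2)).
  exact: coord_cont.
exact: exprn_continuous.
Qed.

Lemma cont_nearP U x : {for x, continuous U} <->
  forall e : R, 0 < e -> \forall y \near x, `|U x - U y| < e.
Proof. exact: (@cvgrPdist_lt _ _ _ (nbhs x) (nbhs_filter x) U (U x)). Qed.

Lemma line_nz x j (h : R) : x != 0 -> `|h| < enorm x -> h *: basis_vec R j + x != 0.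
Proof.
move=> x0 hx; suff : 0 < enorm (h *: basis_vec R j + x) ^+ 2.
  by apply: contraTneq => ->; rewrite enorm0 expr0n ltxx.
rewrite enorm_line -(real_normK (num_real h)).
have h1 : - (h * x 0 j) <= `|h| * enorm x.
  by apply: le_trans (ler_norm _) _; rewrite normrN normrM ler_wpM2l // coord_le.
have h2 : 0 < (enorm x - `|h|) ^+ 2 by rewrite exprn_gt0 // subr_gt0.
by rewrite !expr2 in h2 *; lra.
Qed.

Lemma d_enorm x j : x != 0 -> dd (0 : R) (fun h : R => enorm (h *: basis_vec R j + x))
  (x 0 j / enorm x).
Proof.
move=> x0; have e0 := enorm_gt0 x0.
have E (h : R) : enorm (h *: basis_vec R j + x) = Num.sqrt (enorm x ^+ 2 + 2 * h * x 0 j + h ^+ 2).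
  by rewrite -enorm_line sqrtr_sqr ger0_norm ?enorm_ge0.
have D : dd (0 : R) (fun h : R => enorm x ^+ 2 + 2 * h * x 0 j + h ^+ 2) (2 * x 0 j).
  by dby; rewrite /=; ring.
have p0 : 0 < enorm x ^+ 2 + 2 * 0 * x 0 j + 0 ^+ 2 by rewrite mulr0 mul0r expr0n /= !addr0 exprn_gt0.
have D2 := dcomp (f := Num.sqrt) (g := fun h : R => enorm x ^+ 2 + 2 * h * x 0 j + h ^+ 2)
  (is_derive1_sqrt p0) D.
apply: (@eq_ddT _ _ _ _ _ (fun h => esym (E h))); apply: dval D2 _.
rewrite mulr0 mul0r expr0n /= !addr0 sqrtr_sqr ger0_norm ?enorm_ge0 //.
by field; rewrite gt_eqF.
Qed.

Section AwayFromOrigin.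
Variables (u u1 u2 : R -> R).
Hypotheses (du : forall r : R, 0 < r -> dd r u (u1 r))
  (du1 : forall r : R, 0 < r -> dd r u1 (u2 r)).

Let Ur x := u (enorm x).
(** The partial derivatives of u(|x|) are slope(|x|) x_i, so this quotient carries the regularity at
    the origin. *)
Definition slope (r : R) : R := u1 r / r.
Definition slope' (r : R) : R := u2 r / r - u1 r / r ^+ 2.

Lemma d_slope (r : R) : 0 < r -> dd r slope (slope' r).
Proof.
move=> r0; have h := du1 r0; rewrite /slope; dby; first by rewrite gt_eqF.
by rewrite /slope' /=; field; rewrite gt_eqF.
Qed.

Lemma radial_partial x i : x != 0 ->
  derivable Ur x (basis_vec R i) /\ partial i Ur x = slope (enorm x) * x 0 i.
Proof.
move=> x0; apply: partial_line; have e0 := enorm_gt0 x0.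
have D := d_enorm i x0.
have h : dd (enorm (0 *: basis_vec R i + x)) u (u1 (enorm x)).
  by rewrite scale0r add0r; exact: du.
apply: dval (dcomp (g := fun h : R => enorm (h *: basis_vec R i + x)) h D) _.
by rewrite /slope; ring.
Qed.

Lemma radial_partial2 x i j : x != 0 ->
  derivable (partial i Ur) x (basis_vec R j) /\
  partial j (partial i Ur) x = slope' (enorm x) * (x 0 j / enorm x) * x 0 i + slope (enorm x) * (i == j)%:R.
Proof.
move=> x0; apply: partial_line; have e0 := enorm_gt0 x0.
apply: (@eq_dd _ (fun h : R => slope (enorm (h *: basis_vec R j + x)) * (x 0 i + (i == j)%:R * h)) _ _ _ (enorm x)) => //.
  by move=> h; rewrite subr0 => hx; rewrite (radial_partial i (line_nz j x0 hx)).2 line_coord.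
have D := d_enorm j x0.
have h : dd (enorm (0 *: basis_vec R j + x)) slope (slope' (enorm x)).
  by rewrite scale0r add0r; exact: d_slope.
have g : dd (0 : R) (fun h : R => slope (enorm (h *: basis_vec R j + x))) _ :=
  dcomp (g := fun h : R => enorm (h *: basis_vec R j + x)) h D.
by dby; rewrite /= scale0r add0r; ring.
Qed.

Lemma radial_laplacian x : x != 0 ->
  laplacian Ur x = u2 (enorm x) + (N%:R - 1) / enorm x * u1 (enorm x).
Proof.
move=> x0; have e0 := enorm_gt0 x0; rewrite /laplacian.
under eq_bigr => i _ do rewrite (radial_partial2 i i x0).2 eqxx mulr1.
rewrite big_split /= sumr_const card_ord.
have -> : \sum_(i < N) slope' (enorm x) * (x 0 i / enorm x) * x 0 i =
    slope' (enorm x) / enorm x * \sum_(i < N) x 0 i ^+ 2.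
  by rewrite mulr_sumr; apply: eq_bigr => i _; ring.
by rewrite -enorm_sqr /slope /slope' -mulr_natr; field; rewrite gt_eqF.
Qed.

Lemma radial_grad x : x != 0 -> grad_sq Ur x = u1 (enorm x) ^+ 2.
Proof.
move=> x0; have e0 := enorm_gt0 x0; rewrite /grad_sq.
under eq_bigr => i _ do rewrite (radial_partial i x0).2 exprMn.
by rewrite -mulr_sumr -enorm_sqr /slope; field; rewrite gt_eqF.
Qed.

Lemma near_nz x : x != 0 -> \forall y \near x, y != 0.
Proof.
move=> x0; have e0 := enorm_gt0 x0.
have /cvgrPdist_lt/(_ _ e0) := @enorm_cont x; apply: filterS => y.
by apply: contraTneq => ->; rewrite enorm0 subr0 gtr0_norm // ltxx.
Qed.

Lemma near_eq_cont (f g : 'rV[R]_N -> R) x : (\forall y \near x, f y = g y) ->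
  {for x, continuous f} -> {for x, continuous g}.
Proof.
move=> H /cont_nearP C; have E : f x = g x := nbhs_singleton H.
apply/cont_nearP => e e0; have := C e e0.
by apply: filter_app; apply: filterS H => y ->; rewrite E.
Qed.

Hypothesis cu2 : forall r : R, 0 < r -> {for r, continuous u2}.

Lemma comp_enorm_cont (f : R -> R) x : {for enorm x, continuous f} ->
  {for x, continuous (fun y => f (enorm y))}.
Proof. by move=> C; apply: continuous_comp; [exact: enorm_cont|]. Qed.

Lemma radial_C2 x : x != 0 ->
  [/\ {for x, continuous Ur},
     forall i, derivable Ur x (basis_vec R i) /\ {for x, continuous (partial i Ur)}
   & forall i j, derivable (partial i Ur) x (basis_vec R j) /\
       {for x, continuous (partial j (partial i Ur))}].
Proof.
move=> x0; have e0 := enorm_gt0 x0; have ne : enorm x != 0 by rewrite gt_eqF.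
have cs : {for x, continuous (fun y => slope (enorm y))}.
  by apply: comp_enorm_cont; exact: dd_cont (d_slope e0).
split.
- by apply: comp_enorm_cont; exact: dd_cont (du e0).
- move=> i; split; first exact: (radial_partial i x0).1.
  apply: (@near_eq_cont (fun y => slope (enorm y) * y 0 i)).
    by apply: filterS (near_nz x0) => y y0; rewrite (radial_partial i y0).2.
  by apply: continuousM => //; exact: coord_cont.
- move=> i j; split; first exact: (radial_partial2 i j x0).1.
  apply: (@near_eq_cont (fun y => slope' (enorm y) * (y 0 j / enorm y) * y 0 i + slope (enorm y) * (i == j)%:R)).
    by apply: filterS (near_nz x0) => y y0; rewrite (radial_partial2 i j y0).2.
  apply: continuousD; apply: continuousM => //.
    apply: continuousM; last first.
      by apply: continuousM; [exact: coord_cont|apply: continuousV => //; exact: enorm_cont].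
    apply: comp_enorm_cont; apply: continuousB; apply: continuousM.
    + exact: cu2.
    + by apply: continuousV.
    + exact: dd_cont (du1 e0).
    + by apply: continuousV; rewrite ?expf_neq0 //; exact: exprn_continuous.
  exact: coord_cont.
by apply/cont_nearP => e ep; near=> y; rewrite subrr normr0.
Unshelve. all: by end_near.
Qed.
End AwayFromOrigin.
End Radial.

(** * Regularity of a radial function at the origin *)

Section Origin.
Context {R : realType}.
Variable N : nat.
Implicit Types (x y : 'rV[R]_N) (i j : 'I_N).
Variables (u u1 u2 : R -> R) (m : R).
Hypotheses (du : forall r : R, dd r u (u1 r)) (u10 : u1 0 = 0)
  (du1 : forall r : R, 0 < r -> dd r u1 (u2 r))
  (cm1 : forall e : R, 0 < e -> exists2 r, 0 < r & forall s, 0 < s -> s < r -> `|u1 s / s - m| <= e)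
  (cm2 : forall e : R, 0 < e -> exists2 r, 0 < r & forall s, 0 < s -> s < r -> `|u2 s - m| <= e).

Let Ur x := u (enorm x).
Let du' (r : R) (_ : 0 < r) : dd r u (u1 r) := du r.
Local Notation slope := (slope u1).
Local Notation slope' := (slope' u1 u2).

Lemma near0_enorm (e : R) : 0 < e -> \forall y \near (0 : 'rV[R]_N), enorm y < e.
Proof.
move=> e0; have /cont_nearP/(_ e e0) := @enorm_cont R N 0; apply: filterS => y.
by rewrite enorm0 sub0r normrN ger0_norm // enorm_ge0.
Qed.

Lemma origin_partial i :
  derivable Ur 0 (basis_vec R i) /\ partial i Ur 0 = 0.
Proof.
apply: partial_line; apply/dd_eps => e e0.
have /dd_eps/(_ e e0)[r r0 Hr] := du 0.
exists r => // h hr; rewrite add0r scale0r !addr0 /Ur enorm_scale enorm0 mul0r subr0.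
have := Hr `|h|; rewrite normr_id => /(_ hr).
by rewrite u10 mul0r subr0 add0r.
Qed.

Lemma origin_partialE y i : partial i Ur y = slope (enorm y) * y 0 i.
Proof.
have [->|y0] := eqVneq y 0; first by rewrite (origin_partial i).2 mxE mulr0.
by rewrite (radial_partial du' i y0).2.
Qed.

Lemma origin_partial2 i j :
  derivable (partial i Ur) 0 (basis_vec R j) /\
  partial j (partial i Ur) 0 = m * (i == j)%:R.
Proof.
apply: partial_line; apply/dd_eps => e e0.
have [r r0 Hr] := cm1 e0; exists r => // h hr.
rewrite add0r scale0r !addr0 !origin_partialE enorm_scale enorm0.
rewrite [(0 : 'rV[R]_N) 0 i]mxE mulr0 subr0.
have -> : (h *: basis_vec R j) 0 i = (i == j)%:R * h.
  by rewrite -[_ *: _]addr0 line_coord mxE add0r.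
have [->|h0] := eqVneq h 0; first by rewrite !mulr0 subrr normr0 mulr0.
have -> : slope `|h| * ((i == j)%:R * h) - m * (i == j)%:R * h = (slope `|h| - m) * ((i == j)%:R * h) by ring.
rewrite normrM; apply: ler_pM => //; first by apply: Hr; rewrite ?normr_gt0.
by case: (i == j); rewrite ?mul1r // mul0r normr0.
Qed.

Lemma origin_grad : grad_sq Ur 0 = 0.
Proof. by rewrite /grad_sq big1 // => i _; rewrite (origin_partial i).2 expr0n. Qed.

Lemma origin_laplacian : laplacian Ur 0 = N%:R * m.
Proof.
rewrite /laplacian; under eq_bigr => i _ do rewrite (origin_partial2 i i).2 eqxx mulr1.
by rewrite sumr_const card_ord mulr_natl.
Qed.

(** The direction products y_i y_j / r^2 have no limit at the origin, but in the second derivatives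
    they multiply u'' - u' / r, which tends to 0 because both terms tend to [m]. *)
Lemma origin_C2 : [/\ {for 0, continuous Ur},
     forall i, derivable Ur 0 (basis_vec R i) /\ {for 0, continuous (partial i Ur)}
   & forall i j, derivable (partial i Ur) 0 (basis_vec R j) /\
       {for 0, continuous (partial j (partial i Ur))}].
Proof.
split.
- by apply: comp_enorm_cont; rewrite enorm0; exact: dd_cont (du 0).
- move=> i; split; first exact: (origin_partial i).1.
  apply/cont_nearP => e e0; have [r r0 Hr] := cm1 (e := 1) ltr01.
  have k0 : 0 < `|m| + 2 by rewrite ltr_wpDl.
  have s0 : 0 < Num.min r (e / (`|m| + 2)) by rewrite lt_min r0 divr_gt0.
  apply: filterS (near0_enorm s0) => y; rewrite lt_min => /andP[yr ye].
  rewrite (origin_partial i).2 sub0r normrN origin_partialE.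
  have [->|y0] := eqVneq y 0; first by rewrite mxE mulr0 normr0.
  have h := Hr _ (enorm_gt0 y0) yr; rewrite normrM.
  have h1 : `|slope (enorm y)| <= `|m| + 1.
    by rewrite -[slope _](subrK m) (le_trans (ler_normD _ _)) // addrC lerD2l.
  move: ye; rewrite ltr_pdivlMr // mulrC; apply: le_lt_trans.
  apply: ler_pM => //; last exact: coord_le.
  by apply: le_trans h1 _; lra.
- move=> i j; split; first exact: (origin_partial2 i j).1.
  apply/cont_nearP => e e0; have e4 : 0 < e / 4 by rewrite divr_gt0.
  have [r1 r10 H1] := cm1 e4; have [r2 r20 H2] := cm2 e4.
  have s0 : 0 < Num.min r1 r2 by rewrite lt_min r10.
  apply: filterS (near0_enorm s0) => y; rewrite lt_min => /andP[yr1 yr2].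
  rewrite (origin_partial2 i j).2.
  have [->|y0] := eqVneq y 0; first by rewrite (origin_partial2 i j).2 subrr normr0.
  rewrite (radial_partial2 du' du1 i j y0).2.
  have ey := enorm_gt0 y0; have h1 := H1 _ ey yr1; have h2 := H2 _ ey yr2.
  set r := enorm y in ey h1 h2 *.
  pose a := y 0 i / r; pose b := y 0 j / r.
  have le1 k : `|y 0 k / r| <= 1.
    by rewrite normrM normfV (gtr0_norm ey) ler_pdivrMr // mul1r coord_le.
  have ab : `|a * b| <= 1 by rewrite normrM mulr_ile1 ?normr_ge0 ?le1.
  have -> : m * (i == j)%:R - (slope' r * (y 0 j / r) * y 0 i + slope r * (i == j)%:R) =
     (u1 r / r - m) * (a * b - (i == j)%:R) + - ((u2 r - m) * (a * b)).
    by rewrite /slope' /slope /slope' /slope /a /b; field; rewrite gt_eqF.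
  apply: (@le_lt_trans _ _ (e / 4 * 2 + e / 4 * 1)); last lra.
  apply: le_trans (ler_normD _ _) _; rewrite normrN; apply: lerD.
    rewrite normrM; apply: ler_pM => //; apply: le_trans (ler_normB _ _) _.
    have : `|(i == j)%:R : R| <= 1 by case: (i == j); rewrite ?normr1 ?normr0.
    lra.
  by rewrite normrM; apply: ler_pM.
Qed.
End Origin.

(** * From the partial differential equation to the equation along a ray *)

Section Ray.
Context {R : realType}.
Variable n : nat.
Local Notation N := n.+1.
Implicit Types (x y : 'rV[R]_N).
Let e0 : 'rV[R]_N := basis_vec R ord0.
Variables (delta lambda : R) (U : 'rV[R]_N -> R).
Hypothesis rad : radial U.

Lemma enorm_e0 (r : R) : enorm (r *: e0) = `|r|. Proof. exact: enorm_scale. Qed.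

Lemma radial_ray x : ecball x -> U x = U (enorm x *: e0).
Proof.
move=> x1; have [u Hu] := rad; rewrite !Hu //; last first.
  by rewrite /ecball /= enorm_e0 ger0_norm ?enorm_ge0.
by rewrite enorm_e0 ger0_norm ?enorm_ge0.
Qed.

Lemma dd_ray (f : 'rV[R]_N -> R) (r : R) : derivable f (r *: e0) e0 ->
  dd r (fun s : R => f (s *: e0)) (partial ord0 f (r *: e0)).
Proof.
move=> /line_partial h.
have D : dd r (fun s : R => s - r) 1 by dby; rewrite /=; ring.
have h' : dd (r - r) (fun h : R => f (h *: e0 + r *: e0)) (partial ord0 f (r *: e0)).
  by rewrite subrr.
apply: (@eq_ddT _ (fun s : R => f ((s - r) *: e0 + r *: e0))).
  by move=> s; rewrite -scalerDl subrK.
by apply: dval (dcomp (g := fun s : R => s - r) h' D) _; rewrite mulr1.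
Qed.

Let v (r : R) : R := U (r *: e0).
Let v1 (r : R) : R := partial ord0 U (r *: e0).
Let v2 (r : R) : R := partial ord0 (partial ord0 U) (r *: e0).

Variable A : set 'rV[R]_N.
Hypotheses (HA : forall x, 0 < enorm x < 1 -> A x) (sol : classical_on delta lambda A U).

Let Ar (r : R) : 0 < r < 1 -> A (r *: e0).
Proof. by move=> /[dup] h /andP[r0 _]; apply: HA; rewrite enorm_e0 gtr0_norm. Qed.

Lemma ray_dd (r : R) : 0 < r < 1 -> dd r v (v1 r) /\ dd r v1 (v2 r).
Proof.
move=> r01; have [C _] := sol; have [_ [D1 D2]] := C _ (Ar r01).
by split; [exact: dd_ray (D1 ord0).1|exact: dd_ray (D2 ord0 ord0).1].
Qed.

(** On the line through r e_0 in direction e_j, radiality gives U = v(q(s)) with q(s)^2 = r^2 + s^2.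
    Differentiating this twice at s = 0 yields the term v' / r of the radial Laplacian, using only
    the differentiability of [U] along the first axis. *)
Lemma ray_transverse (j : 'I_N) (r : R) : j != ord0 -> 0 < r < 1 ->
  partial j U (r *: e0) = 0 /\ partial j (partial j U) (r *: e0) = v1 r / r.
Proof.
move=> j0 /[dup] r01 /andP[r0 r1].
have x0 : r *: e0 != 0 by rewrite -enorm_eq0 enorm_e0 gtr0_norm // gt_eqF.
have re : enorm (r *: e0) = r by rewrite enorm_e0 gtr0_norm.
have xj : (r *: e0) 0 j = 0.
  by rewrite !mxE eqxx /= (negbTE j0) mulr0.
pose q (s : R) := enorm (s *: basis_vec R j + r *: e0).
have qE (s : R) : q s ^+ 2 = r ^+ 2 + s ^+ 2 by rewrite /q enorm_line re xj mulr0 addr0.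
have q0 : q 0 = r by rewrite /q scale0r add0r re.
(* Keeps the transverse segment inside the ball: r^2 + s^2 < r + (1 - r) / 2 < 1. *)
pose eta := Num.min (r / 2) ((1 - r) / 2).
have eta0 : 0 < eta by rewrite lt_min !divr_gt0 // subr_gt0.
have eta1 : eta <= r / 2 by rewrite ge_min lexx.
have eta2 : eta <= (1 - r) / 2 by rewrite ge_min lexx orbT.
have qnn (s : R) : 0 <= q s by exact: enorm_ge0.
have q01 (s : R) : `|s| < eta -> 0 < q s < 1.
  move=> se; have s2 : s ^+ 2 < eta ^+ 2.
    by rewrite -(real_normK (num_real s)) ltr_pXn2r // nnegrE ?(ltW eta0).
  have s3 : 0 <= s ^+ 2 by exact: sqr_ge0.
  have E := qE s; apply/andP; split.
    rewrite lt_neqAle qnn andbT; apply/eqP => E0; move: E; rewrite -E0 expr0n /=.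
    have : 0 < r ^+ 2 by rewrite exprn_gt0.
    lra.
  rewrite -(@ltr_pXn2r _ 2) ?nnegrE // E expr1n.
  have : eta ^+ 2 <= eta * 1 by rewrite expr2 ler_pM2l //; lra.
  have : r ^+ 2 <= r * 1 by rewrite expr2 ler_pM2l // ltW.
  lra.
have Uq (s : R) : `|s| < eta -> U (s *: basis_vec R j + r *: e0) = v (q s).
  by move=> /q01/andP[_ h]; rewrite radial_ray // /ecball /= ltW.
(* the transverse derivative along the whole segment, not only at its centre *)
have dq (s : R) : `|s| < eta -> dd s q (s / q s).
  move=> se; have /andP[qp _] := q01 s se; rewrite /q.
  have sx0 : s *: basis_vec R j + r *: e0 != 0 by rewrite -enorm_eq0 gt_eqF.
  have h := d_enorm j sx0.
  have D : dd s (fun t : R => t - s) 1 by dby; rewrite /=; ring.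
  have h' : dd (s - s) (fun h : R => enorm (h *: basis_vec R j + (s *: basis_vec R j + r *: e0))) (s / q s).
    by rewrite subrr; apply: dval h _; rewrite line_coord xj eqxx mul1r add0r.
  apply: (@eq_ddT _ (fun t : R => enorm ((t - s) *: basis_vec R j + (s *: basis_vec R j + r *: e0)))).
    by move=> t; rewrite addrA -scalerDl subrK.
  by apply: dval (dcomp (g := fun t : R => t - s) h' D) _; rewrite mulr1.
have pj (s : R) : `|s| < eta -> partial j U (s *: basis_vec R j + r *: e0) = v1 (q s) * (s / q s).
  move=> se; apply: (proj2 (partial_line _)).
  have e1 : 0 < eta - `|s| by rewrite subr_gt0.
  apply: (@eq_dd _ (fun h => v (q (h + s))) _ _ _ (eta - `|s|)) => // [h|].
    rewrite subr0 => hs; rewrite addrA -scalerDl Uq //.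
    by rewrite (le_lt_trans (ler_normD _ _)) // -ltrBrDr.
  have D : dd (0 : R) (fun h : R => h + s) 1 by dby; rewrite /=; ring.
  have g1 : dd (0 + s) (fun t => v (q t)) (v1 (q s) * (s / q s)).
    rewrite add0r; have [h _] := ray_dd (q01 s se).
    exact: (dcomp (g := q) h (dq s se)).
  by apply: dval (dcomp (g := fun h : R => h + s) g1 D) _; rewrite mulr1.
have n0 : `|0 : R| < eta by rewrite normr0.
split.
  by have := pj 0 n0; rewrite scale0r add0r mul0r mulr0.
apply: (proj2 (partial_line _)).
apply: (@eq_dd _ (fun s => v1 (q s) * (s / q s)) _ _ _ eta) => // [s|].
  by rewrite subr0 => se; rewrite pj.
have [_ h] := ray_dd (q01 0 n0); have dq0 := dq 0 n0.
have g1 : dd (0 : R) (fun s => v1 (q s)) _ := dcomp (g := q) h dq0.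
dby; first by rewrite q0 gt_eqF.
by rewrite /= q0; field; rewrite gt_eqF.
Qed.

Lemma ray_equation (r : R) : 0 < r < 1 ->
  v2 r = - (n%:R / r * v1 r) - (lambda + delta * v1 r ^+ 2) / (1 - v r).
Proof.
move=> r01; have [_ /(_ _ (Ar r01))] := sol.
have jne (j : 'I_n) : lift ord0 j != ord0 :> 'I_N by [].
have -> : grad_sq U (r *: e0) = v1 r ^+ 2.
  rewrite /grad_sq big_ord_recl big1 ?addr0 // => j _.
  by rewrite (ray_transverse (jne j) r01).1 expr0n.
have -> : laplacian U (r *: e0) = v2 r + n%:R * (v1 r / r).
  rewrite /laplacian big_ord_recl; congr (_ + _).
  under eq_bigr => j _ do rewrite (ray_transverse (jne j) r01).2.
  by rewrite sumr_const card_ord mulr_natl.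
by rewrite -/(v r) => <-; ring.
Qed.
End Ray.

(** * Radial solutions in the ball *)

Lemma at_right_eps (R : realType) (f : R -> R) (m : R) :
  f s @[s --> (0 : R)^'+] --> m <->
  forall e : R, 0 < e -> exists2 r : R, 0 < r & forall s, 0 < s -> s < r -> `|f s - m| <= e.
Proof.
split=> [/cvgrPdist_le H e e0|H].
  have := H e e0; rewrite near_withinE => /near_eps[r r0 Hr]; exists r => // s s0 sr.
  by have := Hr s; rewrite subr0 gtr0_norm // distrC; apply.
apply/cvgrPdist_le => e e0; have [r r0 Hr] := H e e0.
rewrite near_withinE; apply/near_eps; exists r => // s; rewrite subr0 => sr s0.
by rewrite distrC; apply: Hr => //; rewrite -(gtr0_norm s0).
Qed.

Lemma within_of_eps (R : realType) (f : R -> R) (a b : R) :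
  (forall x e, a <= x -> x <= b -> 0 < e -> exists2 r : R, 0 < r & forall y, a <= y -> y <= b -> `|y - x| < r ->
    `|f y - f x| < e) -> {within `[a, b], continuous f}.
Proof.
move=> H; apply/subspace_continuousP => x; rewrite /= in_itv /= => /andP[ax xb].
apply/cvgrPdist_lt => e e0; have [r r0 Hr] := H x e ax xb e0.
rewrite near_withinE; apply/near_eps; exists r => // y yr; rewrite /= in_itv /= => /andP[ay yb].
by rewrite distrC; apply: Hr.
Qed.

Section Regular.
Context {R : realType}.
Variables (n : nat) (d : R).
Hypotheses (n0 : (0 < n)%N) (d0 : 0 < d) (dn : 0 < n.+1%:R - 2 * d).
Let NN : R := n.+1%:R.
Variables (L L' : R -> R).
Hypothesis prof : is_profile NN d L L'.
Local Notation W := (W L).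
Local Notation qc := (qc L).
Local Notation uc := (uc L).
Local Notation uc1 := (uc1 L L').
Local Notation uc2 := (uc2 n d L L').
Let NN0 : 0 < NN. Proof. by rewrite /NN ltr0n. Qed.
Let nN : n%:R = NN - 1 :> R. Proof. by rewrite /NN -natr1 addrK. Qed.
Let dL (s : R) : dd s L (L' s). Proof. by have [_ /(_ s)[]] := prof. Qed.

Section AtZero.
Variable k : R.
Hypothesis k0 : 0 < k.
(** The common limit of u' / r and u'' at the centre, where the equation reads N m + lambda / (1 -
    u(0)) = 0. *)
Let m : R := - (k ^+ 2 / W k / NN).

Lemma uc_right : uc k s @[s --> (0 : R)^'+] --> uc k 0.
Proof. by apply: cvg_at_right_filter; exact: dd_cont (d_uc prof k 0). Qed.

Lemma uc1_slope : uc1 k s / s @[s --> (0 : R)^'+] --> m.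
Proof.
have c1 : L' (k * s) / (k * s) @[s --> (0 : R)^'+] --> NN^-1.
  apply/at_right_eps => e e0; have [_ _ _ /(_ e e0)[r r0 Hr] _] := prof.
  exists (r / k) => [|s s0 sr]; first by rewrite divr_gt0.
  by apply: Hr; rewrite ?mulr_gt0 // mulrC -ltr_pdivlMr.
have c2 : W (k * s) / W k @[s --> (0 : R)^'+] --> 1 / W k.
  have dk : dd (0 : R) (fun r : R => k * r) k by dby; rewrite /=; ring.
  have dW : dd (k * 0) W _ := dexp (dL _).
  have h : dd (0 : R) (fun s : R => W (k * s)) _ := dcomp (g := fun s : R => k * s) dW dk.
  have -> : 1 / W k = W (k * 0) / W k by rewrite mulr0 (W0 prof).
  apply: cvg_at_right_filter; exact: (dd_cont (dM h (dcst (W k)^-1 0))).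
have -> : m = - (k ^+ 2 * NN^-1 * (1 / W k)) by rewrite /m; ring.
have c3 : - (k ^+ 2 * (L' (k * s) / (k * s)) * (W (k * s) / W k)) @[s --> (0 : R)^'+] -->
    - (k ^+ 2 * NN^-1 * (1 / W k)).
  by apply: cvgN; apply: cvgM => //; apply: cvgM => //; exact: cvg_cst.
apply/at_right_eps => e e0; have [r r0 Hr] := (at_right_eps _ _).1 c3 e e0.
exists r => // s s0 sr; have := Hr s s0 sr.
suff -> : uc1 k s / s = - (k ^+ 2 * (L' (k * s) / (k * s)) * (W (k * s) / W k)) by [].
by rewrite /uc1; move: (_ / W k) => w; field; rewrite !gt_eqF.
Qed.

Lemma uc2_right : uc2 k s @[s --> (0 : R)^'+] --> m.
Proof.
have c1 := uc1_slope; have c2 := uc_right.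
have c3 : s @[s --> (0 : R)^'+] --> (0 : R).
  by apply: cvg_at_right_filter; exact: cvg_id.
have c4 : uc1 k s / s * s @[s --> (0 : R)^'+] --> m * 0 by exact: cvgM.
have u0 : 1 - uc k 0 = (W k)^-1 by rewrite /uc mulr0 (W0 prof) subKr div1r.
have ne : 1 - uc k 0 != 0 by rewrite u0 invr_eq0 W_neq0.
have c5 : - (n%:R * (uc1 k s / s)) - (qc k + d * (uc1 k s / s * s * (uc1 k s / s * s))) / (1 - uc k s)
    @[s --> (0 : R)^'+] --> - (n%:R * m) - (qc k + d * (m * 0 * (m * 0))) / (1 - uc k 0).
  apply: cvgB; first by apply: cvgN; apply: cvgM => //; exact: cvg_cst.
  apply: cvgM; last by apply: cvgV => //; apply: cvgB => //; exact: cvg_cst.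
  apply: cvgD; first exact: cvg_cst.
  by apply: cvgM; [exact: cvg_cst|exact: cvgM].
have E : - (n%:R * m) - (qc k + d * (m * 0 * (m * 0))) / (1 - uc k 0) = m.
  rewrite u0 /m nN /qc; have w := W_neq0 L k.
  move: (W k) w NN (lt0r_neq0 NN0) => w w0 NN' NN'0.
  by field; rewrite w0 NN'0.
rewrite E in c5.
apply/at_right_eps => e e0; have [r r0 Hr] := (at_right_eps _ _).1 c5 e e0.
exists r => // s s0 sr; have := Hr s s0 sr.
suff -> : uc2 k s = - (n%:R * (uc1 k s / s)) - (qc k + d * (uc1 k s / s * s * (uc1 k s / s * s))) / (1 - uc k s) by [].
have -> : uc1 k s / s * s = uc1 k s by rewrite divfK // gt_eqF.
by rewrite /uc2; ring.
Qed.

Let U (x : 'rV[R]_n.+1) : R := uc k (enorm x).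

Lemma uc_solution : radial_regular_solution d (qc k) U.
Proof.
have uC x : {for x, continuous U}.
  by apply: comp_enorm_cont; exact: dd_cont (d_uc prof k _).
split; first by exists (uc k).
split.
- exact: continuous_subspaceT.
- by move=> x; rewrite /esphere /= /U => ->; rewrite /uc mulr1 divff ?subrr // W_neq0.
- move=> x; rewrite /eball /= /U => x1; apply/andP; split.
    rewrite /uc subr_gt0 ltr_pdivrMr ?W_gt0 // mul1r (W_lt d0 prof) //.
      by rewrite mulr_ge0 ?enorm_ge0 // ltW.
    by rewrite -[ltRHS]mulr1 ltr_pM2l.
  by rewrite -subr_gt0 uc_lt1.
have du (r : R) (r0 : 0 < r) := d_uc1 prof k0 r0.
have du0 (r : R) (_ : 0 < r) : dd r (uc k) (uc1 k r) := d_uc prof k r.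
have u10 : uc1 k 0 = 0.
  by have [[_ h] _ _ _ _] := prof; rewrite /uc1 mulr0 h // mulr0 mul0r oppr0.
have cm1 := (at_right_eps _ _).1 uc1_slope.
have cm2 := (at_right_eps _ _).1 uc2_right.
have cu2 (r : R) : 0 < r -> {for r, continuous (uc2 k)}.
  move=> r0; have h1 := d_uc prof k r; have h2 := du r r0.
  have ne : 1 - uc k r != 0 by rewrite gt_eqF // uc_lt1.
  have rne : r != 0 by rewrite gt_eqF.
  have : exists D, dd r (uc2 k) D.
    by eexists; rewrite /uc2; dsolve => //.
  by move=> [D]; exact: dd_cont.
split=> [x _|x].
  have [->|x0] := eqVneq x 0.
    by have [h1 h2 h3] := @origin_C2 R n.+1 (uc k) (uc1 k) (uc2 k) m (d_uc prof k) u10 du cm1 cm2.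
  by have [h1 h2 h3] := radial_C2 du0 du cu2 x0.
have [-> _|x0 _] := eqVneq x 0.
  rewrite (origin_laplacian n.+1 (d_uc prof k) u10 cm1) (origin_grad n.+1 (d_uc prof k) u10).
  rewrite mulr0 addr0 /U enorm0 /uc mulr0 (W0 prof) subKr div1r /m /qc -/NN.
  have w := W_neq0 L k; move: (W k) w NN (lt0r_neq0 NN0) => w w0 NN' NN'0.
  by field; rewrite w0 NN'0.
rewrite (radial_laplacian du0 du x0) (radial_grad du0 x0) /uc2 -/NN -nN /U.
by ring.
Qed.
End AtZero.
End Regular.

Section RayContinuity.
Context {R : realType}.
Variable n : nat.
Implicit Types (x : 'rV[R]_n.+1) (r e : R).
Local Notation e0 := (basis_vec R (@ord0 n)).
Variable U : 'rV[R]_n.+1 -> R.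
Hypothesis (cU : {within @ecball R n.+1, continuous U}).

Lemma ray_within r e : 0 <= r -> r <= 1 -> 0 < e -> exists2 h, 0 < h &
  forall s, 0 <= s -> s <= 1 -> `|s - r| < h -> `|U (s *: e0) - U (r *: e0)| < e.
Proof.
move=> r0 r1 e0'; have inb s : 0 <= s -> s <= 1 -> ecball (s *: e0).
  by move=> s0 s1; rewrite /ecball /= enorm_scale ger0_norm.
move/subspace_continuousP: cU => /(_ _ (inb r r0 r1)) H.
move/cvgrPdist_lt/(_ e e0'): H; rewrite near_withinE => H2.
have C : {for r, continuous (fun s : R => s *: e0)} by exact: scalel_continuous.
have /near_eps[h h0 Hh] := C _ H2.
by exists h => // s s0 s1 sr; rewrite distrC; apply: (Hh s sr); exact: inb.
Qed.

Lemma ray_within_cont : {within `[(0 : R), 1], continuous (fun r => U (r *: e0))}.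
Proof.
by apply: within_of_eps => x e x0 x1 ep; exact: ray_within.
Qed.
End RayContinuity.

Section BvpOfRegular.
Context {R : realType}.
Variables (n : nat) (d lambda : R) (U : 'rV[R]_n.+1 -> R).
Hypothesis sol : radial_regular_solution d lambda U.
Local Notation e0 := (basis_vec R (@ord0 n)).
Let v (r : R) : R := U (r *: e0).
Let v1 (r : R) : R := partial ord0 U (r *: e0).

Let rad : radial U. Proof. exact: sol.1. Qed.

Let dv (r : R) : 0 < r -> r < 1 -> dd r v (v1 r) /\
  dd r v1 (- (n%:R / r * v1 r) - (lambda + d * v1 r ^+ 2) / (1 - v r)).
Proof.
move=> r0 r1; have r01 : 0 < r < 1 by rewrite r0.
have [_ _ _ cl] := sol.2.
have HA (x : 'rV[R]_n.+1) : 0 < enorm x < 1 -> @eball R n.+1 x by case/andP.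
have [h1 h2] := ray_dd HA cl r01; split=> //.
by apply: dval h2 (ray_equation rad HA cl r01).
Qed.

(** The condition at the origin comes from symmetry: along the axis [v] is even and differentiable
    at 0, so its derivative there vanishes. *)
Lemma regular_ray_bvp : 0 < U 0 < 1 /\ radial_bvp n.+1 d (U 0) lambda v.
Proof.
have [cU U1 Ub cl] := sol.2.
have b0 : @eball R n.+1 0 by rewrite /eball /= enorm0.
split; first exact: Ub.
have v0 : v 0 = U 0 by rewrite /v scale0r.
split=> //.
- exact: ray_within_cont.
- have [C _] := cl; have [_ [D1 _]] := C _ b0.
  have D : dd (0 : R) v (v1 0) by apply: dd_ray; rewrite scale0r; exact: (D1 ord0).1.
  have even (s : R) : `|s| < 1 -> v (- s) = v s.
    move=> s1; have [u Hu] := rad.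
    by rewrite /v !Hu /ecball /= ?enorm_e0 ?normrN // ltW.
  have DN : dd (0 : R) v (- v1 0).
    apply: (@eq_dd _ (fun s : R => v (- s)) _ _ _ 1) => // [s|]; first by rewrite subr0; exact: even.
    have dN' : dd (0 : R) (fun s : R => - s) (-1) by dby.
    have D' : dd (- (0 : R)) v (v1 0) by rewrite oppr0.
    by apply: dval (dcomp (g := fun s : R => - s) D' dN') _; rewrite mulrN1.
  have z : v1 0 = 0.
    have := dd_derive1 D; rewrite (dd_derive1 DN) => h; lra.
  apply/at_right_eps => e ep; move: D; rewrite z => /dd_eps/(_ e ep)[r r0 Hr].
  exists r => // s s0 sr; have := Hr s; rewrite subr0 gtr0_norm // => /(_ sr).
  by rewrite add0r mul0r !subr0 normrM normfV (gtr0_norm s0) ler_pdivrMr.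
- by rewrite /v U1 // /esphere /= enorm_e0 normr1.
- move=> r /andP[r0 r1]; have [h1 h2] := dv r0 r1.
  have m0 : 0 < Num.min r (1 - r) by rewrite lt_min r0 subr_gt0.
  have dd1 : dd r (derive1 v) (- (n%:R / r * v1 r) - (lambda + d * v1 r ^+ 2) / (1 - v r)).
    apply: (@eq_dd _ v1 _ _ _ (Num.min r (1 - r))) h2 => // s.
    rewrite lt_min => /andP[]; rewrite !ltr_norml => /andP[a _] /andP[_ b].
    have s0 : 0 < s by lra. have s1 : s < 1 by lra.
    by apply/esym/dd_derive1; exact: (dv s0 s1).1.
  split; [exact: dd_derivable h1|exact: dd_derivable dd1|].
  by rewrite (dd_derive1 dd1) (dd_derive1 h1) -natr1 addrK; ring.
Qed.
End BvpOfRegular.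

(** * The rupture solution in the ball *)

Section Rupture.
Context {R : realType}.
Variables (n : nat) (d : R).
Hypotheses (n0 : (0 < n)%N) (d0 : 0 < d) (dn : 0 < n.+1%:R - 2 * d).
Local Notation l := (n.+1%:R - 1 - d).
Local Notation e0 := (basis_vec R (@ord0 n)).
Implicit Types x y : 'rV[R]_n.+1.

Lemma Ustar_cont : continuous (@Ustar R n.+1).
Proof.
move=> x; apply: (@comp_enorm_cont _ _ (fun r : R => 1 - r)).
have h : dd (enorm x) (fun r : R => 1 - r) (-1) by dby; rewrite /=; ring.
exact: dd_cont h.
Qed.

Lemma Ustar_rupture : rupture_solution d l (@Ustar R n.+1).
Proof.
split; first by exists (fun r : R => 1 - r).
have du (r : R) : 0 < r -> dd r (fun r : R => 1 - r) ((fun=> -1 : R) r) by move=> _; dby; rewrite /=; ring.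
have du1 (r : R) : 0 < r -> dd r (fun=> -1 : R) ((fun=> 0 : R) r) by move=> _; exact: dcst.
have cu2 (r : R) : 0 < r -> {for r, continuous (fun=> 0 : R)} by move=> _; exact: cvg_cst.
split.
- exact: continuous_subspaceT Ustar_cont.
- by rewrite /Ustar enorm0 subr0.
- by move=> x; rewrite /esphere /= /Ustar => ->; rewrite subrr.
- move=> x [] + /eqP x0; rewrite /eball /= => x1.
  by have := enorm_gt0 x0; rewrite /Ustar; lra.
- split=> x [_ /eqP x0].
    by have [h1 h2 h3] := radial_C2 du du1 cu2 x0.
  have e0 := enorm_gt0 x0.
  rewrite (radial_laplacian du du1 x0) (radial_grad du x0) /Ustar subKr.
  by field; rewrite gt_eqF.
Qed.

Lemma rupture_unique : unique_rupture_solution d l (@Ustar R n.+1).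
Proof.
split=> [|lambda U lam0 [rad [cU U0 U1 Ub cl]]]; first exact: Ustar_rupture.
have HA x : 0 < enorm x < 1 -> (@eball R n.+1 `\ 0) x.
  by move=> /andP[x0 x1]; split=> //= E; rewrite E enorm0 ltxx in x0.
pose V (r : R) : R := 1 - U (r *: e0).
pose V' (r : R) : R := - partial ord0 U (r *: e0).
have dV (r : R) : 0 < r -> r < 1 -> dd r V (V' r).
  move=> r0 r1; have [] := ray_dd HA cl (r := r); first by rewrite r0.
  by move=> h _; rewrite /V; dby; rewrite /V' /=; ring.
have dV' (r : R) : 0 < r -> r < 1 ->
    dd r V' (- (n%:R / r * V' r) + (lambda + d * V' r ^+ 2) / V r).
  move=> r0 r1; have r01 : 0 < r < 1 by rewrite r0.
  have [_ h] := ray_dd HA cl r01; rewrite {1}/V'; dby.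
  by rewrite /= (ray_equation rad HA cl r01) /V' /V sqrrN; ring.
have er (r : R) : 0 < r -> enorm (r *: e0) = r by move=> r0; rewrite enorm_e0 gtr0_norm.
have Vpos (r : R) : 0 < r -> r < 1 -> 0 < V r.
  move=> r0 r1; rewrite subr_gt0.
  by have /andP[] := Ub (r *: e0) (HA (r *: e0) ltac:(by rewrite er // r0)).
have V0 : tends0 V.
  move=> e ep; have [r r0 Hr] := ray_within cU (lexx 0) ler01 ep.
  exists (Num.min r 1) => [|s s0]; first by rewrite lt_min r0 ltr01.
  rewrite lt_min => /andP[sr s1]; have := Hr s (ltW s0) (ltW s1).
  by rewrite subr0 gtr0_norm // => /(_ sr); rewrite scale0r U0 distrC => /ltW.
have V1 (e : R) : 0 < e -> exists2 r : R, 0 < r & forall s : R, 0 < s -> s < 1 -> 1 - s < r -> `|V s - 1| < e.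
  move=> ep; have [r r0 Hr] := ray_within cU ler01 (lexx 1) ep.
  exists r => // s s0 s1 sr; have := Hr s (ltW s0) (ltW s1).
  rewrite distrC gtr0_norm ?subr_gt0 // => /(_ sr).
  rewrite (U1 (1 *: e0)); last by rewrite /esphere /= er.
  by rewrite /V subr0 addrAC subrr add0r normrN.
have [-> E] := rupture_ode_unique n0 d0 dn lam0 dV dV' Vpos V0 V1; split=> // x xb.
rewrite (radial_ray rad xb) /Ustar.
have := enorm_ge0 x; rewrite le_eqVlt => /predU1P[<-|x0]; first by rewrite scale0r U0 subr0.
move: xb; rewrite /ecball /= le_eqVlt => /predU1P[->|x1].
  by rewrite U1 ?subrr // /esphere /= er.
by have := E _ x0 x1; rewrite /V => h; lra.
Qed.

End Rupture.

(** * Counting regular solutions *)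

Lemma seq_below1 (R : realType) (s : seq R) : (forall x, x \in s -> x < 1) ->
  exists2 m, 0 < m < 1 & forall x, x \in s -> x <= m.
Proof.
elim: s => [_|a s IH H]; first by exists (1 / 2) => //; lra.
have [x xs|m /andP[m0 m1] Hm] := IH; first by apply: H; rewrite in_cons xs orbT.
exists (Num.max a m) => [|x]; first by rewrite lt_max m0 orbT gt_max m1 (H a) ?mem_head.
by rewrite in_cons => /predU1P[->|/Hm xm]; rewrite le_max ?lexx // xm orbT.
Qed.

Section Count.
Context {R : realType}.
Variables (n : nat) (d : R).
Hypotheses (n0 : (0 < n)%N) (d0 : 0 < d) (dn : 0 < n.+1%:R - 2 * d).
Variables (L L' : R -> R).
Hypothesis prof : is_profile n.+1%:R d L L'.
Local Notation l := (n.+1%:R - 1 - d).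

Lemma regular_unique lambda :
  8 * l <= (n.+1%:R - 2 * d) ^+ 2 -> 4 < n.+1%:R - 2 * d -> 0 < lambda < l ->
  exactly_one_radial_regular n.+1 d lambda.
Proof.
move=> cl c4 /andP[lam0 laml]; have [k k0 kE] := qc_surj n0 d0 dn prof lam0 laml.
exists (fun x => uc L k (enorm x)); rewrite -kE; split.
  exact: (uc_solution d0 prof k0).
move=> V sol x xb; have [a01 bvp] := regular_ray_bvp sol.
have [k' [k'0 _ E Vr]] := bvp_char n0 d0 prof a01 (qc_gt0 L k0) bvp.
have [_ mono] := qc_mono n0 d0 dn prof cl c4.
have kk : k' = k.
  case: (ltgtP k' k) => // h; first by have := mono _ _ k'0 h; rewrite -E ltxx.
  by have := mono _ _ k0 h; rewrite -E ltxx.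
by rewrite (radial_ray sol.1 xb) (Vr _ (enorm_ge0 x) xb) kk.
Qed.

(** Finitely many solutions would have finitely many central values, bounded by some m < 1; but
    crossings of the equilibrium value occur at arbitrarily late times, where the central value 1 -
    1 / W is close to 1. *)
Lemma regular_infinite :
  (n.+1%:R - 2 * d) ^+ 2 < 8 * l -> infinitely_many_radial_regular n.+1 d l.
Proof.
move=> cl /(finite_image (fun g : 'rV[R]_n.+1 -> R => g 0)) /finite_seqP[s sE].
have b0 : @ecball R n.+1 0 by rewrite /ecball /= enorm0.
have inS (U : 'rV[R]_n.+1 -> R) : radial_regular_solution d l U -> U 0 \in s.
  move=> sol; suff : [set` s] (U 0) by [].
  rewrite -sE; exists (U \_ (@ecball R n.+1)); first by exists U.
  by rewrite patchE mem_set.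
have [x xs|m /andP[m0 m1] Hm] := @seq_below1 R s.
  have : [set` s] x by [].
  rewrite -sE => -[_ [U [_ [_ _ Ub _]] <-] <-].
  have /Ub/andP[_ U1] : @eball R n.+1 0 by rewrite /eball /= enorm0.
  by rewrite patchE mem_set.
(* From this [k] on, the central value is at least (1 + m) / 2, which exceeds m. *)
have [||k k0 kE] := W_surj n0 d0 prof (a := (1 - m) / 2); [lra..|].
have [t kt xt] := prof_zero n0 d0 dn prof (ln k) cl.
have kt' : k <= expR t by rewrite -[k]lnK ?posrE // ler_expR.
have N2 : 2 <= n.+1%:R :> R by rewrite ler_nat.
have sol := uc_solution d0 prof (expR_gt0 t).
rewrite qc_xo xt (expR_xs N2 dn) in sol.
have := Hm _ (inS _ sol); rewrite enorm0 /uc mulr0 (W0 prof) div1r.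
have Wk : W L k <= W L (expR t).
  by move: kt'; rewrite le_eqVlt => /predU1P[->//|h]; exact/ltW/(W_lt d0 prof (ltW k0) h).
have : (W L (expR t))^-1 <= (1 - m) / 2.
  by rewrite -[leRHS]invrK -kE lef_pV2 ?posrE ?W_gt0.
by move: (_^-1) => i; lra.
Qed.
End Count.

(** * The threshold on [delta] *)

Lemma discriminant (R : realType) (M d w : R) : w ^+ 2 = M - 1 ->
  (M - 2 * d) ^+ 2 - 8 * (M - 1 - d) = (M - 2 - 2 * d - 2 * w) * (M - 2 - 2 * d + 2 * w).
Proof.
move=> E; have -> : M = w ^+ 2 + 1 by rewrite E subrK.
ring.
Qed.

Section Thresholds.
Context {R : realType}.
Variables (N : nat) (d : R).
Hypotheses (N2 : (2 <= N)%N) (dN : d < N%:R / 2).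

Lemma sqrt_pred : Num.sqrt (N%:R - 1) ^+ 2 = N%:R - 1 :> R.
Proof. by rewrite sqr_sqrtr // subr_ge0 ler1n ltnW. Qed.

Lemma sqrt_pred_ge1 : 1 <= Num.sqrt (N%:R - 1) :> R.
Proof.
have h : 1 <= N%:R - 1 :> R by have : 2 <= N%:R :> R by [rewrite ler_nat]; lra.
by have := ler_wsqrtr h; rewrite sqrtr1.
Qed.

Lemma threshold_le : d <= threshold R N -> 8 * (N%:R - 1 - d) <= (N%:R - 2 * d) ^+ 2.
Proof.
rewrite /threshold => h; rewrite -subr_ge0 (discriminant _ sqrt_pred).
by move: (Num.sqrt _) sqrt_pred_ge1 h => w w1 h; apply: mulr_ge0; lra.
Qed.

(** Below the threshold N - 2 d >= 2 + 2 sqrt(N - 1), and the root exceeds 1 as soon as 3 <= N. *)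
Lemma threshold_le4 : d <= threshold R N -> (3 <= N)%N -> 4 < N%:R - 2 * d.
Proof.
move=> + N3; have : 1 < Num.sqrt (N%:R - 1) :> R.
  have h : 1 < N%:R - 1 :> R by have : 3 <= N%:R :> R by [rewrite ler_nat]; lra.
  by have := h; rewrite -(ltr_sqrt _ (lt_trans ltr01 h)) sqrtr1.
by rewrite /threshold; move: (Num.sqrt _) => w w1; lra.
Qed.

(** Beyond the threshold the first factor of [discriminant] is negative; the second is positive
    because 2 d < N and sqrt(N - 1) >= 1. *)
Lemma threshold_lt : threshold R N < d -> (N%:R - 2 * d) ^+ 2 < 8 * (N%:R - 1 - d).
Proof.
rewrite /threshold => h; rewrite -subr_lt0 (discriminant _ sqrt_pred).
move: (Num.sqrt _) sqrt_pred_ge1 dN h => w w1 h1 h.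
by rewrite nmulr_rlt0; lra.
Qed.
End Thresholds.

Lemma threshold_lt0 (R : realType) (N : nat) : (2 <= N <= 6)%N -> threshold R N < 0.
Proof.
move=> /andP[N2 N6]; rewrite /threshold.
have N2' : 2 <= N%:R :> R by rewrite ler_nat.
have N6' : N%:R <= 6 :> R by rewrite ler_nat.
have [w0 w2] : 0 <= Num.sqrt (N%:R - 1) :> R /\ Num.sqrt (N%:R - 1) ^+ 2 = N%:R - 1 :> R.
  by rewrite sqr_sqrtr ?sqrtr_ge0 //; lra.
rewrite ltr_pdivrMr // mul0r; move: (Num.sqrt _) w0 w2 => w w0 w2.
nra.
Qed.

Theorem theorem1p1 (R : realType) (N : nat) (delta lambdastar : R)
  (hN : (2 <= N)%N) (hdelta : 0 < delta < N%:R / 2)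
  (hlambdastar : lambdastar = N%:R - 1 - delta) :
  (* (i) *)
  ((3 <= N)%N /\ delta <= threshold R N ->
     [/\ typeI N delta lambdastar,
         unique_rupture_solution delta lambdastar (@Ustar R N)
       & forall lambda : R, 0 < lambda < lambdastar ->
           exactly_one_radial_regular N delta lambda])
  /\
  (* (ii) *)
  (((3 <= N)%N /\ threshold R N < delta) \/ N = 2%N ->
     [/\ typeII N delta lambdastar,
         unique_rupture_solution delta lambdastar (@Ustar R N)
       & infinitely_many_radial_regular N delta lambdastar])
  /\
  (* the special case 3 <= N <= 6 of (ii) *)
  ((3 <= N <= 6)%N ->
     threshold R N < 0 /\
     [/\ typeII N delta lambdastar,
         unique_rupture_solution delta lambdastar (@Ustar R N)
       & infinitely_many_radial_regular N delta lambdastar]).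
Proof.
move: hdelta => /andP[d0 dN]; rewrite {lambdastar}hlambdastar.
have dn : 0 < N%:R - 2 * delta by lra.
case: N hN dN dn => [//|n] hN dN dn; have n0 : (0 < n)%N by [].
have [L [L' prof]] := profile n0 d0 dn.
have rupt := rupture_unique n0 d0 dn.
(* All cases of (ii) pass through this implication: for N = 2 and for 3 <= N <= 6 the threshold is
   negative, hence below [delta]. *)
have II : threshold R n.+1 < delta ->
    [/\ typeII n.+1 delta (n.+1%:R - 1 - delta),
        unique_rupture_solution delta (n.+1%:R - 1 - delta) (@Ustar R n.+1)
      & infinitely_many_radial_regular n.+1 delta (n.+1%:R - 1 - delta)].
  move=> /(threshold_lt hN dN) cl; split=> //; first exact: (curve_typeII n0 d0 dn prof cl).
  exact: (regular_infinite n0 d0 dn prof cl).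
split; [|split].
- move=> [N3 thr]; have cl := threshold_le hN thr; have c4 := threshold_le4 thr N3.
  split=> //; first exact: (curve_typeI n0 d0 dn prof cl c4).
  by move=> lambda; exact: (regular_unique n0 d0 dn prof cl c4).
- case=> [[_]|N2]; first exact: II.
  by apply/II/lt_trans/d0/threshold_lt0; rewrite N2.
- move=> /andP[N3 N6]; have t0 : threshold R n.+1 < 0 by rewrite threshold_lt0 // hN N6.
  by split=> //; apply: II; exact: lt_trans t0 d0.
Qed.
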